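(* Let $(a_j)_{j\in\mathbb{Z}}$ be complex numbers with $\sum_{j\in\mathbb{Z}}|a_j|<\infty$. For $M>1$ let $A=A_M:=[a_{i-j}]_{i,j=1}^M$, and let $A^+_\infty:=[a_{i-j}]_{i,j\in\mathbb{N}}$, a bounded operator on $\ell^2(\mathbb{N})$. Write $A$ in block form $A=[a_{ij}]_{i,j=1}^N$ with blocks $a_{ij}\in\mathbb{C}^{m_i\times m_j}$, $\sum_{i=1}^Nm_i=M$, $N>1$, and let $w:=\min_{1\le i\le N}m_i$. Suppose $\varepsilon>0$. Then $\mathrm{Spec}_\varepsilon A\to\mathrm{Spec}_\varepsilon A^+_\infty$ in the Hausdorff distance as $M\to\infty$. Further, $\Gamma^n_\varepsilon(A)\to\mathrm{Spec}_\varepsilon A^+_\infty$ in the Hausdorff distance as $n,M,w\to\infty$ (with $1\le n\le N-1$). Thus $d_H(\Gamma^n_\varepsilon(A),\mathrm{Spec}_\varepsilon A)\to0$ as $M,n,w\to\infty$. If $a_{-j}=\overline{a_j}$ for all $j\in\mathbb{Z}$, then these results hold also for $\varepsilon=0$; in particular $d_H(\Gamma^n_0(A),\mathrm{Spec}\,A)\to0$ as $M,n,w\to\infty$.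
   Context: All norms are (spectral) $2$-norms/operator norms; $s_{\min}(E):=\min_{\|x\|=1}\|Ex\|$ is the smallest singular value of a (square or tall) matrix. For a square matrix or bounded operator $E$ on a Hilbert space and $\varepsilon\ge0$, $\mathrm{Spec}_\varepsilon E:=\{\lambda\in\mathbb{C}:\|(E-\lambda I)^{-1}\|^{-1}\le\varepsilon\}$, with $\|(E-\lambda I)^{-1}\|^{-1}:=0$ if $E-\lambda I$ is not invertible; $\mathrm{Spec}_0E=\mathrm{Spec}\,E$. The Hausdorff distance between compact $T_1,T_2\subset\mathbb{C}$ is $d_H(T_1,T_2):=\max\{\sup_{t_1\in T_1}\mathrm{dist}(t_1,T_2),\sup_{t_2\in T_2}\mathrm{dist}(t_2,T_1)\}$. (Double-indexed $a_{ij}$ are blocks of $A$; single-indexed $a_j$ are the Toeplitz coefficients.) Tridiagonal part: $B=[b_{ij}]_{i,j=1}^N$ with $b_{ij}:=a_{ij}$ if $|i-j|\le1$, $b_{ij}:=0$ otherwise; $C:=A-B$. Put $r_L(A):=\max_{1\le i\le N-1}\|a_{i+1,i}\|$, $r_U(A):=\max_{1\le i\le N-1}\|a_{i,i+1}\|$, $r(A):=r_L(A)+r_U(A)$, and $\varepsilon'_n(A):=2r(A)\sin\left(\frac{\pi}{2n+2}\right)+\|C\|$. For $1\le n\le N$, $0\le k\le N-n$, $B_{n,k}:=[b_{ij}]_{i,j=k+1}^{k+n}$. Let $b_{0,1}$ and $b_{N+1,N}$ be zero matrices of dimensions $1\times m_1$ and $1\times m_N$. $B^+_{n,k}$ is the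 $(n+2)\times n$ block matrix whose first block row is $(b_{k,k+1},0,\ldots,0)$, whose middle $n$ block rows are $B_{n,k}$, and whose last block row is $(0,\ldots,0,b_{k+n+1,k+n})$ (zero blocks of consistent dimensions). $I^+_n$ is the block matrix of the same dimensions with first and last block rows zero and middle $n$ block rows the identity. $\mathrm{Spec}_\varepsilon B^+_{n,k}:=\{\lambda\in\mathbb{C}:s_{\min}(B^+_{n,k}-\lambda I^+_n)\le\varepsilon\}$. For $\varepsilon\ge0$ and $n=1,\ldots,N-1$, $\Gamma^n_\varepsilon(A):=\bigcup_{k=0}^{N-n}\mathrm{Spec}_{\varepsilon+\varepsilon'_n(A)}B^+_{n,k}$. Limits as $n,M,w\to\infty$ are over all such data: for every $\delta>0$ there is $K$ such that the distance is $<\delta$ whenever $n,M,w\ge K$ and $1\le n\le N-1$. *)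

(* Defs.v *)
From HB Require Import structures.
From mathcomp Require Import all_boot all_order all_algebra.
From mathcomp Require Import all_classical all_reals all_analysis.
From mathcomp Require Import complex.
Import Order.TTheory GRing.Theory Num.Theory.
Import numFieldNormedType.Exports.
Import Normc.

Set Implicit Arguments.
Unset Strict Implicit.
Unset Printing Implicit Defensive.

Local Open Scope classical_set_scope.
Local Open Scope ring_scope.

(* The modulus of z : R[i] is taken to be [normc z : R]; the generic [`|z|] is
   the same number, but seen as an element of R[i]. *)

Section MatrixNorms.
Variable R : realType.
Local Notation C := R[i].

Definition vnorm n (x : 'cV[C]_n) : R := Num.sqrt (\sum_i normc (x i 0) ^+ 2).

Definition mxnorm m n (E : 'M[C]_(m, n)) : R :=
  sup [set vnorm (E *m x) | x in [set x : 'cV[C]_n | vnorm x <= 1]].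

(* For n > 0 the unit sphere is compact and nonempty, so this is a minimum. *)
Definition smin m n (E : 'M[C]_(m, n)) : R :=
  inf [set vnorm (E *m x) | x in [set x : 'cV[C]_n | vnorm x = 1]].

Definition mx_invnorm n (E : 'M[C]_n) : R :=
  if E \in unitmx then (mxnorm (invmx E))^-1 else 0.

Definition mx_pspec n (eps : R) (E : 'M[C]_n) : set C :=
  [set lambda | mx_invnorm (E - lambda%:M) <= eps].

Definition mx_spec n (E : 'M[C]_n) : set C :=
  [set lambda | E - lambda%:M \notin unitmx].

End MatrixNorms.

(* Operators on l^2(nat) are maps on all sequences, considered only through
   their values on the set [ell2]. *)
Section SequenceSpace.
Variable R : realType.
Local Notation C := R[i].
Implicit Types (x y : nat -> C) (S T : (nat -> C) -> (nat -> C)).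

Definition ell2 : set (nat -> C) :=
  [set x | cvgn (series (fun k => normc (x k) ^+ 2))].

Definition ell2_norm x : R :=
  Num.sqrt (limn (series (fun k => normc (x k) ^+ 2))).

Definition ell2_bounded_operator T : Prop :=
  [/\ forall x, ell2 x -> ell2 (T x),
      forall (c : C) x y, ell2 x -> ell2 y ->
        T (fun k => c * x k + y k) = (fun k => c * T x k + T y k)
    & exists K : R, forall x, ell2 x -> ell2_norm (T x) <= K * ell2_norm x].

Definition ell2_opnorm T : R :=
  sup [set ell2_norm (T x) | x in [set x | ell2 x /\ ell2_norm x <= 1]].

Definition ell2_is_inverse T S : Prop :=
  ell2_bounded_operator S /\
  forall x, ell2 x -> S (T x) = x /\ T (S x) = x.

(* An inverse is determined on [ell2], hence so is its operator norm: the
   value does not depend on the inverse picked by [cid]. *)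
Definition ell2_invnorm T : R :=
  match pselect (exists S, ell2_is_inverse T S) with
  | left invT => (ell2_opnorm (sval (cid invT)))^-1
  | right _ => 0
  end.

Definition ell2_pspec (eps : R) T : set C :=
  [set lambda | ell2_invnorm (fun x k => T x k - lambda * x k) <= eps].

End SequenceSpace.

Section Toeplitz.
Variables (R : realType) (a : int -> R[i]).

Definition toeplitz_mx M : 'M[R[i]]_M :=
  \matrix_(i, j) a ((i : nat)%:Z - (j : nat)%:Z).

(* The topology on the complex numbers is carried by the alias [R[i]^o]. *)
Definition toeplitz_op (x : nat -> R[i]) : nat -> R[i] :=
  fun i => limn (series (fun j : nat => a (i%:Z - j%:Z) * x j : R[i]^o)).

End Toeplitz.

(* The values are extended reals, with the usual conventions for suprema and
   infima; for nonempty compact sets the distance is finite. *)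
Section Hausdorff.
Variable R : realType.
Local Open Scope ereal_scope.

Definition set_dist (z : R[i]) (T : set R[i]) : \bar R :=
  ereal_inf [set (normc (z - t)%R)%:E | t in T].

Definition hausdorff_dist (T1 T2 : set R[i]) : \bar R :=
  maxe (ereal_sup [set set_dist t T2 | t in T1])
       (ereal_sup [set set_dist t T1 | t in T2]).

End Hausdorff.

(* A matrix A of order \sum_i m i is in block form with blocks
   [submxblock A i j : 'M_(m i, m j)], where i, j : 'I_N count from 0. *)
Section Blocks.
Variables (R : realType) (N : nat) (m : 'I_N -> nat).
Local Notation C := R[i].
Local Notation M := (\sum_i m i)%N.
Implicit Type A : 'M[C]_M.

(* The initial value of the iterated minimum is an upper bound of the m i. *)
Definition min_block_size : nat := \big[minn/M]_(i < N) m i.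

Definition tridiag_part A : 'M[C]_M :=
  \mxblock_(i < N, j < N)
    (if ((i <= j.+1) && (j <= i.+1))%N then submxblock A i j else 0).

Definition r_L A : R :=
  \big[Num.max/0]_(p : 'I_N * 'I_N | p.1 == p.2.+1 :> nat)
    mxnorm (submxblock A p.1 p.2).

Definition r_U A : R :=
  \big[Num.max/0]_(p : 'I_N * 'I_N | p.2 == p.1.+1 :> nat)
    mxnorm (submxblock A p.1 p.2).

Definition eps' (n : nat) A : R :=
  2 * (r_L A + r_U A) * sin (pi / (2 * n%:R + 2)) + mxnorm (A - tridiag_part A).

(* Block positions counted from 1, as in b_{k,k+1}: position i in 1..N is block
   [Some _], and the fictitious positions 0 and N+1 are [None], of size 1. *)
Definition pos (i : nat) : option 'I_N := if i is i'.+1 then insub i' else None.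

Definition xsize (u : option 'I_N) : nat := if u is Some i then m i else 1.

Definition xblock (B : 'M[C]_M) (u v : option 'I_N) : 'M[C]_(xsize u, xsize v) :=
  match u, v with
  | Some i, Some j => submxblock B i j
  | _, _ => 0
  end.

Section Truncation.
Variables n k : nat.

Definition msize (j : 'I_n) : nat := xsize (pos (k + j.+1)%N).

Local Notation msum := (\sum_j msize j)%N.

Definition Bnk (B : 'M[C]_M) : 'M[C]_msum :=
  \mxblock_(i < n, j < n) (xblock B (pos (k + i.+1)%N) (pos (k + j.+1)%N)).

Definition Btop (B : 'M[C]_M) : 'M[C]_(xsize (pos k), msum) :=
  \mxrow_(j < n)
    (if j == 0 :> nat then xblock B (pos k) (pos (k + j.+1)%N) else 0).

Definition Bbot (B : 'M[C]_M) : 'M[C]_(xsize (pos (k + n.+1)%N), msum) :=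
  \mxrow_(j < n)
    (if j.+1 == n then xblock B (pos (k + n.+1)%N) (pos (k + j.+1)%N) else 0).

Definition Bplus (B : 'M[C]_M) := col_mx (Btop B) (col_mx (Bnk B) (Bbot B)).

Definition Iplus :
    'M[C]_((xsize (pos k) + (msum + xsize (pos (k + n.+1))))%N, msum) :=
  col_mx 0 (col_mx 1%:M 0).

Definition Bplus_pspec (eps : R) (B : 'M[C]_M) : set C :=
  [set lambda | smin (Bplus B - lambda *: Iplus) <= eps].

End Truncation.

Definition Gamma (n : nat) (eps : R) A : set C :=
  \bigcup_(k in [set k | (k <= N - n)%N])
    Bplus_pspec n k (eps + eps' n A) (tridiag_part A).

End Blocks.

(* d N m n -> 0 as n, M = \sum_i m i and the minimal block size tend to
   infinity, over all block structures with at least two nonempty blocks. *)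
Definition block_cvg0 (R : realType)
    (d : forall N : nat, ('I_N -> nat) -> nat -> \bar R) : Prop :=
  forall delta : R, 0 < delta -> exists K : nat,
    forall (N : nat) (m : 'I_N -> nat) (n : nat),
      (1 < N)%N -> (forall i, (0 < m i)%N) -> (1 <= n <= N - 1)%N ->
      (K <= n)%N -> (K <= \sum_i m i)%N -> (K <= min_block_size m)%N ->
      (d N m n < delta%:E)%E.

(* Main.v *)
Require Import Defs.
From mathcomp Require Import all_boot all_order all_algebra.
From mathcomp Require Import all_classical all_reals all_analysis.
From mathcomp Require Import complex ring lra zify.
Import Order.TTheory GRing.Theory Num.Theory.
Import numFieldNormedType.Exports.
Import Normc.

Set Implicit Arguments.
Unset Strict Implicit.
Unset Printing Implicit Defensive.

Local Open Scope classical_set_scope.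
Local Open Scope ring_scope.

(** Write [T] for the Toeplitz operator [T(a)] on l^2, [A_M] for its sections, and
    [smin] for the smallest singular value; for a square matrix
    [mx_invnorm E = smin E] ([mx_invnormE]). Both pseudospectra are sublevel sets,
    of [smin (A_M - l)] and of the number [nu l = ell2_invnorm (T - l)], and the
    two convergence statements come from comparing these functions of [l].

    [nu l > s] forces [smin (A_M - l) >= s] for large [M] ([sections_stable]).
    Cut an almost minimizing vector of [A_M - l] with two slowly varying functions
    whose squares add up to 1. One piece fades out before the right end of the
    section, where it cannot tell [A_M] from [T]; the other fades out before the
    left end, and after a reversal of the order it cannot tell [A_M] from the
    transpose of [T], which has the same lower bound. The commutators with the
    cut-offs are small because [a] is summable and Schur's test bounds matrices
    whose entries are dominated by a function of [i - j].

    Conversely [smin (A_M - l) >= c > 0] for infinitely many [M] forces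
    [nu l >= c] ([sections_invnorm]): the solutions of the sections of
    [(T - l) x = y] are bounded by [|y| / c], and a coordinatewise limit along an
    ultrafilter solves the infinite system. So if [nu l <= eps], then
    [smin (A_M - l)] is eventually below [eps + eta], for each [eta > 0], and one has
    to move [l] a little to reach [eps]. For [eps > 0] this is the fact that resolvent
    norms have no plateau ([pspec_no_plateau]), in a form that depends only on a
    bound for the norm of the matrix, hence not on [M]. For hermitian symbols and
    [eps = 0] the sections are normal, and a normal matrix has an eigenvalue at
    distance at most [smin (E - l)] from [l] ([normal_eigenvalue_near]). Since
    [smin (E - l)] is 1-Lipschitz in [l], compactness of discs makes these pointwise
    statements uniform ([locally_uniform_disc]).

    The sets [Gamma] are squeezed between pseudospectra of sections. On the one hand,
    the square part of a window of [n] blocks is a section of order at least [n], up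
    to an error which is a tail of the sum of the [|a_j|] ([Gamma_section]), and
    [eps'_n] tends to 0. On the other hand [Spec_eps A] is contained in
    [Gamma^n_eps A] for every block matrix [A] ([pspec_sub_Gamma]): weight a vector
    by all translates of the sine profile [sin (pi j / (n + 1))], which minimizes the
    quotient of the l^2 norms of the differences and of the values of a sequence
    supported on [n] points, and take the mean over the translates. *)

(** * The modulus and finite l^2 norms *)

Section Modulus.
Variable R : realType.
Implicit Types z w : R[i].

Lemma normc_ge0 z : 0 <= normc z.
Proof. by case: z => u v; rewrite sqrtr_ge0. Qed.

Lemma normc_distC z w : normc (z - w) = normc (w - z).
Proof. by rewrite -normcN opprB. Qed.

Lemma normc_lt0 z : (0 < normc z) = (z != 0).
Proof.
rewrite lt_def normc_ge0 andbT; congr negb.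
by apply/eqP/eqP => [/eq0_normc //| ->]; exact: normc0.
Qed.

Lemma normc_triangle z w t : normc (z - t) <= normc (z - w) + normc (w - t).
Proof. by rewrite (le_trans _ (le_normcD _ _)) // addrA subrK. Qed.

Lemma normc_sum (I : Type) (r : seq I) (P : pred I) (F : I -> R[i]) :
  normc (\sum_(i <- r | P i) F i) <= \sum_(i <- r | P i) normc (F i).
Proof.
elim/big_ind2: _ => [|a b c d ab cd|//]; first by rewrite normc0.
by rewrite (le_trans (le_normcD _ _)) // lerD.
Qed.

Lemma normc_real (x : R) : normc x%:C%C = `|x|.
Proof. by rewrite /normc /= expr0n /= addr0 sqrtr_sqr. Qed.

Lemma normc_conj z : normc (conjc z) = normc z.
Proof. by case: z => u v; rewrite /normc /= sqrrN. Qed.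

Lemma mulc_conj z : z * conjc z = (normc z ^+ 2)%:C%C.
Proof.
case: z => u v; rewrite /normc sqr_sqrtr ?addr_ge0 ?sqr_ge0 //.
by apply/eqP; rewrite eq_complex /=; apply/andP; split; apply/eqP; ring.
Qed.

Lemma normc_parallelogram z w : normc (z + w) ^+ 2 + normc (z - w) ^+ 2 =
  2 * (normc z ^+ 2 + normc w ^+ 2).
Proof.
case: z w => [a b] [c d]; rewrite /normc !sqr_sqrtr ?addr_ge0 ?sqr_ge0 //=.
by ring.
Qed.

Lemma absRe_le_normc z : `|complex.Re z| <= normc z.
Proof.
case: z => a b /=; rewrite -sqrtr_sqr ler_sqrt ?addr_ge0 ?sqr_ge0 //.
by rewrite lerDl sqr_ge0.
Qed.

Lemma absIm_le_normc z : `|complex.Im z| <= normc z.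
Proof.
case: z => a b /=; rewrite -sqrtr_sqr ler_sqrt ?addr_ge0 ?sqr_ge0 //.
by rewrite lerDr sqr_ge0.
Qed.

Lemma normc_le_ReIm z : normc z <= `|complex.Re z| + `|complex.Im z|.
Proof.
case: z => a b /=; rewrite -(ger0_norm (addr_ge0 (normr_ge0 a) (normr_ge0 b))).
rewrite -sqrtr_sqr ler_sqrt ?sqr_ge0 // sqrrD !real_normK ?num_real //.
by rewrite addrAC lerDl mulrn_wge0 ?mulr_ge0.
Qed.

End Modulus.

Section FiniteL2.
Variable R : realType.
Local Notation C := R[i].

Definition l2 (I : finType) (f : I -> C) : R :=
  Num.sqrt (\sum_i normc (f i) ^+ 2).

Section OneIndex.
Variable I : finType.
Implicit Types f g : I -> C.

Lemma sumsq_ge0 f : 0 <= \sum_i normc (f i) ^+ 2.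
Proof. by apply: sumr_ge0 => i _; rewrite sqr_ge0. Qed.

Lemma l2_ge0 f : 0 <= l2 f.
Proof. exact: sqrtr_ge0. Qed.

Lemma sqr_l2 f : l2 f ^+ 2 = \sum_i normc (f i) ^+ 2.
Proof. by rewrite sqr_sqrtr ?sumsq_ge0. Qed.

Lemma l2_le f (b : R) : 0 <= b -> (l2 f <= b) = (\sum_i normc (f i) ^+ 2 <= b ^+ 2).
Proof. by move=> b0; rewrite -sqr_l2 ler_sqr ?nnegrE ?l2_ge0. Qed.

Lemma eq_l2 f g : f =1 g -> l2 f = l2 g.
Proof. by move=> fg; rewrite /l2; under eq_bigr do rewrite fg. Qed.

Lemma l2_eq0 f : l2 f = 0 -> forall i, f i = 0.
Proof.
move=> /(congr1 (fun t => t ^+ 2)); rewrite sqr_l2 expr0n /= => /eqP.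
rewrite psumr_eq0 => [/allP h i|i _]; last exact: sqr_ge0.
have /= := h i (mem_index_enum _); rewrite sqrf_eq0 => /eqP; exact: eq0_normc.
Qed.

Lemma l2_le_mono f g : (forall i, normc (f i) <= normc (g i)) -> l2 f <= l2 g.
Proof.
move=> fg; rewrite l2_le ?l2_ge0 // sqr_l2; apply: ler_sum => i _.
by rewrite ler_sqr ?nnegrE ?normc_ge0.
Qed.

Lemma normc_le_l2 f i : normc (f i) <= l2 f.
Proof.
rewrite -ler_sqr ?nnegrE ?normc_ge0 ?l2_ge0 // sqr_l2 (bigD1 i) //= lerDl.
by apply: sumr_ge0 => j _; rewrite sqr_ge0.
Qed.

Lemma l2Z (c : C) f : l2 (fun i => c * f i) = normc c * l2 f.
Proof.
apply/eqP; rewrite -(@eqrXn2 _ 2) ?mulr_ge0 ?l2_ge0 ?normc_ge0 //.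
rewrite exprMn !sqr_l2 mulr_sumr; apply/eqP/eq_bigr => i _.
by rewrite normcM exprMn.
Qed.

Lemma l2N f : l2 (fun i => - f i) = l2 f.
Proof. by congr Num.sqrt; apply: eq_bigr => i _; rewrite normcN. Qed.

Lemma l20 f : (forall i, f i = 0) -> l2 f = 0.
Proof.
by move=> f0; rewrite /l2 big1 ?sqrtr0 // => i _; rewrite f0 normc0 expr0n.
Qed.

Lemma cauchy_schwarz_real (u v : I -> R) (a b : R) :
  0 <= a -> 0 <= b -> \sum_i u i ^+ 2 <= a ^+ 2 -> \sum_i v i ^+ 2 <= b ^+ 2 ->
  \sum_i u i * v i <= a * b.
Proof.
move=> a0 b0 ua vb.
have zero (w : I -> R) : \sum_i w i ^+ 2 <= 0 -> forall i, w i = 0.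
  move=> w0 i; apply/eqP; rewrite -sqrf_eq0.
  have : \sum_i w i ^+ 2 == 0.
    by rewrite eq_le w0 sumr_ge0 // => j _; exact: sqr_ge0.
  rewrite psumr_eq0 => [/allP/(_ i (mem_index_enum _)) //|j _]; exact: sqr_ge0.
have [a_eq0|an0] := eqVneq a 0.
  rewrite a_eq0 mul0r big1 // => i _.
  by rewrite (zero u) ?mul0r // (le_trans ua) // a_eq0 expr0n.
have [b_eq0|bn0] := eqVneq b 0.
  rewrite b_eq0 mulr0 big1 // => i _.
  by rewrite (zero v) ?mulr0 // (le_trans vb) // b_eq0 expr0n.
have ab0 : 0 < a * b by rewrite lt_def mulf_neq0 //= mulr_ge0.
suff : 2 * (\sum_i u i * v i) * (a * b) <= 2 * (a * b) * (a * b).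
  by rewrite ler_pM2r // ler_pM2l.
have : \sum_i (b * u i - a * v i) ^+ 2 >= 0.
  by apply: sumr_ge0 => i _; exact: sqr_ge0.
under eq_bigr => i _.
  have -> : (b * u i - a * v i) ^+ 2 =
      b ^+ 2 * u i ^+ 2 + (a ^+ 2 * v i ^+ 2 - 2 * (a * b) * (u i * v i)) by ring.
  over.
rewrite big_split sumrB /= -!mulr_sumr => h.
have hu : b ^+ 2 * \sum_i u i ^+ 2 <= b ^+ 2 * a ^+ 2 by rewrite ler_wpM2l ?sqr_ge0.
have hv : a ^+ 2 * \sum_i v i ^+ 2 <= a ^+ 2 * b ^+ 2 by rewrite ler_wpM2l ?sqr_ge0.
nra.
Qed.

Lemma cauchy_schwarz f g : normc (\sum_i f i * g i) <= l2 f * l2 g.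
Proof.
apply: le_trans (normc_sum _ _ _) _.
under eq_bigr do rewrite normcM.
by apply: cauchy_schwarz_real; rewrite ?l2_ge0 // sqr_l2.
Qed.

Lemma l2D f g : l2 (fun i => f i + g i) <= l2 f + l2 g.
Proof.
rewrite l2_le ?addr_ge0 ?l2_ge0 //.
apply: (@le_trans _ _ (\sum_i (normc (f i) + normc (g i)) ^+ 2)).
  apply: ler_sum => i _.
  by rewrite ler_sqr ?nnegrE ?addr_ge0 ?normc_ge0 ?le_normcD.
have cs : \sum_i normc (f i) * normc (g i) <= l2 f * l2 g.
  by apply: cauchy_schwarz_real; rewrite ?l2_ge0 // sqr_l2.
under eq_bigr => i _.
  have -> : (normc (f i) + normc (g i)) ^+ 2 = normc (f i) ^+ 2 +
      (normc (g i) ^+ 2 + 2 * (normc (f i) * normc (g i))) by ring.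
  over.
by rewrite !big_split /= -mulr_sumr -!sqr_l2; nra.
Qed.

Lemma l2B f g : l2 (fun i => f i - g i) <= l2 f + l2 g.
Proof. by rewrite -(l2N g); exact: l2D. Qed.

End OneIndex.

(** Cauchy--Schwarz with the weight [normc (k i j)] in each row, then an
    exchange of the two sums. *)
Lemma schur_test (I J : finType) (k : I -> J -> C) (G : R) (x : J -> C) :
    0 <= G ->
    (forall i, \sum_j normc (k i j) <= G) ->
    (forall j, \sum_i normc (k i j) <= G) ->
  l2 (fun i => \sum_j k i j * x j) <= G * l2 x.
Proof.
move=> G0 rowG colG.
rewrite l2_le ?mulr_ge0 ?l2_ge0 // exprMn sqr_l2.
pose s i := \sum_j normc (k i j) * normc (x j) ^+ 2.
have s0 i : 0 <= s i.
  by apply: sumr_ge0 => j _; rewrite mulr_ge0 ?normc_ge0 ?sqr_ge0.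
have row i : normc (\sum_j k i j * x j) ^+ 2 <= G * s i.
  rewrite -[leRHS]sqr_sqrtr ?mulr_ge0 // ler_sqr ?nnegrE ?normc_ge0 ?sqrtr_ge0 //.
  apply: le_trans (normc_sum _ _ _) _.
  rewrite sqrtrM //.
  pose r j := Num.sqrt (normc (k i j)).
  have rr j : r j ^+ 2 = normc (k i j) by rewrite sqr_sqrtr ?normc_ge0.
  under eq_bigr => j _ do rewrite normcM -rr expr2 -mulrA.
  apply: cauchy_schwarz_real; rewrite ?sqrtr_ge0 // sqr_sqrtr //.
    by under eq_bigr do rewrite rr.
  by under eq_bigr do rewrite exprMn rr.
apply: (@le_trans _ _ (\sum_i G * s i)); first by apply: ler_sum => i _.
rewrite -mulr_sumr expr2 -mulrA ler_wpM2l // exchange_big /= mulr_sumr.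
by apply: ler_sum => j _; rewrite -mulr_suml ler_wpM2r ?sqr_ge0.
Qed.

End FiniteL2.

(** * Smallest singular values *)

Section SmallestSingularValue.
Variable R : realType.
Local Notation C := R[i].

Lemma vnormE n (x : 'cV[C]_n) : vnorm x = l2 (fun i => x i 0).
Proof. by []. Qed.

Lemma vnorm_ge0 n (x : 'cV[C]_n) : 0 <= vnorm x.
Proof. exact: l2_ge0. Qed.

Lemma vnormZ n (c : C) (x : 'cV[C]_n) : vnorm (c *: x) = normc c * vnorm x.
Proof. by rewrite !vnormE -l2Z; apply: eq_l2 => i; rewrite mxE. Qed.

Lemma vnormN n (x : 'cV[C]_n) : vnorm (- x) = vnorm x.
Proof. by rewrite !vnormE -(l2N (fun i => x i 0)); apply: eq_l2 => i; rewrite mxE. Qed.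

Lemma vnormD n (x y : 'cV[C]_n) : vnorm (x + y) <= vnorm x + vnorm y.
Proof.
rewrite !vnormE (le_trans _ (l2D _ _)) //.
by apply/l2_le_mono => i; rewrite mxE.
Qed.

Lemma vnorm_sub_le n (x y : 'cV[C]_n) : vnorm x - vnorm y <= vnorm (x + y).
Proof. by rewrite lerBlDr -{1}(addrK y x) -(vnormN y) vnormD. Qed.

Lemma vnorm_eq0 n (x : 'cV[C]_n) : (vnorm x == 0) = (x == 0).
Proof.
apply/eqP/eqP => [/l2_eq0 x0|->].
  by apply/colP => i; rewrite x0 mxE.
by rewrite vnormE l20 // => i; rewrite mxE.
Qed.

Lemma vnorm0 n : vnorm (0 : 'cV[C]_n) = 0.
Proof. by apply/eqP; rewrite vnorm_eq0. Qed.

Lemma vnorm_parallelogram n (x y : 'cV[C]_n) :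
  vnorm (x + y) ^+ 2 + vnorm (x - y) ^+ 2 = 2 * (vnorm x ^+ 2 + vnorm y ^+ 2).
Proof.
rewrite !vnormE !sqr_l2 -!big_split /= mulr_sumr; apply: eq_bigr => i _.
by rewrite !mxE normc_parallelogram.
Qed.

Lemma vnorm_col_mx m n (x : 'cV[C]_m) (y : 'cV[C]_n) :
  vnorm (col_mx x y) ^+ 2 = vnorm x ^+ 2 + vnorm y ^+ 2.
Proof.
rewrite !vnormE !sqr_l2 big_split_ord /=.
by congr (_ + _); apply: eq_bigr => i _; rewrite ?col_mxEu ?col_mxEd.
Qed.

Lemma mulmx_col m n (E : 'M[C]_(m, n)) (x : 'cV[C]_n) i :
  (E *m x) i 0 = \sum_j E i j * x j 0.
Proof. by rewrite mxE. Qed.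

Lemma mulmx_bounded m n (E : 'M[C]_(m, n)) :
  exists2 K : R, 0 <= K & forall x, vnorm (E *m x) <= K * vnorm x.
Proof.
exists (l2 (fun i => (l2 (E i))%:C%C)); first exact: l2_ge0.
move=> x; rewrite l2_le ?mulr_ge0 ?l2_ge0 // exprMn [X in X * _]sqr_l2 mulr_suml.
apply: ler_sum => i _; rewrite -exprMn ler_sqr ?nnegrE ?mulr_ge0 ?normc_ge0 //.
  by rewrite mulmx_col normc_real ger0_norm ?l2_ge0 // cauchy_schwarz.
exact: l2_ge0.
Qed.

Lemma exists_unit_vector n (x : 'cV[C]_n) : x != 0 ->
  vnorm (((vnorm x)^-1)%:C%C *: x) = 1.
Proof.
move=> x0; rewrite vnormZ normc_real ger0_norm ?invr_ge0 ?vnorm_ge0 //.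
by rewrite mulVf ?vnorm_eq0.
Qed.

Lemma smin_mul_le m n (E : 'M[C]_(m, n)) x : smin E * vnorm x <= vnorm (E *m x).
Proof.
have [->|x0] := eqVneq x 0; first by rewrite vnorm0 mulr0 vnorm_ge0.
have nx : 0 < vnorm x by rewrite lt_def vnorm_eq0 x0 vnorm_ge0.
rewrite -ler_pdivlMr //; apply: ge_inf.
  by exists 0 => _ [y _ <-]; exact: vnorm_ge0.
exists (((vnorm x)^-1)%:C%C *: x); first exact: exists_unit_vector.
rewrite -scalemxAr vnormZ normc_real ger0_norm ?invr_ge0 ?vnorm_ge0 //.
by rewrite mulrC.
Qed.

Lemma le_smin m n (E : 'M[C]_(m, n)) (c : R) : (0 < n)%N ->
  (forall x, c * vnorm x <= vnorm (E *m x)) -> c <= smin E.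
Proof.
move=> n0 cE; apply: lb_le_inf.
  have e0 : (delta_mx (Ordinal n0) 0 : 'cV[C]_n) != 0.
    by apply/eqP => /matrixP/(_ (Ordinal n0) 0)/eqP; rewrite !mxE !eqxx oner_eq0.
  exists (vnorm (E *m (((vnorm (delta_mx (Ordinal n0) 0 : 'cV[C]_n))^-1)%:C%C
    *: delta_mx (Ordinal n0) 0))).
  eexists; last by [].
  exact: exists_unit_vector.
by move=> _ [x /= x1 <-]; rewrite -[c]mulr1 -x1.
Qed.

Lemma smin_ge0 m n (E : 'M[C]_(m, n)) : 0 <= smin E.
Proof.
have [n0|] := ltnP 0 n; first by apply: le_smin => // x; rewrite mul0r vnorm_ge0.
rewrite leqn0 => /eqP n0; subst n; rewrite /smin.
suff -> : [set vnorm (E *m x) | x in [set x : 'cV[C]_0 | vnorm x = 1]] = set0.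
  by rewrite inf0.
apply/seteqP; split=> // _ [x /= x1 _].
by have := vnorm0 0; rewrite -[0](flatmx0 x) x1 => /eqP; rewrite oner_eq0.
Qed.

Lemma smin_lt m n (E : 'M[C]_(m, n)) (s : R) : (0 < n)%N -> smin E < s ->
  exists2 x, vnorm x = 1 & vnorm (E *m x) < s.
Proof.
move=> n0 Es; apply: contrapT => nex.
suff : s <= smin E by rewrite leNgt Es.
apply: le_smin => // x.
have [->|x0] := eqVneq x 0; first by rewrite vnorm0 mulr0 vnorm_ge0.
have nx : 0 < vnorm x by rewrite lt_def vnorm_eq0 x0 vnorm_ge0.
rewrite -ler_pdivlMr // leNgt; apply/negP => lts.
apply: nex; exists (((vnorm x)^-1)%:C%C *: x); first exact: exists_unit_vector.
rewrite -scalemxAr vnormZ normc_real ger0_norm ?invr_ge0 ?vnorm_ge0 //.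
by rewrite mulrC.
Qed.

Lemma smin_perturb m n (E F : 'M[C]_(m, n)) (K : R) : (0 < n)%N ->
  (forall x, vnorm (F *m x) <= K * vnorm x) -> smin E - K <= smin (E + F).
Proof.
move=> n0 FK; apply: le_smin => // x; rewrite mulrBl mulmxDl.
apply: le_trans (vnorm_sub_le _ _).
by apply: lerB; rewrite ?smin_mul_le.
Qed.

Lemma vnorm_scalar_mx n (c : C) (x : 'cV[C]_n) :
  vnorm (c%:M *m x) = normc c * vnorm x.
Proof. by rewrite mul_scalar_mx vnormZ. Qed.

Lemma smin_lipschitz n (E : 'M[C]_n) (l l' : C) : (0 < n)%N ->
  smin (E - l%:M) <= smin (E - l'%:M) + normc (l - l').
Proof.
move=> n0; rewrite -lerBlDr.
have -> : E - l'%:M = E - l%:M + (l - l')%:M.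
  by rewrite raddfB /= addrA subrK.
by apply: smin_perturb => // x; rewrite vnorm_scalar_mx.
Qed.

Lemma mxnorm_mul_le m n (E : 'M[C]_(m, n)) x :
  vnorm (E *m x) <= mxnorm E * vnorm x.
Proof.
have [->|x0] := eqVneq x 0; first by rewrite mulmx0 !vnorm0 mulr0.
have nx : 0 < vnorm x by rewrite lt_def vnorm_eq0 x0 vnorm_ge0.
rewrite -ler_pdivrMr //; apply: ub_le_sup.
  have [K K0 EK] := mulmx_bounded E.
  exists K => _ [y /= y1 <-]; apply: le_trans (EK y) _.
  by rewrite ler_piMr.
exists (((vnorm x)^-1)%:C%C *: x); first by rewrite /= exists_unit_vector.
rewrite -scalemxAr vnormZ normc_real ger0_norm ?invr_ge0 ?vnorm_ge0 //.
by rewrite mulrC.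
Qed.

Lemma mxnorm_le m n (E : 'M[C]_(m, n)) (K : R) : 0 <= K ->
  (forall x, vnorm (E *m x) <= K * vnorm x) -> mxnorm E <= K.
Proof.
move=> K0 EK; apply: ge_sup.
  by exists (vnorm (E *m 0)); exists 0 => //=; rewrite vnorm0.
by move=> _ [y /= y1 <-]; apply: le_trans (EK y) _; rewrite ler_piMr.
Qed.

Lemma mxnorm_ge0 m n (E : 'M[C]_(m, n)) : 0 <= mxnorm E.
Proof.
apply: ub_le_sup; last by exists 0; rewrite /= ?mulmx0 vnorm0.
have [K K0 EK] := mulmx_bounded E.
exists K => _ [y /= y1 <-]; apply: le_trans (EK y) _.
by rewrite ler_piMr.
Qed.

Lemma singular_kernel n (E : 'M[C]_n) : E \notin unitmx ->
  exists2 x : 'cV[C]_n, x != 0 & E *m x = 0.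
Proof.
rewrite -unitmx_tr -row_free_unit -kermx_eq0 => /rowV0Pn[v vk v0].
exists v^T; first by rewrite trmx_eq0.
apply: trmx_inj; rewrite trmx_mul trmxK trmx0.
exact/sub_kermxP.
Qed.

Lemma smin_singular n (E : 'M[C]_n) : E \notin unitmx -> smin E = 0.
Proof.
case/singular_kernel => x x0 Ex; apply/eqP; rewrite eq_le smin_ge0 andbT.
have nx : 0 < vnorm x by rewrite lt_def vnorm_eq0 x0 vnorm_ge0.
by have := smin_mul_le E x; rewrite Ex vnorm0 pmulr_lle0.
Qed.

(** The maximum of [|E^-1 y| / |y|] and the minimum of [|E x| / |x|] are inverse to
    each other, through [y = E x]; a singular matrix has a kernel vector. *)
Lemma mx_invnormE n (E : 'M[C]_n) : (0 < n)%N -> mx_invnorm E = smin E.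
Proof.
move=> n0; rewrite /mx_invnorm; case: ifPn => [uE|/smin_singular //].
have inv x : vnorm x <= mxnorm (invmx E) * vnorm (E *m x).
  by rewrite -{1}(mulKmx uE x) mxnorm_mul_le.
have pos : 0 < mxnorm (invmx E).
  rewrite lt_def mxnorm_ge0 andbT; apply/eqP => m0.
  have := inv (delta_mx (Ordinal n0) 0); rewrite m0 mul0r => h.
  have : vnorm (delta_mx (Ordinal n0) 0 : 'cV[C]_n) == 0.
    by rewrite eq_le h vnorm_ge0.
  rewrite vnorm_eq0 => /eqP/matrixP/(_ (Ordinal n0) 0)/eqP.
  by rewrite !mxE !eqxx oner_eq0.
apply/eqP; rewrite eq_le; apply/andP; split.
  by apply: le_smin => // x; rewrite mulrC ler_pdivrMr // mulrC.
have [s0|s0] := leP (smin E) 0; first by rewrite (le_trans s0) // invr_ge0 ltW.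
rewrite -[leLHS]invrK lef_pV2 ?posrE ?invr_gt0 //.
apply: mxnorm_le; first by rewrite invr_ge0 ltW.
move=> x; rewrite mulrC ler_pdivlMr // mulrC.
by have := smin_mul_le E (invmx E *m x); rewrite mulKVmx.
Qed.

Lemma smin_eq0 n (E : 'M[C]_n) : (0 < n)%N -> (smin E <= 0) = (E \notin unitmx).
Proof.
move=> n0; apply/idP/idP => [|/smin_singular ->//].
apply: contraTN => uE; rewrite -ltNge.
have [K K0 EK] := mulmx_bounded (invmx E).
have K1 : 0 < K + 1 by rewrite ltr_wpDl.
suff : (K + 1)^-1 <= smin E by apply: lt_le_trans; rewrite invr_gt0.
apply: le_smin => // x; rewrite mulrC ler_pdivrMr // mulrC.
rewrite -{1}(mulKmx uE x) (le_trans (EK _)) // ler_wpM2r ?vnorm_ge0 //.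
by rewrite lerDl.
Qed.

End SmallestSingularValue.

Section NoPlateau.
Variable R : realType.
Local Notation C := R[i].

(** With [u_k = E^-k u0] the trial vector is the Taylor polynomial of degree 3, at
    [z], of [(E - z)^-1 E u0]. The error is of order [z^4], and has to be negligible
    compared with the gain of order [z^2] in [four_point_average]. *)
Lemma resolvent_truncation n (E : 'M[C]_n) (u0 u1 u2 u3 : 'cV[C]_n) (z : C) :
  E *m u1 = u0 -> E *m u2 = u1 -> E *m u3 = u2 ->
  (E - z%:M) *m (u0 + z *: u1 + z ^+ 2 *: u2 + z ^+ 3 *: u3) =
  E *m u0 - z ^+ 4 *: u3.
Proof.
move=> E1 E2 E3; rewrite mulmxBl mul_scalar_mx 3!mulmxDr -3!scalemxAr E1 E2 E3.
move: (E *m u0) => v {E1 E2 E3}; apply/colP => i; rewrite !mxE.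
by move: (v i 0) (u0 i 0) (u1 i 0) (u2 i 0) (u3 i 0) => a b c d e; ring.
Qed.

(** Parseval for the fourth roots of unity, in the form of the parallelogram law
    used twice: over the points [rho i^k] the mean of [|Y z|^2] is
    [sum_j rho^(2j) |u_j|^2], and only the first two terms are kept. *)
Lemma four_point_average n (u0 u1 u2 u3 : 'cV[C]_n) (Y : C -> 'cV[C]_n) (rho : R) :
  (forall z, Y z = u0 + z *: u1 + z ^+ 2 *: u2 + z ^+ 3 *: u3) ->
  4 * (vnorm u0 ^+ 2 + rho ^+ 2 * vnorm u1 ^+ 2) <=
  vnorm (Y rho%:C%C) ^+ 2 + vnorm (Y (- rho%:C%C)) ^+ 2 +
  (vnorm (Y (rho%:C * 'i)%C) ^+ 2 + vnorm (Y (- (rho%:C * 'i))%C) ^+ 2).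
Proof.
move=> YE.
have par z : vnorm (Y z) ^+ 2 + vnorm (Y (- z)) ^+ 2 =
    2 * (vnorm (u0 + z ^+ 2 *: u2) ^+ 2
         + normc z ^+ 2 * vnorm (u1 + z ^+ 2 *: u3) ^+ 2).
  have -> : Y z = (u0 + z ^+ 2 *: u2) + z *: (u1 + z ^+ 2 *: u3).
    rewrite YE; apply/colP => i; rewrite !mxE.
    by move: (u0 i 0) (u1 i 0) (u2 i 0) (u3 i 0) => a b c d; ring.
  have -> : Y (- z) = (u0 + z ^+ 2 *: u2) - z *: (u1 + z ^+ 2 *: u3).
    rewrite YE; apply/colP => i; rewrite !mxE.
    by move: (u0 i 0) (u1 i 0) (u2 i 0) (u3 i 0) => a b c d; ring.
  by rewrite vnorm_parallelogram vnormZ exprMn.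
rewrite !par.
have i2 : (rho%:C * 'i)%C ^+ 2 = - (rho%:C%C ^+ 2) :> C.
  by rewrite exprMn sqrCi mulrN1.
have ni : normc (rho%:C * 'i)%C ^+ 2 = normc (rho%:C%C : C) ^+ 2.
  rewrite normcM exprMn [X in _ * X](_ : _ = 1) ?mulr1 //.
  by rewrite -complexiE /normc expr0n expr1n add0r sqrtr1 expr1n.
rewrite ni i2 !scaleNr normc_real -normrX ger0_norm ?sqr_ge0 //.
have p1 := vnorm_parallelogram u0 (rho%:C%C ^+ 2 *: u2).
have p2 := vnorm_parallelogram u1 (rho%:C%C ^+ 2 *: u3).
have := sqr_ge0 (vnorm (rho%:C%C ^+ 2 *: u2)).
have := sqr_ge0 (vnorm (rho%:C%C ^+ 2 *: u3)).
have := sqr_ge0 rho; nra.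
Qed.

Lemma max_ge_average (c p d q1 q2 q3 q4 : R) : 0 < c ->
  4 * p <= q1 + q2 + (q3 + q4) ->
  c * q1 <= d -> c * q2 <= d -> c * q3 <= d -> c * q4 <= d -> c * p <= d.
Proof. by move=> c0 avg; nra. Qed.

(** The budget of [pspec_no_plateau] with [t = rho^2]: the slack [2 eta] and the
    truncation error [t^2 / eps^3] together stay below the gain, which is at least
    [t / kappa^2] relative to [eps^2]. *)
Lemma no_plateau_budget (eps kappa t : R) : 0 < eps -> 0 < kappa -> 0 < t ->
  t <= 4 * kappa ^+ 2 -> t <= eps ^+ 4 / (8 * kappa ^+ 2) ->
  (eps + (2 * (eps * t / (16 * kappa ^+ 2)) + t ^+ 2 / eps ^+ 3)) ^+ 2 <
  eps ^+ 2 * (1 + t / kappa ^+ 2).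
Proof.
move=> e0 k0 t0 tk te.
have k2 : 0 < kappa ^+ 2 by rewrite exprn_gt0.
have kn0 : kappa != 0 by rewrite gt_eqF.
have e3 : 0 < eps ^+ 3 by rewrite exprn_gt0.
have [w wE] : exists w, w = t / kappa ^+ 2 by exists (t / kappa ^+ 2).
have w0 : 0 < w by rewrite wE divr_gt0.
have w4 : w <= 4 by rewrite wE ler_pdivrMr.
have -> : 2 * (eps * t / (16 * kappa ^+ 2)) = eps * w / 8 by rewrite wE; field.
rewrite -wE.
have : t ^+ 2 / eps ^+ 3 <= eps * w / 8.
  rewrite ler_pdivrMr //.
  have -> : eps * w / 8 * eps ^+ 3 = t * (eps ^+ 4 / (8 * kappa ^+ 2)).
    by rewrite wE; field.
  by rewrite expr2 ler_pM2l.
have : 0 <= t ^+ 2 / eps ^+ 3 by rewrite divr_ge0 ?ltW ?exprn_gt0.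
move: (t ^+ 2 / eps ^+ 3) => d d0 dw.
apply: (@le_lt_trans _ _ ((eps + eps * w / 4) ^+ 2)).
  have ew : 0 < eps * w by rewrite mulr_gt0.
  by rewrite ler_sqr ?nnegrE; lra.
have -> : (eps + eps * w / 4) ^+ 2 = eps ^+ 2 * (1 + w / 2 + w ^+ 2 / 16) by field.
by rewrite ltr_pM2l ?exprn_gt0 //; nra.
Qed.

(** Resolvent norms are not locally constant, quantitatively. Let [y] be an almost
    minimizing unit vector of [E]. The mean over the four points [z = rho i^k] of
    [|Y z|^2], for the trial vector [Y z] of [resolvent_truncation], is at least
    [1 + rho^2 |E^-1 y|^2 >= 1 + rho^2 / kappa^2], whereas [(E - z) Y z] has norm
    at most [smin E + O(rho^4)]. So for small [rho] one of the four shifts brings the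
    quotient below [eps]. The matrix enters the choice of [rho] and [eta] only
    through [kappa]. *)
Lemma pspec_no_plateau (eps kappa r : R) : 0 < eps -> 0 < kappa -> 0 < r ->
  exists2 eta : R, 0 < eta & forall n (E : 'M[C]_n), (0 < n)%N ->
    (forall x, vnorm (E *m x) <= kappa * vnorm x) ->
    smin E <= eps + eta ->
    exists2 z : C, normc z <= r & smin (E - z%:M) <= eps.
Proof.
move=> e0 k0 r0.
pose t := Num.min (r ^+ 2) (Num.min (4 * kappa ^+ 2) (eps ^+ 4 / (8 * kappa ^+ 2))).
have k2 : 0 < kappa ^+ 2 by rewrite exprn_gt0.
have e4 : 0 < eps ^+ 4 by rewrite exprn_gt0.
have t0 : 0 < t.
  by rewrite !lt_min !exprn_gt0 //= mulr_gt0 //= divr_gt0 // mulr_gt0.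
have [tr [tk te]] : t <= r ^+ 2 /\ t <= 4 * kappa ^+ 2 /\
    t <= eps ^+ 4 / (8 * kappa ^+ 2).
  by rewrite /t !ge_min !lexx /= !orbT.
exists (eps * t / (16 * kappa ^+ 2)); first by rewrite divr_gt0 ?mulr_gt0.
move=> n E n0 Ek Es; set eta := _ / _ in Es.
have eta0 : 0 < eta by rewrite divr_gt0 ?mulr_gt0.
have [se|/negP] := pselect (smin E <= eps).
  by exists 0; [rewrite normc0 ltW|rewrite raddf0 subr0].
rewrite -ltNge => se.
have uE : E \in unitmx.
  by apply: contraTT se => /smin_singular ->; rewrite -leNgt ltW.
(* The slack 2 eta instead of eta spares an attained minimum. *)
have [y y1 Ey] : exists2 y, vnorm y = 1 & vnorm (E *m y) < eps + 2 * eta.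
  by apply: smin_lt => //; lra.
have [F FE] : exists F, F = invmx E by exists (invmx E).
have uF (v : 'cV[C]_n) : E *m (F *m v) = v by rewrite FE mulKVmx.
have Fb (v : 'cV[C]_n) : eps * vnorm (F *m v) <= vnorm v.
  have := smin_mul_le E (F *m v); rewrite uF.
  by apply: le_trans; rewrite ler_wpM2r ?vnorm_ge0 // ltW.
pose rho := Num.sqrt t.
have rho2 : rho ^+ 2 = t by rewrite sqr_sqrtr // ltW.
have rho_r : rho <= r.
  by rewrite -ler_sqr ?nnegrE ?sqrtr_ge0 ?rho2 // ltW.
apply: contrapT => nex.
pose Y (z : C) := y + z *: (F *m y) + z ^+ 2 *: (F *m (F *m y))
    + z ^+ 3 *: (F *m (F *m (F *m y))).
have F3 : eps ^+ 3 * vnorm (F *m (F *m (F *m y))) <= 1.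
  have h1 := Fb y; have h2 := Fb (F *m y); have h3 := Fb (F *m (F *m y)).
  rewrite y1 in h1.
  have -> : eps ^+ 3 * vnorm (F *m (F *m (F *m y))) =
    eps * (eps * (eps * vnorm (F *m (F *m (F *m y))))) by ring.
  apply: le_trans h1; rewrite ler_pM2l //; apply: le_trans h2.
  by rewrite ler_pM2l.
pose del := 2 * eta + t ^+ 2 / eps ^+ 3.
have del0 : 0 <= del.
  apply: addr_ge0; first by rewrite mulr_ge0 // ltW.
  by rewrite divr_ge0 // exprn_ge0 ?ltW.
have YE z : normc z = rho -> eps ^+ 2 * vnorm (Y z) ^+ 2 <= (eps + del) ^+ 2.
  move=> nz; rewrite -exprMn ler_sqr ?nnegrE; last 2 first.
  - by rewrite mulr_ge0 ?vnorm_ge0 ?(ltW e0).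
  - by rewrite addr_ge0 ?(ltW e0).
  have sz : eps <= smin (E - z%:M).
    rewrite leNgt; apply/negP => sz; apply: nex; exists z; rewrite ?nz //.
    exact: ltW.
  apply: (@le_trans _ _ (vnorm ((E - z%:M) *m Y z))).
    by apply: le_trans (smin_mul_le _ _); rewrite ler_wpM2r ?vnorm_ge0.
  rewrite (resolvent_truncation _ (uF _) (uF _) (uF _)).
  rewrite (le_trans (vnormD _ _)) // vnormN vnormZ.
  rewrite /del addrA lerD ?(ltW Ey) // ler_pdivlMr ?exprn_gt0 //.
  have -> : normc (z ^+ 4) = t ^+ 2.
    by rewrite -rho2 -nz -exprM !exprSr !expr0 !mul1r !normcM.
  rewrite -mulrA ler_piMr ?exprn_ge0 ?(ltW t0) //.
  by rewrite mulrC.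
have nrho : normc (rho%:C%C : C) = rho.
  by rewrite normc_real ger0_norm ?sqrtr_ge0.
have nrhoi : normc (rho%:C * 'i : C)%C = rho.
  by rewrite normcM nrho -complexiE /normc expr0n expr1n add0r sqrtr1 mulr1.
have Y1 := YE _ nrho.
have Y2 := YE (- rho%:C%C); rewrite normcN in Y2; have {}Y2 := Y2 nrho.
have Y3 := YE _ nrhoi.
have Y4 := YE (- (rho%:C * 'i))%C; rewrite normcN in Y4; have {}Y4 := Y4 nrhoi.
have := four_point_average rho (fun z => erefl (Y z)).
rewrite y1 expr1n rho2 => avg.
have Fy : 1 <= kappa ^+ 2 * vnorm (F *m y) ^+ 2.
  have := Ek (F *m y); rewrite uF y1 -exprMn => h.
  by rewrite exprn_ege1.
have main : 1 + t / kappa ^+ 2 <= 1 + t * vnorm (F *m y) ^+ 2.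
  by rewrite lerD2l ler_wpM2l ?(ltW t0) // -[leLHS]mul1r ler_pdivrMr // mulrC.
have e2 : 0 < eps ^+ 2 by rewrite exprn_gt0.
have tot : eps ^+ 2 * (1 + t / kappa ^+ 2) <= (eps + del) ^+ 2.
  apply: (@le_trans _ _ (eps ^+ 2 * (1 + t * vnorm (F *m y) ^+ 2))).
    by rewrite ler_pM2l.
  exact: (max_ge_average e2 avg Y1 Y2 Y3 Y4).
have := no_plateau_budget e0 k0 t0 tk te.
by rewrite ltNge tot.
Qed.

End NoPlateau.

(** * Normal matrices; summable symbols *)

Section Normal.
Variable R : realType.
Local Notation C := R[i].
Local Open Scope sesquilinear_scope.

Lemma sqr_vnormE n (x : 'cV[C]_n) : (vnorm x ^+ 2)%:C%C = (x ^t* *m x) 0 0.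
Proof.
rewrite vnormE sqr_l2 rmorph_sum mxE; apply: eq_bigr => i _.
rewrite !mxE mulrC. exact: (esym (mulc_conj _)).
Qed.

Lemma vnorm_unitary n (P : 'M[C]_n) x : P \is unitarymx -> vnorm (P *m x) = vnorm x.
Proof.
move=> uP; apply/eqP; rewrite -(@eqrXn2 _ 2) ?vnorm_ge0 //; apply/eqP.
have realI (s t : R) : s%:C%C = t%:C%C -> s = t by case.
apply: realI; rewrite !sqr_vnormE.
have PP : P ^t* *m P = 1%:M by rewrite -invmx_unitary // mulVmx ?unitarymx_unit.
by rewrite trmx_mul map_mxM -mulmxA (mulmxA _ P x) PP mul1mx.
Qed.

(** In an orthonormal eigenbasis [A - l] is diagonal, so its smallest singular value
    is the distance from [l] to the nearest eigenvalue. *)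
Lemma normal_eigenvalue_near n (A : 'M[C]_n) (l : C) (s : R) : (0 < n)%N ->
  A \is normalmx -> smin (A - l%:M) <= s ->
  exists2 mu, normc (l - mu) <= s & smin (A - mu%:M) <= 0.
Proof.
move=> n0 /orthomx_spectral_subproof [[P d] /= uP AE] As.
have uPm := unitarymx_unit uP.
have shiftE mu : A - mu%:M = invmx P *m diag_mx (d - const_mx mu) *m P.
  rewrite AE raddfB /= diag_const_mx mulmxBr mulmxBl.
  by rewrite mul_mx_scalar -scalemxAl mulVmx // scalemx1.
have uV : invmx P \is unitarymx by rewrite invmx_unitary ?trmxC_unitary.
pose i0 := [arg min_(i < Ordinal n0) normc (d 0 i - l)]%O.
have i0P i : normc (d 0 i0 - l) <= normc (d 0 i - l).
  by rewrite /i0; case: arg_minP => // j _; apply.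
exists (d 0 i0).
  rewrite normc_distC; apply: le_trans As; apply: le_smin => // x.
  rewrite shiftE -!mulmxA vnorm_unitary // -{1}(vnorm_unitary x uP).
  move: (P *m x) => y; rewrite !vnormE.
  rewrite -(ger0_norm (normc_ge0 (d 0 i0 - l))) -normc_real -l2Z.
  apply: l2_le_mono => i; rewrite mul_diag_mx !mxE !normcM normc_real.
  by rewrite ger0_norm ?normc_ge0 // ler_wpM2r ?normc_ge0.
rewrite smin_eq0 // shiftE unitmxE !det_mulmx det_diag.
rewrite (bigD1 i0) //= !mxE subrr mul0r mulr0 mul0r.
by rewrite unitr0.
Qed.

End Normal.

Section Wiener.
Variable R : realType.
Local Notation C := R[i].

(** For nonnegative [h] this says that the l^1 norm of [h] is at most [K]. Sums over
    duplicate-free sequences transfer directly to the rows and columns of a Toeplitz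
    matrix, whose indices run over injective images of ordinals. *)
Definition l1_bound (h : int -> R) (K : R) :=
  forall s : seq int, uniq s -> \sum_(j <- s) h j <= K.

Lemma l1_bound_ge0 h K : l1_bound h K -> 0 <= K.
Proof. by move=> /(_ [::] isT); rewrite big_nil. Qed.

Lemma esum_l1_bound (h : int -> R) : (forall j, 0 <= h j) ->
  (\esum_(j in [set: int]) (h j)%:E < +oo)%E -> exists K, l1_bound h K.
Proof.
move=> h0 hoo.
have e0 : (0 <= \esum_(j in [set: int]) (h j)%:E)%E.
  by apply: esum_ge0 => j _; rewrite lee_fin.
exists (fine (\esum_(j in [set: int]) (h j)%:E)) => s us.
rewrite -lee_fin fineK ?ge0_fin_numE // -sumEFin fsbig_seq //.
apply: ereal_sup_ubound; exists [set` s]; last by [].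
by split; [exact: finite_seq|].
Qed.

(** A finite family whose sum is within [e] of the supremum leaves at most [e] for
    any family disjoint from it. *)
Lemma l1_bound_tail (h : int -> R) K (e : R) :
  l1_bound h K -> 0 < e ->
  exists J : nat, l1_bound (fun j => if (J <= `|j|)%N then h j else 0) e.
Proof.
move=> hK e0.
pose S := [set t | exists2 s : seq int, uniq s & t = \sum_(j <- s) h j].
have hS : has_sup S.
  split; first by exists 0, [::]; rewrite ?big_nil.
  by exists K => _ [s us ->]; exact: hK.
have [_ [s0 us0 ->] lts0] := sup_adherent e0 hS.
exists (\max_(j <- s0) `|j|%N).+1 => s us.
rewrite -big_mkcond /= -big_filter.
set s1 := seq.filter _ s.
have u01 : uniq (s0 ++ s1).
  rewrite cat_uniq us0 filter_uniq // andbT; apply/hasPn => j /=.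
  rewrite seq.mem_filter => /andP[Jj _]; apply: contraL Jj => js0.
  by rewrite -leqNgt; apply: leq_bigmax_seq.
have : \sum_(j <- s0 ++ s1) h j <= sup S.
  by apply: (ub_le_sup (proj2 hS)); exists (s0 ++ s1).
by rewrite big_cat /=; lra.
Qed.

(** A cut-off with Lipschitz constant [c] and values in [0, 1] changes the entry [a_j]
    of a Toeplitz matrix by the factor [min 1 (c |j|)] in a commutator. The weighted
    sum tends to 0 with [c]: terms with [|j| < J] are small since [c J] is, the others
    since they belong to a tail. *)
Lemma l1_bound_lipschitz_gain (h : int -> R) K (e : R) :
  (forall j, 0 <= h j) -> l1_bound h K -> 0 < e ->
  exists2 c0 : R, 0 < c0 & forall c : R, 0 <= c <= c0 ->
    l1_bound (fun j => h j * Num.min 1 (c * `|j|%N%:R)) e.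
Proof.
move=> h0 hK e0; have K0 := l1_bound_ge0 hK.
have [J tJ] := l1_bound_tail hK (divr_gt0 e0 (ltr0Sn R 1)).
have J0 : 0 <= J%:R :> R by [].
exists (e / (2 * (J%:R * K + 1))).
  by rewrite divr_gt0 // mulr_gt0 // ltr_wpDl // mulr_ge0.
move=> c /andP[c0 cc0] s us.
apply: (@le_trans _ _ (c * J%:R * K + e / 2)); last first.
  have : c * (J%:R * K + 1) <= e / 2.
    rewrite -ler_pdivlMr ?ltr_wpDl ?mulr_ge0 //.
    by rewrite (le_trans cc0) // invfM mulrA.
  by lra.
apply: (@le_trans _ _ (\sum_(j <- s) (c * J%:R * h j +
    (if (J <= `|j|)%N then h j else 0)))).
  apply: ler_sum => j _; case: leqP => Jj.
    rewrite ler_wpDl ?mulr_ge0 // -[leRHS]mulr1 ler_wpM2l //.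
    by rewrite ge_min lexx.
  rewrite addr0 mulrC ler_wpM2r // ge_min; apply/orP; right.
  by rewrite ler_wpM2l // ler_nat ltnW.
rewrite big_split /= lerD ?tJ // -mulr_sumr ler_wpM2l ?mulr_ge0 //.
exact: hK.
Qed.

(** The form of Schur's test used for all Toeplitz-like matrices below; [p] and [q]
    give the positions of rows and columns, which for blocks are offset. *)
Lemma schur_test_shift (I J : finType) (p : I -> int) (q : J -> int)
    (k : I -> J -> C) (h : int -> R) (G : R) (x : J -> C) :
  injective p -> injective q -> l1_bound h G ->
  (forall i j, normc (k i j) <= h (p i - q j)) ->
  l2 (fun i => \sum_j k i j * x j) <= G * l2 x.
Proof.
move=> pI qI hG kh; apply: schur_test; first exact: l1_bound_ge0 hG.
  move=> i; apply: (@le_trans _ _ (\sum_j h (p i - q j))); first exact: ler_sum.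
  rewrite -(big_map (fun j => p i - q j) xpredT h); apply: hG.
  by rewrite map_inj_uniq ?index_enum_uniq // => j j' /addrI/oppr_inj/qI.
move=> j; apply: (@le_trans _ _ (\sum_i h (p i - q j))); first exact: ler_sum.
rewrite -(big_map (fun i => p i - q j) xpredT h); apply: hG.
by rewrite map_inj_uniq ?index_enum_uniq // => i i' /addIr/pI.
Qed.

End Wiener.

(** * Finite sections: localization of almost minimizing vectors *)

Section PartialNorms.
Variable R : realType.
Local Notation C := R[i].
Implicit Types x y : nat -> C.

Definition nrm n x : R := l2 (fun i : 'I_n => x i).

Lemma nrm_ge0 n x : 0 <= nrm n x.
Proof. exact: l2_ge0. Qed.

Lemma sqr_nrm n x : nrm n x ^+ 2 = \sum_(i < n) normc (x i) ^+ 2.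
Proof. exact: sqr_l2. Qed.

Lemma eq_nrm n x y : (forall i, (i < n)%N -> x i = y i) -> nrm n x = nrm n y.
Proof. by move=> xy; apply: eq_l2 => i; exact: xy. Qed.

Lemma nrmD n x y : nrm n (fun i => x i + y i) <= nrm n x + nrm n y.
Proof. exact: l2D. Qed.

Lemma nrmB n x y : nrm n (fun i => x i - y i) <= nrm n x + nrm n y.
Proof. exact: l2B. Qed.

Lemma nrmN n x : nrm n (fun i => - x i) = nrm n x.
Proof. exact: l2N. Qed.

Lemma nrmZ n (c : C) x : nrm n (fun i => c * x i) = normc c * nrm n x.
Proof. exact: l2Z. Qed.

Lemma nrm_widen n m x : (n <= m)%N -> nrm n x <= nrm m x.
Proof.
move=> nm; rewrite -ler_sqr ?nnegrE ?nrm_ge0 // !sqr_nrm.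
rewrite (big_ord_widen m (fun i => normc (x i) ^+ 2) nm).
by rewrite big_mkcond; apply: ler_sum => i _; case: ifP; rewrite ?sqr_ge0.
Qed.

Lemma nrm_supp n m x : (forall i, (n <= i)%N -> x i = 0) -> nrm m x <= nrm n x.
Proof.
move=> x0; have [mn|nm] := leqP m n; first exact: nrm_widen.
rewrite -ler_sqr ?nnegrE ?nrm_ge0 // !sqr_nrm.
rewrite (big_ord_widen m (fun i => normc (x i) ^+ 2) (ltnW nm)).
rewrite [leRHS]big_mkcond; apply: ler_sum => i _; case: ltnP => // ni.
by rewrite x0 // normc0 expr0n.
Qed.

Lemma normc_le_nrm n x i : (i < n)%N -> normc (x i) <= nrm n x.
Proof. by move=> ni; exact: (normc_le_l2 (fun i : 'I_n => x i) (Ordinal ni)). Qed.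

Lemma nrm_col n x : vnorm (\col_(i < n) x i) = nrm n x.
Proof. by rewrite vnormE; apply: eq_l2 => i; rewrite mxE. Qed.

Lemma col_seqE n (v : 'cV[C]_n) :
  exists2 x : nat -> C, v = \col_i x i & forall i, (n <= i)%N -> x i = 0.
Proof.
exists (fun i => if insub i is Some i' then v i' 0 else 0).
  by apply/colP => i; rewrite mxE valK.
by move=> i ni; rewrite insubF // ltnNge ni.
Qed.

Lemma nrm_rev n x : nrm n (fun i => x (n.-1 - i)%N) = nrm n x.
Proof.
rewrite /nrm /l2; congr Num.sqrt; rewrite (reindex_inj rev_ord_inj) /=.
apply: eq_bigr => i _; congr (normc (x _) ^+ 2).
by have := ltn_ord i; lia.
Qed.

End PartialNorms.

Section Sections.
Variable R : realType.
Local Notation C := R[i].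
Implicit Types (a : int -> C) (x : nat -> C).

(** Row [i] of [T(a) - l] applied to a sequence that vanishes from [M] on. *)
Definition toeplitz_row a (l : C) M x (i : nat) : C :=
  \sum_(j < M) a (i%:Z - j%:Z) * x j - l * x i.

Lemma toeplitz_mxE a l M x :
  (toeplitz_mx a M - l%:M) *m (\col_i x i) = \col_i toeplitz_row a l M x i.
Proof.
apply/colP => i; rewrite mulmxBl mul_scalar_mx !mxE; congr (_ - _).
by apply: eq_bigr => j _; rewrite !mxE.
Qed.

Lemma smin_toeplitz_le a l M x :
  smin (toeplitz_mx a M - l%:M) * nrm M x <= nrm M (toeplitz_row a l M x).
Proof. by rewrite -!nrm_col -toeplitz_mxE; exact: smin_mul_le. Qed.

Lemma smin_toeplitz_lt a l M (s : R) : (0 < M)%N ->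
  smin (toeplitz_mx a M - l%:M) < s ->
  exists x, [/\ forall i, (M <= i)%N -> x i = 0, nrm M x = 1
    & nrm M (toeplitz_row a l M x) < s].
Proof.
move=> M0 /(smin_lt M0)[v v1 vs]; have [x vx x0] := col_seqE v.
by exists x; split; rewrite // -nrm_col -?toeplitz_mxE -?vx.
Qed.

Lemma toeplitz_row_rev a l M x i : (i < M)%N ->
  toeplitz_row (fun j => a (- j)) l M (fun j => x (M.-1 - j)%N) i =
  toeplitz_row a l M x (M.-1 - i)%N.
Proof.
move=> iM; rewrite /toeplitz_row; congr (_ - _).
rewrite (reindex_inj rev_ord_inj) /=; apply: eq_bigr => j _.
have jM := ltn_ord j; have -> : (M.-1 - (M - j.+1))%N = j by lia.
by congr (a _ * _); lia.
Qed.

(** [(T - l) phi x - phi (A_M - l) x] is the commutator of [T] with [phi], applied to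
    [x]. As [phi] vanishes from [M] on, this covers the rows below the section as
    well. *)
Lemma toeplitz_commutator a l M I x (phi : nat -> R) (c e : R) :
  l1_bound (fun j => normc (a j) * Num.min 1 (c * `|j|%N%:R)) e ->
  (forall i, 0 <= phi i <= 1) ->
  (forall i j : nat, `|phi i - phi j| <= c * `|i%:Z - j%:Z|%N%:R) ->
  (forall i, (M <= i)%N -> phi i = 0) ->
  nrm I (toeplitz_row a l M (fun j => (phi j)%:C%C * x j)) <=
  nrm M (fun i => (phi i)%:C%C * toeplitz_row a l M x i) + e * nrm M x.
Proof.
move=> ce phi01 phic phi0.
pose com (i : nat) := \sum_(j < M) a (i%:Z - j%:Z) * (phi j - phi i)%:C%C * x j.
have -> : nrm I (toeplitz_row a l M (fun j => (phi j)%:C%C * x j)) =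
    nrm I (fun i => (phi i)%:C%C * toeplitz_row a l M x i + com i).
  apply: eq_nrm => i _; rewrite /toeplitz_row mulrBr mulr_sumr addrAC -big_split /=.
  congr (_ - _); last by ring.
  by apply: eq_bigr => j _; rewrite rmorphB /=; ring.
apply: le_trans (nrmD _ _ _) _; apply: lerD.
  by apply: nrm_supp => i Mi; rewrite phi0 // mul0r.
apply: (@schur_test_shift _ _ _ (fun i : 'I_I => (i : nat)%:Z)
  (fun j : 'I_M => (j : nat)%:Z) _ _ _ _ _ _ ce).
- by move=> i j [/val_inj].
- by move=> i j [/val_inj].
move=> i j; rewrite normcM normc_real ler_wpM2l ?normc_ge0 //.
rewrite le_min distrC phic andbT.
by have := phi01 i; have := phi01 j; move=> /andP[? ?] /andP[? ?]; rewrite ler_norml; lra.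
Qed.

(** A lower bound on finitely supported sequences. The norm of the image is bounded
    through its truncations, which avoids infinite sums. *)
Definition bounded_below a l (s : R) :=
  forall M x b, (forall i, (M <= i)%N -> x i = 0) -> 0 <= b ->
    (forall I, nrm I (toeplitz_row a l M x) <= b) -> s * nrm M x <= b.

(** The rational parametrization of the quarter circle: the squares of the two
    functions add up to 1, and their Lipschitz constants are elementary. *)
Definition cutoff (t : R) := (1 - t ^+ 2) / (1 + t ^+ 2).
Definition cutoff' (t : R) := 2 * t / (1 + t ^+ 2).

Lemma cutoff_sqr t : cutoff t ^+ 2 + cutoff' t ^+ 2 = 1.
Proof.
rewrite /cutoff /cutoff'; field.
by rewrite lt0r_neq0 // ltr_wpDr ?sqr_ge0.
Qed.

Lemma cutoff_itv t : 0 <= t <= 1 -> 0 <= cutoff t <= 1 /\ 0 <= cutoff' t <= 1.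
Proof.
move=> /andP[t0 t1]; have p : 0 < 1 + t ^+ 2 by rewrite ltr_wpDr ?sqr_ge0.
rewrite /cutoff /cutoff' !divr_ge0 ?(ltW p) ?ler_pdivrMr //; nra.
Qed.

Lemma cutoff_lip t s : 0 <= t <= 1 -> 0 <= s <= 1 ->
  `|cutoff t - cutoff s| <= 2 * `|t - s| /\
  `|cutoff' t - cutoff' s| <= 2 * `|t - s|.
Proof.
move=> /andP[t0 t1] /andP[s0 s1].
have p : 0 < 1 + t ^+ 2 by rewrite ltr_wpDr ?sqr_ge0.
have q : 0 < 1 + s ^+ 2 by rewrite ltr_wpDr ?sqr_ge0.
have pq : 0 < (1 + t ^+ 2) * (1 + s ^+ 2) by rewrite mulr_gt0.
have pn := lt0r_neq0 p; have qn := lt0r_neq0 q.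
have -> : cutoff t - cutoff s =
    2 * (t - s) * (- (t + s) / ((1 + t ^+ 2) * (1 + s ^+ 2))).
  by rewrite /cutoff; field; rewrite pn qn.
have -> : cutoff' t - cutoff' s =
    2 * (t - s) * ((1 - t * s) / ((1 + t ^+ 2) * (1 + s ^+ 2))).
  by rewrite /cutoff'; field; rewrite pn qn.
have ts : 0 <= 1 - t * s by rewrite subr_ge0 mulr_ile1.
have ts' : 0 <= t + s by rewrite addr_ge0.
have fin u : 0 <= u -> u <= (1 + t ^+ 2) * (1 + s ^+ 2) ->
    2 * `|t - s| * (u / ((1 + t ^+ 2) * (1 + s ^+ 2))) <= 2 * `|t - s|.
  by move=> u0 u1; rewrite ler_piMr ?mulr_ge0 // ler_pdivrMr // mul1r.
rewrite !normrM !(@ger0_norm _ 2) // normrN !normfV (gtr0_norm pq).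
rewrite (ger0_norm ts) (ger0_norm ts').
by split; apply: fin => //; nra.
Qed.

(** [X], [Y] are the norms of the two pieces and [P], [Q] the norms of their images
    under the section, [e] the commutator error. *)
Lemma two_piece_budget (s s1 e P Q X Y : R) :
  0 <= s -> s < s1 -> 0 <= P -> 0 <= Q -> 0 <= X -> 0 <= Y ->
  0 < e <= 1 -> e * (8 * s + 8) <= s1 ^+ 2 - s ^+ 2 ->
  X ^+ 2 + Y ^+ 2 = 1 -> P ^+ 2 + Q ^+ 2 <= s ^+ 2 ->
  s1 * X <= P + e -> s1 * Y <= Q + e -> False.
Proof.
move=> s0 ss1 P0 Q0 X0 Y0 /andP[e0 e1] es XY PQ hX hY.
have Ps : P <= s by rewrite -ler_sqr ?nnegrE //; have := sqr_ge0 Q; lra.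
have Qs : Q <= s by rewrite -ler_sqr ?nnegrE //; have := sqr_ge0 P; lra.
have s10 : 0 <= s1 by lra.
have hX2 : s1 ^+ 2 * X ^+ 2 <= (P + e) ^+ 2.
  by rewrite -exprMn ler_sqr ?nnegrE ?mulr_ge0 ?addr_ge0 ?(ltW e0).
have hY2 : s1 ^+ 2 * Y ^+ 2 <= (Q + e) ^+ 2.
  by rewrite -exprMn ler_sqr ?nnegrE ?mulr_ge0 ?addr_ge0 ?(ltW e0).
have tot : s1 ^+ 2 <= (P + e) ^+ 2 + (Q + e) ^+ 2.
  by rewrite -[leLHS]mulr1 -XY mulrDr lerD.
have eP : e * P <= e * s by rewrite ler_pM2l.
have eQ : e * Q <= e * s by rewrite ler_pM2l.
have ee : e * e <= e by rewrite ler_piMr // ltW.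
have es0 : 0 <= e * s by rewrite mulr_ge0 // ltW.
have : s1 ^+ 2 <= s ^+ 2 + 4 * (e * s) + 2 * (e * e).
  apply: (le_trans tot).
  have -> : (P + e) ^+ 2 + (Q + e) ^+ 2 =
    (P ^+ 2 + Q ^+ 2) + 2 * (e * P) + 2 * (e * Q) + 2 * (e * e) by ring.
  by lra.
by rewrite mulrDr in es; lra.
Qed.

(** An almost minimizing vector of a large finite section splits into a part
    that fades out before the right end, on which the section acts like [T(a)],
    and a part that fades out before the left end, on which, after reversing
    the order, it acts like the transpose of [T(a)]. As the squares of the two
    cut-offs add up to 1, one of the parts is almost minimizing too. *)
Lemma sections_bounded_below a K l (s s1 : R) :
  l1_bound (fun j => normc (a j)) K -> 0 <= s -> s < s1 ->
  bounded_below a l s1 -> bounded_below (fun j => a (- j)) l s1 ->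
  exists M0, forall M, (0 < M)%N -> (M0 <= M)%N ->
    s <= smin (toeplitz_mx a M - l%:M).
Proof.
move=> aK s0 ss1 low low'.
pose e := Num.min 1 ((s1 ^+ 2 - s ^+ 2) / (8 * s + 8)).
have s8 : 0 < 8 * s + 8 by lra.
have gap : 0 < s1 ^+ 2 - s ^+ 2 by rewrite subr_gt0 ltr_sqr ?nnegrE //; lra.
have e0 : 0 < e by rewrite lt_min ltr01 divr_gt0.
have e1 : e <= 1 by rewrite ge_min lexx.
have es : e * (8 * s + 8) <= s1 ^+ 2 - s ^+ 2.
  by rewrite -ler_pdivlMr // ge_min lexx orbT.
have [c0 c00 cP] := l1_bound_lipschitz_gain (fun j => normc_ge0 (a j)) aK e0.
exists (Num.truncn (2 / c0)).+1 => M M0 MM.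
have Mr : 0 < M%:R :> R by rewrite ltr0n.
have cM : (0 : R) <= 2 / M%:R <= c0.
  rewrite divr_ge0 //= ler_pdivrMr // mulrC -ler_pdivrMr //.
  apply: ltW; apply: lt_le_trans (truncnS_gt _) _.
  by rewrite ler_nat.
have {}cP := cP _ cM.
have cP' : l1_bound (fun j => normc (a (- j)) *
    Num.min 1 (2 / M%:R * `|j|%N%:R)) e.
  move=> t ut; have := cP (map -%R t); rewrite map_inj_uniq; last exact: oppr_inj.
  move=> /(_ ut); rewrite big_map; apply: le_trans.
  by apply: ler_sum => j _; rewrite abszN.
rewrite leNgt; apply/negP => /(smin_toeplitz_lt M0)[x [x0 x1 xs]].
pose tau (i : nat) : R := Num.min 1 (i%:R / M%:R).
have tau01 i : 0 <= tau i <= 1.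
  by rewrite le_min ler01 divr_ge0 //= ge_min lexx.
have taul (i j : nat) : `|tau i - tau j| <= `|i%:Z - j%:Z|%N%:R / M%:R.
  wlog ij : i j / (j <= i)%N => [th|].
    have [|/ltnW ji] := leqP j i; first exact: th.
    by rewrite distrC distnC; exact: th.
  have -> : `|i%:Z - j%:Z|%N = (i - j)%N by clear -ij; lia.
  have tij : tau j <= tau i.
    by rewrite le_min2 // ler_pM2r ?invr_gt0 // ler_nat.
  rewrite ger0_norm ?subr_ge0 // natrB // mulrBl /tau.
  have : j%:R / M%:R <= i%:R / M%:R :> R by rewrite ler_pM2r ?invr_gt0 // ler_nat.
  move: (i%:R / _) (j%:R / _) => u v uv.
  by rewrite /Num.min; case: ltP => ?; case: ltP => ?; lra.
pose phi i := cutoff (tau i).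
(* The truncated subtraction makes psi vanish from M.-1 on, as required. *)
pose psi i := cutoff' (tau (M.-1 - i)%N).
have phiM i : (M <= i)%N -> phi i = 0.
  move=> Mi; have ti : tau i = 1.
    by apply/min_idPl; rewrite ler_pdivlMr // mul1r ler_nat.
  by rewrite /phi ti /cutoff expr1n subrr mul0r.
have psiM i : (M <= i)%N -> psi i = 0.
  move=> Mi; have -> : (psi i = cutoff' (tau 0)) 
    by congr (cutoff' (tau _)); clear -Mi; lia.
  rewrite /cutoff' [tau 0](_ : _ = 0) ?mulr0 ?mul0r //.
  by rewrite /tau mul0r; apply/min_idPr.
have phil (i j : nat) : `|phi i - phi j| <= 2 / M%:R * `|i%:Z - j%:Z|%N%:R.
  apply: le_trans (proj1 (cutoff_lip (tau01 i) (tau01 j))) _.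
  by rewrite -mulrA [_^-1 * _]mulrC ler_pM2l.
have psil (i j : nat) : `|psi i - psi j| <= 2 / M%:R * `|i%:Z - j%:Z|%N%:R.
  apply: le_trans (proj2 (cutoff_lip (tau01 _) (tau01 _))) _.
  rewrite -mulrA [_^-1 * _]mulrC ler_pM2l //; apply: le_trans (taul _ _) _.
  by rewrite ler_pM2r ?invr_gt0 // ler_nat; clear; lia.
pose F := toeplitz_row a l M x.
pose X := nrm M (fun i => (phi i)%:C%C * x i).
pose Y := nrm M (fun i => (psi i)%:C%C * x (M.-1 - i)%N).
pose P := nrm M (fun i => (phi i)%:C%C * F i).
pose Q := nrm M (fun i => (psi i)%:C%C * F (M.-1 - i)%N).
have hX : s1 * X <= P + e.
  apply: low => [i /phiM ->||I]; first by rewrite mul0r.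
    by rewrite addr_ge0 ?nrm_ge0 ?(ltW e0).
  rewrite -[e in leRHS]mulr1 -x1.
  by apply: toeplitz_commutator cP _ phil phiM => i; case: (cutoff_itv (tau01 i)).
have hY : s1 * Y <= Q + e.
  apply: low' => [i /psiM ->||I]; first by rewrite mul0r.
    by rewrite addr_ge0 ?nrm_ge0 ?(ltW e0).
  rewrite -[e in leRHS]mulr1 -x1 -(nrm_rev M x).
  apply: le_trans (@toeplitz_commutator _ l _ I _ psi _ _ cP' _ psil psiM) _.
    by move=> i; case: (cutoff_itv (tau01 (M.-1 - i)%N)).
  rewrite lerD2r le_eqVlt; apply/orP; left; apply/eqP/eq_nrm => i iM.
  by rewrite toeplitz_row_rev.
have split_sum (f : nat -> C) : nrm M (fun i => (phi i)%:C%C * f i) ^+ 2 +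
    nrm M (fun i => (psi i)%:C%C * f (M.-1 - i)%N) ^+ 2 = nrm M f ^+ 2.
  rewrite (nrm_rev M (fun i => (cutoff' (tau i))%:C%C * f i)) !sqr_nrm.
  rewrite -big_split /=; apply: eq_bigr => i _.
  rewrite !normcM !normc_real !exprMn !real_normK ?num_real // -mulrDl.
  by rewrite cutoff_sqr mul1r.
have XY : X ^+ 2 + Y ^+ 2 = 1 by rewrite split_sum x1 expr1n.
have PQ : P ^+ 2 + Q ^+ 2 <= s ^+ 2.
  by rewrite split_sum ler_sqr ?nnegrE ?nrm_ge0 // ltW.
apply: (two_piece_budget s0 ss1 _ _ _ _ _ es XY PQ hX hY); rewrite ?nrm_ge0 //.
by rewrite e0 e1.
Qed.

End Sections.

(** * Limits along filters and the space l^2 *)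

Section Tends.
Variable R : realType.
Local Notation C := R[i].

(** Convergence of complex sequences with a real tolerance. It is stated for any
    filter, as it serves both ordinary limits and limits along ultrafilters. *)
Definition tends (F : set_system nat) (u : nat -> C) (z : C) :=
  forall d : R, 0 < d -> \forall n \near F, normc (u n - z) < d.

Section OneFilter.
Variables (F : set_system nat) (FF : ProperFilter F).
Implicit Types u v : nat -> C.

Lemma tends_cst z : tends F (fun=> z) z.
Proof. by move=> d d0; apply: nearW => n; rewrite subrr normc0. Qed.

Lemma tends_near u v z : (\forall n \near F, u n = v n) -> tends F u z -> tends F v z.
Proof.
move=> uv uz d d0; apply: filterS2 uv (uz _ d0) => n /= ->; exact.
Qed.

Lemma tendsD u v z w :
  tends F u z -> tends F v w -> tends F (fun n => u n + v n) (z + w).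
Proof.
move=> uz vw d d0; have d2 : 0 < d / 2 by rewrite divr_gt0.
apply: filterS2 (uz _ d2) (vw _ d2) => n h1 h2.
rewrite opprD addrACA (le_lt_trans (le_normcD _ _)) //.
by rewrite [d]splitr ltrD.
Qed.

Lemma tendsZ c u z : tends F u z -> tends F (fun n => c * u n) (c * z).
Proof.
move=> uz d d0; have c1 : 0 < normc c + 1 by rewrite ltr_wpDl ?normc_ge0.
apply: filterS (uz _ (divr_gt0 d0 c1)) => n.
rewrite -mulrBr normcM ltr_pdivlMr // => h; apply: le_lt_trans h.
by rewrite mulrC ler_wpM2l ?normc_ge0 // lerDl.
Qed.

Lemma tendsB u v z w :
  tends F u z -> tends F v w -> tends F (fun n => u n - v n) (z - w).
Proof.
move=> uz /(tendsZ (-1)) vw; have := tendsD uz vw.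
rewrite mulN1r; apply: tends_near; apply: nearW => n.
by rewrite mulN1r.
Qed.

Lemma tends_sum (I : finType) (u : I -> nat -> C) (z : I -> C) :
  (forall i, tends F (u i) (z i)) ->
  tends F (fun n => \sum_i u i n) (\sum_i z i).
Proof.
move=> uz.
have : tends F (fun n => \sum_(i <- index_enum I) u i n) (\sum_(i <- index_enum I) z i).
  elim: (index_enum I) => [|i r IH].
    by rewrite big_nil; apply: tends_near (tends_cst 0); apply: nearW => n; rewrite big_nil.
  rewrite big_cons; apply: tends_near (tendsD (uz i) IH).
  by apply: nearW => n; rewrite big_cons.
by [].
Qed.

Lemma tends_unique u z w : tends F u z -> tends F u w -> z = w.
Proof.
move=> uz uw; apply/eqP; rewrite -subr_eq0; apply/negPn/negP => zw.
have d0 : 0 < normc (z - w) / 2 by rewrite divr_gt0 // normc_lt0.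
have [n [h1 h2]] := filter_ex (filterI (uz _ d0) (uw _ d0)).
have := normc_triangle z (u n) w; rewrite (normc_distC z (u n)) leNgt.
by rewrite [X in _ < X]splitr ltrD.
Qed.

Lemma tends_nrm I (u : nat -> nat -> C) (z : nat -> C) :
  (forall i, (i < I)%N -> tends F (fun n => u n i) (z i)) ->
  forall d : R, 0 < d -> \forall n \near F, nrm I (fun i => u n i - z i) < d.
Proof.
move=> uz d d0.
have [I0|I0] := posnP I.
  apply: nearW => n; rewrite /nrm l20 // => i; have := ltn_ord i.
  by rewrite {2}I0.
have e0 : 0 < d / (2 * I%:R) by rewrite divr_gt0 // mulr_gt0 // ltr0n.
have fa : \forall n \near F, forall i : 'I_I, normc (u n i - z i) < d / (2 * I%:R).
  by apply: filter_forall => i; exact: uz (ltn_ord i) _ e0.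
apply: filterS fa => n un.
have dI : d / (2 * I%:R) * I%:R = d / 2.
  by field; rewrite lt0r_neq0 // ltr0n.
apply: (@le_lt_trans _ _ (d / 2)); last by rewrite ltr_pdivrMr // ltr_pMr // ltr1n.
rewrite /nrm l2_le ?divr_ge0 ?(ltW d0) //.
apply: (@le_trans _ _ (\sum_(i < I) (d / (2 * I%:R)) ^+ 2)).
  apply: ler_sum => i _; rewrite ler_sqr ?nnegrE ?normc_ge0 ?(ltW e0) //.
  exact: ltW.
rewrite sumr_const card_ord -[leLHS]mulr_natr -dI [leRHS]exprMn ler_wpM2l ?sqr_ge0 //.
by rewrite expr2 ler_peMr // ler1n.
Qed.

Lemma tends_nrm_le I (u : nat -> nat -> C) (z : nat -> C) (b : R) :
  (forall i, (i < I)%N -> tends F (fun n => u n i) (z i)) ->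
  (\forall n \near F, nrm I (u n) <= b) -> nrm I z <= b.
Proof.
move=> uz ub; apply/ler_addgt0Pr => d d0.
have [n [h1 h2]] := filter_ex (filterI ub (tends_nrm uz d0)).
have -> : nrm I z = nrm I (fun i => u n i - (u n i - z i)).
  by apply: eq_nrm => i _; rewrite subKr.
by rewrite (le_trans (nrmB _ _ _)) // lerD // ltW.
Qed.

End OneFilter.

Lemma normc_complexB (a b c d : R) : normc (Complex a b - Complex c d) <= `|a - c| + `|b - d|.
Proof. exact: (normc_le_ReIm (Complex (a - c) (b - d))). Qed.

(** Real and imaginary parts stay in a compact interval, hence have a cluster point,
    and an ultrafilter converges to each of its cluster points. *)
Lemma bounded_tends_ultra (U : set_system nat) (u : nat -> C) (b : R) :
  UltraFilter U -> (\forall n \near U, normc (u n) <= b) ->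
  exists z, tends U u z.
Proof.
move=> UU ub.
have real_case (v : nat -> R) : (\forall n \near U, `|v n| <= b) ->
    exists t, forall d : R, 0 < d -> \forall n \near U, `|v n - t| < d.
  move=> vb; have /(_ (v @ U)) [|t [_ ct]] := @segment_compact R (- b) b.
    by apply: filterS vb => n /=; rewrite in_itv /= ler_norml.
  exists t => d d0.
  have [//|nU] := in_ultra_setVsetC [set n | `|v n - t| < d] UU.
  have vA : U [set n | (~` ball t d) (v n)].
    apply: filterS nU => n nd bd; apply: nd; rewrite /= distrC; exact: bd.
  by have [s [nb /nb]] := ct _ _ vA (nbhsx_ballx t d d0).
have [|s sP] := real_case (fun n => complex.Re (u n)).
  by apply: filterS ub => n; apply: le_trans; exact: absRe_le_normc.
have [|t tP] := real_case (fun n => complex.Im (u n)).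
  by apply: filterS ub => n; apply: le_trans; exact: absIm_le_normc.
exists (Complex s t) => d d0; have d2 : 0 < d / 2 by rewrite divr_gt0.
apply: filterS2 (sP _ d2) (tP _ d2) => n; case: (u n) => p q /= h1 h2.
by rewrite (le_lt_trans (normc_complexB _ _ _ _)) // [d]splitr ltrD.
Qed.

(** The limit in [C^o] quantifies over tolerances in [C], which are positive
    only when they are real. *)
Lemma tends_limn (u : nat -> C) z : tends \oo u z -> limn (u : nat -> C^o) = z.
Proof.
move=> uz; apply: cvg_lim; first exact: norm_hausdorff.
apply/cvgrPdist_lt => e e0.
have [eR ee] : complex.Im e = 0 /\ 0 < complex.Re e.
  by move: e0; case: e => p q; rewrite ltcE /= => /andP[/eqP -> ->].
apply: filterS (uz _ ee) => n; rewrite -normcN opprB => h.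
have -> : e = (complex.Re e)%:C%C by move: eR; case: (e) => p q /= ->.
by rewrite -[X in X < _]/((normc (z - u n))%:C%C) ltcR.
Qed.

Lemma abs_series_tends (f : nat -> C) (b : R) :
  (forall n, \sum_(k < n) normc (f k) <= b) ->
  exists z, tends \oo (fun n => \sum_(k < n) f k) z.
Proof.
move=> fb.
have cabs : cvgn (series (fun k => normc (f k))).
  apply: nondecreasing_is_cvgn.
    by apply: nondecreasing_series => n _ _; exact: normc_ge0.
  by exists b => _ [n _ <-]; rewrite /series /= big_mkord.
have real_case (g : nat -> R) : (forall k, `|g k| <= normc (f k)) ->
    exists t, forall d : R, 0 < d -> \forall n \near \oo, `|\sum_(k < n) g k - t| < d.
  move=> gf; have : cvgn (series g).
    apply: normed_cvg; apply: (series_le_cvg _ _ gf cabs) => k /=.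
      exact: normr_ge0.
    exact: normc_ge0.
  move=> /cvg_ex[t /cvgrPdist_lt gt]; exists t => d /gt.
  by apply: filterS => n; rewrite distrC /series /= big_mkord.
have [|s sP] := real_case (fun n => complex.Re (f n)).
  by move=> k; exact: absRe_le_normc.
have [|t tP] := real_case (fun n => complex.Im (f n)).
  by move=> k; exact: absIm_le_normc.
exists (Complex s t) => d d0; have d2 : 0 < d / 2 by rewrite divr_gt0.
apply: filterS2 (sP _ d2) (tP _ d2) => n h1 h2.
have -> : \sum_(k < n) f k =
    Complex (\sum_(k < n) complex.Re (f k)) (\sum_(k < n) complex.Im (f k)).
  elim/big_rec3: _ => [//|i x y z _ ->]; case: (f i) => p q /=.
  by [].
by rewrite (le_lt_trans (normc_complexB _ _ _ _)) // [d]splitr ltrD.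
Qed.

End Tends.

Section Ell2.
Variable R : realType.
Local Notation C := R[i].
Implicit Types x y : nat -> C.

Lemma series_nrm x n : series (fun k => normc (x k) ^+ 2) n = nrm n x ^+ 2.
Proof. by rewrite sqr_nrm /series /= big_mkord. Qed.

Lemma series_nondecreasing x : nondecreasing_seq (series (fun k => normc (x k) ^+ 2)).
Proof. by apply: nondecreasing_series => n _ _; exact: sqr_ge0. Qed.

(** The partial sums of a nonnegative series converge as soon as they are bounded. *)
Lemma ell2_bound x (b : R) : 0 <= b -> (forall n, nrm n x <= b) ->
  ell2 x /\ ell2_norm x <= b.
Proof.
move=> b0 xb.
have sb n : series (fun k => normc (x k) ^+ 2) n <= b ^+ 2.
  by rewrite series_nrm ler_sqr ?nnegrE ?nrm_ge0.
have cx : ell2 x.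
  apply: nondecreasing_is_cvgn; first exact: series_nondecreasing.
  by exists (b ^+ 2) => _ [n _ <-].
split=> //; rewrite -[leRHS]ger0_norm // -sqrtr_sqr ler_wsqrtr //.
by apply: limr_le => //; exact: nearW.
Qed.

Lemma nrm_le_ell2 x n : ell2 x -> nrm n x <= ell2_norm x.
Proof.
move=> cx; rewrite -[leLHS]ger0_norm ?nrm_ge0 // -sqrtr_sqr ler_wsqrtr //.
by rewrite -series_nrm; apply: nondecreasing_cvgn_le => //; exact: series_nondecreasing.
Qed.

Lemma ell2_norm_ge0 x : 0 <= ell2_norm x.
Proof. exact: sqrtr_ge0. Qed.

Lemma ell2_norm_le x (b : R) : 0 <= b -> (forall n, nrm n x <= b) -> ell2_norm x <= b.
Proof. by move=> b0 /(ell2_bound b0)[]. Qed.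

Lemma ell2_finite_support x M : (forall i, (M <= i)%N -> x i = 0) ->
  ell2 x /\ ell2_norm x <= nrm M x.
Proof. by move=> x0; apply: ell2_bound => [|n]; [exact: nrm_ge0|exact: nrm_supp]. Qed.

Lemma ell2D x y : ell2 x -> ell2 y ->
  ell2 (fun k => x k + y k) /\
  ell2_norm (fun k => x k + y k) <= ell2_norm x + ell2_norm y.
Proof.
move=> cx cy; apply: ell2_bound => [|n]; first by rewrite addr_ge0 ?ell2_norm_ge0.
by rewrite (le_trans (nrmD _ _ _)) // lerD ?nrm_le_ell2.
Qed.

Lemma ell2Z (c : C) x : ell2 x ->
  ell2 (fun k => c * x k) /\ ell2_norm (fun k => c * x k) <= normc c * ell2_norm x.
Proof.
move=> cx; apply: ell2_bound => [|n]; first by rewrite mulr_ge0 ?ell2_norm_ge0 ?normc_ge0.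
by rewrite nrmZ ler_wpM2l ?normc_ge0 ?nrm_le_ell2.
Qed.

Lemma ell2_lin (c : C) x y : ell2 x -> ell2 y -> ell2 (fun k => c * x k + y k).
Proof. by move=> /(ell2Z c)[cx _] cy; case: (ell2D cx cy). Qed.

Lemma ell2_norm_eq0 x : ell2 x -> ell2_norm x = 0 -> x = fun=> 0.
Proof.
move=> cx x0; apply/funext => i; apply: eq0_normc; apply/eqP.
rewrite eq_le normc_ge0 andbT -x0.
exact: le_trans (normc_le_nrm x (ltnSn i)) (nrm_le_ell2 _ cx).
Qed.

Lemma ell2_tail x (d : R) : ell2 x -> 0 < d ->
  \forall M \near \oo,
    ell2_norm (fun k => if (k < M)%N then 0 else x k) <= d.
Proof.
move=> cx d0; have d2 : 0 < d ^+ 2 by rewrite exprn_gt0.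
have /cvgrPdist_lt/(_ _ d2) := cx.
apply: filterS => M; rewrite series_nrm => h.
apply: ell2_norm_le => [|n]; first exact: ltW.
have [nM|/ltnW Mn] := leqP n M.
  rewrite /nrm l20 ?(ltW d0) // => i.
  by rewrite (leq_trans (ltn_ord i) nM).
rewrite -ler_sqr ?nnegrE ?nrm_ge0 ?(ltW d0) //.
have xn := nondecreasing_cvgn_le (series_nondecreasing x) cx n.
rewrite series_nrm in xn.
suff : nrm n (fun k => if (k < M)%N then 0 else x k) ^+ 2 + nrm M x ^+ 2 <= nrm n x ^+ 2.
  by move: h; rewrite ltr_norml => /andP[_ h]; lra.
rewrite !sqr_nrm (big_ord_widen n (fun i => normc (x i) ^+ 2) Mn).
rewrite [X in _ + X]big_mkcond -big_split; apply: ler_sum => i _ /=.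
by case: ifP => _; rewrite ?addr0 // normc0 expr0n add0r.
Qed.

Lemma ell2_opnorm_le (S : (nat -> C) -> (nat -> C)) x :
  ell2_bounded_operator S -> ell2 x -> ell2_norm (S x) <= ell2_opnorm S * ell2_norm x.
Proof.
case=> Sell Slin [K SK] cx.
have z0 : ell2 (fun=> 0 : C) by case: (@ell2_finite_support (fun=> 0) 0%N).
have S0 : S (fun=> 0) = fun=> 0.
  have := Slin (-1) _ _ z0 z0; rewrite /=.
  under eq_fun do rewrite mulr0 addr0.
  by move=> {1}->; apply/funext => k; rewrite mulN1r addNr.
have SZ c : S (fun k => c * x k) = (fun k => c * S x k).
  have := Slin c _ _ cx z0; rewrite S0.
  under eq_fun do rewrite addr0.
  by move=> ->; apply/funext => k; rewrite addr0.
have [x0|x0] := eqVneq (ell2_norm x) 0.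
  by have := SK _ cx; rewrite x0 !mulr0.
have nx : 0 < ell2_norm x by rewrite lt_def x0 ell2_norm_ge0.
pose c := ((ell2_norm x)^-1)%:C%C : C.
have nc : normc c = (ell2_norm x)^-1.
  by rewrite normc_real ger0_norm // invr_ge0 ell2_norm_ge0.
have [ccx ncx] := ell2Z c cx; rewrite nc mulVf // in ncx.
have Scx : ell2_norm (S (fun k => c * x k)) <= ell2_opnorm S.
  apply: ub_le_sup; last by exists (fun k => c * x k).
  exists `|K| => _ [y [cy y1] <-]; apply: le_trans (SK _ cy) _.
  apply: (@le_trans _ _ (`|K| * ell2_norm y)).
    by rewrite ler_wpM2r ?ell2_norm_ge0 // ler_norm.
  by rewrite ler_piMr.
rewrite -ler_pdivrMr // mulrC -nc; apply: le_trans Scx; rewrite SZ.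
have [cSx _] := ell2Z c (Sell _ cx).
have cc : c^-1 * c = 1.
  by rewrite mulVf // -normc_lt0 nc invr_gt0.
have [_] := ell2Z c^-1 cSx.
under eq_fun do rewrite mulrA cc mul1r.
by rewrite normcV -ler_pdivlMl ?invr_gt0 ?nc ?invr_gt0 // invrK.
Qed.

Lemma ell2_opnorm_bound (S : (nat -> C) -> (nat -> C)) (K : R) : 0 <= K ->
  (forall x, ell2 x -> ell2_norm (S x) <= K * ell2_norm x) ->
  ell2_opnorm S <= K.
Proof.
move=> K0 SK; apply: ge_sup.
  have [c0 n0] := @ell2_finite_support (fun=> 0) 0%N (fun _ _ => erefl).
  exists (ell2_norm (S (fun=> 0))); exists (fun=> 0) => //; split=> //.
  by rewrite (le_trans n0) // /nrm l20.
by move=> _ [y [cy y1] <-]; rewrite (le_trans (SK _ cy)) // ler_piMr.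
Qed.

End Ell2.

(** * The Toeplitz operator and its finite sections *)

Section ToeplitzOperator.
Variables (R : realType) (a : int -> R[i]) (K : R).
Hypothesis aK : l1_bound (fun j => normc (a j)) K.
Local Notation C := R[i].
Implicit Types (x y : nat -> C) (l : C).

Definition shifted_toeplitz l x (i : nat) : C := toeplitz_op a x i - l * x i.

Lemma toeplitz_row_lin l M (c : C) x y i :
  toeplitz_row a l M (fun k => c * x k + y k) i =
  c * toeplitz_row a l M x i + toeplitz_row a l M y i.
Proof.
rewrite /toeplitz_row mulrBr mulr_sumr [l * (_ + _)]mulrDr opprD addrACA -big_split /=.
congr (_ + _); last by ring.
by apply: eq_bigr => j _; rewrite mulrDr mulrCA.
Qed.

Lemma toeplitz_row_tends l x i : ell2 x ->
  tends \oo (fun n => toeplitz_row a l n x i) (shifted_toeplitz l x i).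
Proof.
move=> cx.
have [|z zP] := @abs_series_tends R (fun j => a (i%:Z - j%:Z) * x j) (K * ell2_norm x).
  move=> n; apply: (@le_trans _ _ (\sum_(j < n) normc (a (i%:Z - j%:Z)) * ell2_norm x)).
    apply: ler_sum => j _; rewrite normcM ler_wpM2l ?normc_ge0 //.
    exact: le_trans (normc_le_nrm x (ltnSn j)) (nrm_le_ell2 _ cx).
  rewrite -mulr_suml ler_wpM2r ?ell2_norm_ge0 //.
  rewrite -(big_map (fun j : 'I_n => i%:Z - (j : nat)%:Z) xpredT (fun j => normc (a j))).
  apply: aK; rewrite map_inj_uniq ?index_enum_uniq // => j j'.
  by move=> /addrI/oppr_inj[]/val_inj.
apply: tendsB; last exact: tends_cst.
suff -> : toeplitz_op a x i = z by [].
apply: tends_limn; apply: tends_near zP; apply: nearW => n.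
by rewrite /series /= big_mkord.
Qed.

Lemma shifted_toeplitz_finite l M x i : (forall i, (M <= i)%N -> x i = 0) ->
  shifted_toeplitz l x i = toeplitz_row a l M x i.
Proof.
move=> x0; have [cx _] := ell2_finite_support x0.
apply: (tends_unique _ (toeplitz_row_tends l i cx)).
apply: tends_near (tends_cst _ _); exists M => // n /= Mn; congr (_ - _).
rewrite (big_ord_widen n (fun j => a (i%:Z - j%:Z) * x j) Mn) [LHS]big_mkcond.
by apply: eq_bigr => j _ /=; case: ltnP => // /x0 ->; rewrite mulr0.
Qed.

Lemma shifted_toeplitz_lin l (c : C) x y : ell2 x -> ell2 y ->
  shifted_toeplitz l (fun k => c * x k + y k) =
  (fun k => c * shifted_toeplitz l x k + shifted_toeplitz l y k).
Proof.
move=> cx cy; apply/funext => i /=.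
have h := toeplitz_row_tends l i (ell2_lin (c := c) cx cy).
apply: (tends_unique _ h).
apply: tends_near (tendsD _ (tendsZ _ c (toeplitz_row_tends l i cx)) (toeplitz_row_tends l i cy)).
by apply: nearW => n; rewrite toeplitz_row_lin.
Qed.

Lemma nrm_toeplitz_row l I n x : (I <= n)%N ->
  nrm I (toeplitz_row a l n x) <= (K + normc l) * nrm n x.
Proof.
move=> In; apply: le_trans (nrmB _ _ _) _; rewrite mulrDl lerD //.
  apply: (@schur_test_shift _ _ _ (fun i : 'I_I => (i : nat)%:Z)
    (fun j : 'I_n => (j : nat)%:Z) _ _ _ _ _ _ aK) => //.
  - by move=> i j [/val_inj].
  - by move=> i j [/val_inj].
by rewrite nrmZ ler_wpM2l ?normc_ge0 ?nrm_widen.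
Qed.

Lemma shift_bound_ge0 l : 0 <= K + normc l.
Proof. by rewrite addr_ge0 ?normc_ge0 // (l1_bound_ge0 aK). Qed.

Lemma nrm_shifted_toeplitz l I x : ell2 x ->
  nrm I (shifted_toeplitz l x) <= (K + normc l) * ell2_norm x.
Proof.
move=> cx.
apply: (@tends_nrm_le _ \oo _ I (fun n => toeplitz_row a l n x)).
  by move=> i _; exact: toeplitz_row_tends.
exists I => // n /= In; apply: le_trans (nrm_toeplitz_row _ _ In) _.
by rewrite ler_wpM2l ?shift_bound_ge0 ?nrm_le_ell2.
Qed.

Lemma ell2_shifted_toeplitz l x : ell2 x -> ell2 (shifted_toeplitz l x).
Proof.
move=> cx; case: (@ell2_bound _ (shifted_toeplitz l x) ((K + normc l) * ell2_norm x)) => //.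
  by rewrite mulr_ge0 ?shift_bound_ge0 ?ell2_norm_ge0.
by move=> n; exact: nrm_shifted_toeplitz.
Qed.

Lemma ell2_invnormP l : 0 < ell2_invnorm (shifted_toeplitz l) ->
  exists2 S, ell2_is_inverse (shifted_toeplitz l) S &
    ell2_invnorm (shifted_toeplitz l) = (ell2_opnorm S)^-1.
Proof.
rewrite /ell2_invnorm; case: pselect => [exS _|]; last by rewrite ltxx.
by exists (sval (cid exS)) => //; exact: svalP (cid exS).
Qed.

Lemma invnorm_bounded_below l :
  bounded_below a l (ell2_invnorm (shifted_toeplitz l)).
Proof.
move=> M x b x0 b0 xb.
have [s0|s0] := leP (ell2_invnorm (shifted_toeplitz l)) 0.
  by apply: le_trans b0; rewrite mulr_le0_ge0 ?nrm_ge0.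
have [S [Sop SP] sE] := ell2_invnormP s0; rewrite sE in s0 *.
have N0 : 0 < ell2_opnorm S by rewrite -invr_gt0.
have [cx _] := ell2_finite_support x0.
have [cTx nTx] : ell2 (shifted_toeplitz l x) /\ ell2_norm (shifted_toeplitz l x) <= b.
  apply: ell2_bound => // n; apply: le_trans (xb n); rewrite le_eqVlt.
  by apply/orP; left; apply/eqP/eq_nrm => i _; exact: shifted_toeplitz_finite.
rewrite mulrC ler_pdivrMr // mulrC; apply: le_trans (nrm_le_ell2 M cx) _.
have [STx _] := SP _ cx; rewrite -{1}STx.
apply: le_trans (ell2_opnorm_le Sop cTx) _.
by rewrite ler_wpM2l ?(ltW N0).
Qed.

(** If [S] inverts [T], then [|x|^2 = <x, conj x> = <x, T S conj x>], which equals
    [<T^t x, S conj x> <= |T^t x| |S| |x|], for the bilinear pairing. *)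
Lemma invnorm_bounded_below_transpose l :
  bounded_below (fun j => a (- j)) l (ell2_invnorm (shifted_toeplitz l)).
Proof.
move=> M x b x0 b0 xb.
have [s0|s0] := leP (ell2_invnorm (shifted_toeplitz l)) 0.
  by apply: le_trans b0; rewrite mulr_le0_ge0 ?nrm_ge0.
have [S [Sop SP] sE] := ell2_invnormP s0; rewrite sE in s0 *.
have N0 : 0 < ell2_opnorm S by rewrite -invr_gt0.
pose xc i := conjc (x i).
have xc0 i : (M <= i)%N -> xc i = 0 by move=> /x0; rewrite /xc => ->; rewrite conjc0.
have [cxc nxc] := ell2_finite_support xc0.
have nxcE : nrm M xc = nrm M x.
  by rewrite /nrm /l2; under eq_bigr do rewrite normc_conj.
pose w := S xc.
have cw : ell2 w by case: Sop => Sell _ _; exact: Sell.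
have nw : ell2_norm w <= ell2_opnorm S * nrm M x.
  apply: le_trans (ell2_opnorm_le Sop cxc) _.
  by rewrite -nxcE ler_wpM2l ?(ltW N0).
have Tw : shifted_toeplitz l w = xc by case: (SP _ cxc).
pose r n := \sum_(j < n) w j * toeplitz_row (fun j => a (- j)) l M x j.
have rb n : normc (r n) <= ell2_opnorm S * nrm M x * b.
  apply: le_trans (cauchy_schwarz _ _) _; apply: ler_pM; rewrite ?l2_ge0 //.
    exact: le_trans (nrm_le_ell2 n cw) nw.
  exact: xb.
have rE n : (M <= n)%N -> r n = \sum_(i < M) x i * toeplitz_row a l n w i.
  move=> Mn; rewrite /r /toeplitz_row.
  under eq_bigr do rewrite mulrBr mulr_sumr.
  under [RHS]eq_bigr do rewrite mulrBr mulr_sumr.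
  rewrite !sumrB exchange_big /=; congr (_ - _).
    apply: eq_bigr => i _; apply: eq_bigr => j _.
    rewrite opprB mulrCA [x i * _]mulrCA; congr (_ * _).
    by rewrite mulrC.
  rewrite (big_ord_widen n (fun i => x i * (l * w i)) Mn) [RHS]big_mkcond.
  apply: eq_bigr => j _ /=; case: ltnP => [_|/x0 ->]; last by rewrite !mulr0.
  by rewrite mulrCA [RHS]mulrCA [w j * _]mulrC.
have lim : tends \oo r (nrm M x ^+ 2)%:C%C.
  have -> : (nrm M x ^+ 2)%:C%C = \sum_(i < M) x i * shifted_toeplitz l w i.
    rewrite sqr_nrm rmorph_sum; apply: eq_bigr => i _.
    by rewrite Tw /xc mulc_conj.
  have h : tends \oo (fun n => \sum_(i < M) x i * toeplitz_row a l n w i)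
      (\sum_(i < M) x i * shifted_toeplitz l w i).
    by apply: tends_sum => i; apply: tendsZ; exact: toeplitz_row_tends.
  by apply: tends_near h; exists M => // n /= Mn; rewrite rE.
have main : nrm M x ^+ 2 <= ell2_opnorm S * nrm M x * b.
  apply/ler_addgt0Pr => d d0; have [n rn] := filter_ex (lim d d0).
  rewrite -[leLHS]ger0_norm ?sqr_ge0 // -normc_real.
  rewrite -(subrK (r n) (_%:C%C)) (le_trans (le_normcD _ _)) // addrC lerD ?rb //.
  by rewrite normc_distC ltW.
have [x_eq0|xn0] := eqVneq (nrm M x) 0; first by rewrite x_eq0 mulr0.
have xp : 0 < nrm M x by rewrite lt_def xn0 nrm_ge0.
rewrite mulrC ler_pdivrMr //.
by rewrite -(ler_pM2l xp) -expr2 (le_trans main) // -mulrA mulrCA [b * _]mulrC.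
Qed.

End ToeplitzOperator.

Lemma sections_stable (R : realType) (a : int -> R[i]) (K : R) (l : R[i]) (s : R) :
  l1_bound (fun j => normc (a j)) K ->
  0 <= s -> s < ell2_invnorm (shifted_toeplitz a l) ->
  exists M0, forall M, (0 < M)%N -> (M0 <= M)%N ->
    s <= smin (toeplitz_mx a M - l%:M).
Proof.
move=> aK s0 ss1; apply: (sections_bounded_below aK s0 ss1).
  exact: (invnorm_bounded_below aK).
exact: (invnorm_bounded_below_transpose aK).
Qed.

Section InverseFromSections.
Variables (R : realType) (a : int -> R[i]) (K : R).
Hypothesis aK : l1_bound (fun j => normc (a j)) K.
Local Notation C := R[i].
Variables (l : C) (c : R).
Hypothesis c0 : 0 < c.
Hypothesis frequently : forall M0, exists2 M, (M0 <= M)%N &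
  c <= smin (toeplitz_mx a M - l%:M).
Local Notation T := (shifted_toeplitz a l).
Implicit Types x y : nat -> C.

(** If [T x = 0], a section [A_M - l] maps the first [M] terms of [x] to minus the
    first [M] terms of [T] applied to the tail of [x]; the tail is small, and the
    section is bounded below by [c]. *)
Lemma shifted_toeplitz_inj x : ell2 x -> T x = (fun=> 0) -> x = (fun=> 0).
Proof.
move=> cx Tx0; apply/(ell2_norm_eq0 cx)/eqP.
rewrite eq_le ell2_norm_ge0 andbT; apply: ell2_norm_le => // n.
have K0 := shift_bound_ge0 aK l.
suff : c * nrm n x <= 0 by rewrite pmulr_rle0.
apply/ler_addgt0Pr => d d0; rewrite add0r.
have dK : 0 < d / (K + normc l + 1) by rewrite divr_gt0 // ltr_wpDl.
have [M1 _ tailM] := ell2_tail cx dK.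
have [M] := frequently (maxn n M1); rewrite geq_max => /andP[nM M1M] cM.
apply: (@le_trans _ _ (c * nrm M x)); first by rewrite ler_pM2l // nrm_widen.
apply: (@le_trans _ _ (nrm M (toeplitz_row a l M x))).
  by apply: le_trans (smin_toeplitz_le _ _ _ _); rewrite ler_wpM2r ?nrm_ge0.
pose head k := if (k < M)%N then x k else 0.
pose tail k := if (k < M)%N then 0 else x k.
have head0 i : (M <= i)%N -> head i = 0 by rewrite /head ltnNge => ->.
have [chead _] := ell2_finite_support head0.
have tailE : tail = (fun k => -1 * head k + x k).
  apply/funext => k; rewrite /tail /head mulN1r.
  by case: ifP; rewrite ?addNr // oppr0 add0r.
have ctail : ell2 tail by rewrite tailE; exact: ell2_lin.
have -> : nrm M (toeplitz_row a l M x) = nrm M (T tail).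
  rewrite tailE (shifted_toeplitz_lin aK) // Tx0 -nrmN; apply: eq_nrm => i iM.
  rewrite addr0 mulN1r (shifted_toeplitz_finite aK l i head0) /toeplitz_row /head iM.
  by congr (- (_ - _)); apply: eq_bigr => j _; rewrite ltn_ord.
apply: le_trans (nrm_shifted_toeplitz aK _ _ ctail) _.
apply: (@le_trans _ _ ((K + normc l) * (d / (K + normc l + 1)))).
  by rewrite ler_wpM2l //; exact: tailM.
by rewrite mulrCA ler_piMr ?(ltW d0) // ler_pdivrMr ?ltr_wpDl // mul1r lerDl.
Qed.

Lemma section_solution y : ell2 y -> forall M, exists x,
  (0 < M)%N -> c <= smin (toeplitz_mx a M - l%:M) ->
  (forall i, normc (x i) <= ell2_norm y / c) /\ nrm M x <= ell2_norm y / c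
  /\ (forall i, (M <= i)%N -> x i = 0)
  /\ forall i, (i < M)%N -> toeplitz_row a l M x i = y i.
Proof.
move=> cy M; have [/andP[M0 cM]|nM] := boolP ((0 < M)%N && (c <= smin (toeplitz_mx a M - l%:M))); last first.
  by exists y => M0 cM; move: nM; rewrite M0 cM.
have uE : toeplitz_mx a M - l%:M \in unitmx.
  by rewrite -[_ \in _]negbK -smin_eq0 // -ltNge (lt_le_trans c0).
have [x xE x0] := col_seqE (invmx (toeplitz_mx a M - l%:M) *m \col_(i < M) y i).
have rowE i : (i < M)%N -> toeplitz_row a l M x i = y i.
  move=> iM; have := toeplitz_mxE a l M x; rewrite -xE mulKVmx //.
  by move=> /colP/(_ (Ordinal iM)); rewrite !mxE.
have xn : nrm M x <= ell2_norm y / c.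
  rewrite ler_pdivlMr // mulrC; apply: le_trans (nrm_le_ell2 M cy).
  rewrite -(eq_nrm rowE); apply: le_trans (smin_toeplitz_le _ _ _ _).
  by rewrite ler_wpM2r ?nrm_ge0.
exists x => _ _; split=> //; first move=> i.
have [iM|/x0 ->] := ltnP i M; first exact: le_trans (normc_le_nrm x iM) xn.
by rewrite normc0 divr_ge0 ?ell2_norm_ge0 // ltW.
Qed.

(** The solutions of the finite sections are bounded, so they have a coordinatewise
    limit along an ultrafilter, and rows of [T] pass to this limit. *)
Lemma shifted_toeplitz_surj y : ell2 y ->
  exists x, [/\ ell2 x, T x = y & ell2_norm x <= ell2_norm y / c].
Proof.
move=> cy; set b := ell2_norm y / c.
have b0 : 0 <= b by rewrite divr_ge0 ?ell2_norm_ge0 // ltW.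
have [X XP] := choice (section_solution cy).
pose G : set nat := [set M | c <= smin (toeplitz_mx a M - l%:M)].
have PF : ProperFilter (within G \oo).
  apply: Build_ProperFilter_ex => P [M0 _ MP].
  have [M MM cM] := frequently M0; exists M; exact: (MP M MM cM).
have [U [UU leU]] := ultraFilterLemma PF.
have UP : ProperFilter U by exact: ultra_proper.
have Uoo M0 : \forall M \near U, (M0 <= M)%N.
  by apply: leU; exists M0 => // M /= M0M _.
have UG : \forall M \near U, (0 < M)%N /\ c <= smin (toeplitz_mx a M - l%:M).
  by apply: leU; exists 1%N => // M /= M0 cM; split.
have limX k : exists z, tends U (fun M => X M k) z.
  apply: (@bounded_tends_ultra _ _ _ b) => //.
  by apply: filterS UG => M [M0 cM]; case: (XP M M0 cM).
have [x xP] := choice limX.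
have xb n : nrm n x <= b.
  apply: (@tends_nrm_le _ U _ n X) => [i _|]; first exact: xP.
  apply: filterS UG => M [M0 cM]; have [_ [XM [X0 _]]] := XP M M0 cM.
  exact: le_trans (nrm_supp _ X0) XM.
have [cx nx] := ell2_bound b0 xb.
exists x; split=> //; apply/funext => i; apply/eqP; rewrite -subr_eq0.
apply/negPn/negP => ne; have := ne; rewrite -normc_lt0; set t := normc _ => t0.
have t3 : 0 < t / 3 by rewrite divr_gt0.
have [J tJ] := l1_bound_tail aK (divr_gt0 t3 (ltr_wpDl b0 ltr01)).
have [n [rn Jn]] := filter_ex (filterI (toeplitz_row_tends aK l i cx t3)
  (nbhs_infty_ge (i + J).+1)).
have rU : tends U (fun M => toeplitz_row a l n (X M) i) (toeplitz_row a l n x i).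
  apply: tendsB; last exact: tendsZ.
  by apply: tends_sum => j; exact: tendsZ.
have [M [[[M0 cM] nM] rM]] := filter_ex (filterI (filterI UG (Uoo n)) (rU _ t3)).
have [XM [_ [_ XrowE]]] := XP M M0 cM.
have iM : (i < M)%N by apply: leq_trans nM; apply: leq_trans Jn; rewrite ltnS leq_addr.
(* Row i of the section of order M gives y i; cutting it at n >= i + J drops
   entries a_j with |j| >= J only, and these have a small sum. *)
have tailM : normc (toeplitz_row a l n (X M) i - y i) <= t / 3.
  rewrite -(XrowE _ iM) normc_distC /toeplitz_row opprB addrA subrK.
  pose f j := a (i%:Z - j%:Z) * X M j.
  have -> : \sum_(j < M) f j - \sum_(j < n) f j = \sum_(n <= j < M) f j.
    by rewrite -!(big_mkord xpredT f) (@big_cat_nat _ _ _ n) //= addrAC subrr add0r.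
  apply: le_trans (normc_sum _ _ _) _.
  apply: (@le_trans _ _ (t / 3 / (b + 1) * b)); last first.
    rewrite -mulrA ler_piMr ?(ltW t3) // mulrC ler_pdivrMr ?ltr_wpDl // mul1r.
    by rewrite lerDl.
  rewrite big_nat.
  apply: (@le_trans _ _ (\sum_(n <= j < M) (if (J <= `|i%:Z - j%:Z|)%N
      then normc (a (i%:Z - j%:Z)) else 0) * b)).
    rewrite [leRHS]big_nat; apply: ler_sum => j /andP[nj _].
    have -> : (J <= `|i%:Z - j%:Z|)%N by clear -Jn nj; lia.
    by rewrite normcM ler_wpM2l ?normc_ge0.
  rewrite -mulr_suml ler_wpM2r //.
  rewrite -(big_map (fun j : nat => i%:Z - j%:Z) xpredT
    (fun j => if (J <= `|j|)%N then normc (a j) else 0)).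
  apply: tJ; rewrite map_inj_uniq ?iota_uniq // => j j' /addrI/oppr_inj.
  by case.
suff : t < t by rewrite ltxx.
rewrite [X in _ < X](_ : t = t / 3 + t / 3 + t / 3); last by field.
apply: (@le_lt_trans _ _ (normc (T x i - toeplitz_row a l n (X M) i)
  + normc (toeplitz_row a l n (X M) i - y i))); first exact: normc_triangle.
rewrite ltr_leD // (le_lt_trans (normc_triangle _ (toeplitz_row a l n x i) _)) //.
by rewrite ltrD // normc_distC.
Qed.

(** The inverse is the solution map of [shifted_toeplitz_surj]; uniqueness of solutions
    makes it linear and identifies it with any other inverse on l^2. *)
Lemma sections_invnorm : c <= ell2_invnorm T.
Proof.
have exT y : exists x, ell2 y -> [/\ ell2 x, T x = y & ell2_norm x <= ell2_norm y / c].
  have [cy|ncy] := pselect (ell2 y); last by exists y.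
  by have [x xP] := shifted_toeplitz_surj cy; exists x.
have [S SP] := choice exT.
have inj x y : ell2 x -> ell2 y -> T x = T y -> x = y.
  move=> cx cy Txy.
  have cd : ell2 (fun k => -1 * x k + y k) by exact: ell2_lin.
  have /(shifted_toeplitz_inj cd) d0 : T (fun k => -1 * x k + y k) = fun=> 0.
    rewrite (shifted_toeplitz_lin aK) // Txy; apply/funext => k.
    by rewrite mulN1r addNr.
  apply/funext => k; have := congr1 (fun f => f k) d0 => /= /eqP.
  by rewrite mulN1r addrC subr_eq0 => /eqP.
have Sinv : ell2_is_inverse T S.
  split; last first.
    move=> x cx; have [cSx TSx _] := SP x cx.
    have cTx := ell2_shifted_toeplitz aK (l := l) cx.
    have [cSTx TSTx _] := SP _ cTx.
    by split=> //; exact: inj.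
  split.
  - by move=> x cx; case: (SP x cx).
  - move=> z x y cx cy; have cxy := ell2_lin (c := z) cx cy.
    have [? Tx _] := SP x cx; have [? Ty _] := SP y cy; have [? Txy _] := SP _ cxy.
    apply: inj => //; first exact: ell2_lin.
    by rewrite Txy (shifted_toeplitz_lin aK) // Tx Ty.
  - by exists c^-1 => x cx; have [_ _] := SP x cx; rewrite mulrC.
rewrite /ell2_invnorm; case: pselect => [exS|[]]; last by exists S.
move: (cid exS) => [S' [S'op S'P]] /=.
have S'b x : ell2 x -> ell2_norm (S' x) <= c^-1 * ell2_norm x.
  move=> cx; have [cSx TSx nSx] := SP x cx.
  have [_ TS'x] := S'P x cx.
  have cS'x : ell2 (S' x) by case: S'op => h _ _; exact: h.
  by rewrite (inj _ _ cS'x cSx) ?TS'x // mulrC.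
have opb : ell2_opnorm S' <= c^-1 by apply: ell2_opnorm_bound => //; rewrite invr_ge0 ltW.
(* The inverse of the operator norm would be 0 if the norm were 0; a unit vector
   excludes this. *)
pose e0 (k : nat) : C := (k == 0%N)%:R.
have [ce0 _] : ell2 e0 /\ ell2_norm e0 <= nrm 1 e0.
  by apply: ell2_finite_support => [[]].
have op0 : 0 < ell2_opnorm S'.
  rewrite ltNge; apply/negP => op0.
  have cTe := ell2_shifted_toeplitz aK (l := l) ce0.
  have := ell2_opnorm_le S'op cTe.
  have [-> _] := S'P _ ce0.
  apply/negP; rewrite -ltNge.
  apply: (@le_lt_trans _ _ 0); first by rewrite mulr_le0_ge0 ?ell2_norm_ge0.
  rewrite lt_def ell2_norm_ge0 andbT; apply/eqP => /(ell2_norm_eq0 ce0).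
  move=> /(congr1 (fun f => f 0%N))/eqP; rewrite /e0 eqxx.
  by rewrite oner_eq0.
by rewrite -[c]invrK lef_pV2 // posrE invr_gt0.
Qed.

End InverseFromSections.

(** * From pointwise to Hausdorff convergence *)

Section Hausdorff.
Variable R : realType.
Local Notation C := R[i].

Definition within_dist (d : R) (X Y : set C) :=
  forall z, X z -> exists2 t, Y t & normc (z - t) < d.

Lemma within_dist_trans d e X Y Z : within_dist d X Y -> within_dist e Y Z ->
  within_dist (d + e) X Z.
Proof.
move=> XY YZ z /XY[t /YZ[u Zu tu] zt]; exists u => //.
by rewrite (le_lt_trans (normc_triangle z t u)) // ltrD.
Qed.

(** Halving the distance makes room for the suprema in the Hausdorff distance. For
    empty sets these suprema are [-oo]. *)
Lemma hausdorff_dist_lt (d : R) (X Y : set C) : 0 < d ->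
  within_dist (d / 2) X Y -> within_dist (d / 2) Y X ->
  (hausdorff_dist X Y < d%:E)%E.
Proof.
move=> d0 XY YX; apply: (@le_lt_trans _ _ (d / 2)%:E); last first.
  by rewrite lte_fin ltr_pdivrMr // ltr_pMr // ltr1n.
have half X' Y' : within_dist (d / 2) X' Y' ->
    (ereal_sup [set set_dist t Y' | t in X'] <= (d / 2)%:E)%E.
  move=> XY'; apply: ge_ereal_sup => _ [z /XY'[t Yt zt] <-].
  apply: (@le_trans _ _ (normc (z - t))%:E); last by rewrite lee_fin ltW.
  by apply: ereal_inf_lbound; exists t.
by rewrite /hausdorff_dist ge_max !half.
Qed.

(** The disc lies in a compact square, and compact sets have the near-covering
    property. *)
Lemma locally_uniform_disc (b : R) (P : nat -> C -> Prop) :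
  (forall z, exists2 r : R, 0 < r & exists K, forall n, (K <= n)%N ->
     forall w, normc (w - z) < r -> P n w) ->
  exists K, forall n, (K <= n)%N -> forall w, normc w <= b -> P n w.
Proof.
move=> loc.
have cK : compact (`[- b, b]%classic `*` `[- b, b]%classic : set (R * R)).
  by apply: compact_setX; exact: segment_compact.
have /compact_near_coveringP/(_ nat \oo (fun n p => P n (Complex p.1 p.2))) := cK.
case=> [[s t] _|K _ KP].
  have [r r0 [K KP]] := loc (Complex s t).
  have r2 : 0 < r / 2 by rewrite divr_gt0.
  exists (ball (s, t) (r / 2), [set n | (K <= n)%N]).
    by split; [exact: nbhsx_ballx|exists K].
  move=> [[s' t'] n] [/= [bs bt] Kn]; apply: KP => //.
  rewrite (le_lt_trans (normc_complexB _ _ _ _)) // [r]splitr distrC ltrD //.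
  by rewrite distrC.
exists K => n Kn w wb.
have := KP n Kn (complex.Re w, complex.Im w); case: w wb => p q wb /=; apply.
split; rewrite /= in_itv /= -ler_norml.
  exact: le_trans (absRe_le_normc (Complex p q)) wb.
exact: le_trans (absIm_le_normc (Complex p q)) wb.
Qed.

Lemma exists_small_inv (e : R) : 0 < e -> exists n : nat, n.+1%:R^-1 < e.
Proof.
move=> e0; exists (Num.truncn e^-1).
rewrite -[ltRHS]invrK ltf_pV2 ?posrE ?invr_gt0 ?ltr0n //.
exact: truncnS_gt.
Qed.

End Hausdorff.

Section FiniteSections.
Variables (R : realType) (a : int -> R[i]) (K : R).
Hypothesis aK : l1_bound (fun j => normc (a j)) K.
Local Notation C := R[i].

Lemma mx_pspecE n (eps : R) (E : 'M[C]_n) l : (0 < n)%N ->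
  mx_pspec eps E l = (smin (E - l%:M) <= eps) :> Prop.
Proof. by move=> n0; rewrite /mx_pspec /= mx_invnormE. Qed.

Lemma toeplitz_mx_norm M (x : 'cV[C]_M) :
  vnorm (toeplitz_mx a M *m x) <= K * vnorm x.
Proof.
rewrite !vnormE.
have -> : l2 (fun i => (toeplitz_mx a M *m x) i 0) =
    l2 (fun i : 'I_M => \sum_(j < M) a ((i : nat)%:Z - (j : nat)%:Z) * x j 0).
  by apply: eq_l2 => i; rewrite mxE; apply: eq_bigr => j _; rewrite mxE.
apply: (@schur_test_shift _ _ _ (fun i : 'I_M => (i : nat)%:Z)
  (fun j : 'I_M => (j : nat)%:Z) _ _ _ _ _ _ aK) => //.
- by move=> i j [/val_inj].
- by move=> i j [/val_inj].
Qed.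

Lemma smin_toeplitz_ge M l : (0 < M)%N ->
  normc l - K <= smin (toeplitz_mx a M - l%:M).
Proof.
move=> M0; apply: le_smin => // x; rewrite mulrBl.
have -> : vnorm ((toeplitz_mx a M - l%:M) *m x) =
    vnorm (l%:M *m x + - (toeplitz_mx a M *m x)) by rewrite -vnormN mulmxBl opprB.
apply: le_trans (vnorm_sub_le _ _).
by rewrite vnormN vnorm_scalar_mx lerD2l lerN2 toeplitz_mx_norm.
Qed.

Lemma shift_shift n (E : 'M[C]_n) l z : E - l%:M - z%:M = E - (l + z)%:M.
Proof. by rewrite raddfD /= opprD addrA. Qed.

Variable eps : R.
Hypothesis eps0 : 0 <= eps.

Local Notation X := (ell2_pspec eps (toeplitz_op a)).

Lemma ell2_pspecE l : X l = (ell2_invnorm (shifted_toeplitz a l) <= eps) :> Prop.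
Proof. by []. Qed.

Lemma gap_contradiction (v e i i0 s s0 m : R) :
  e < v -> i <= i0 -> s0 <= s + m -> (v + e) / 2 <= s0 -> s <= e + i ->
  m < (v - e) / 6 -> i0 < (v - e) / 6 -> False.
Proof. by lra. Qed.

(** A point at which [nu > eps] has a neighbourhood on which [smin (A_M - l)] exceeds
    [eps] by a fixed amount for large [M], by [sections_stable] and the Lipschitz
    bound; all other points of interest are near [X]. The margin [eta] absorbs
    [eps'_n] when the lemma is applied to [Gamma]. *)
Lemma sections_in_pspec (d : R) : 0 < d ->
  exists2 eta : R, 0 < eta & exists M0, forall M, (0 < M)%N -> (M0 <= M)%N ->
    within_dist d [set l | smin (toeplitz_mx a M - l%:M) <= eps + eta] X.
Proof.
move=> d0.
pose P n (l : C) := forall M, (0 < M)%N -> (n <= M)%N ->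
  smin (toeplitz_mx a M - l%:M) <= eps + n.+1%:R^-1 ->
  exists2 t, X t & normc (l - t) < d.
have [|M0 MP] := @locally_uniform_disc R (K + eps + 1) P.
  move=> l0; have d2 : 0 < d / 2 by rewrite divr_gt0.
  have [[t Xt lt]|nex] := pselect (exists2 t, X t & normc (l0 - t) < d / 2).
    exists (d / 2) => //; exists 0%N => n _ l ll0 M _ _ _; exists t => //.
    by rewrite (le_lt_trans (normc_triangle l l0 t)) // [d]splitr ltrD.
  have : ~ X l0 by move=> Xl0; apply: nex; exists l0; rewrite // subrr normc0.
  rewrite ell2_pspecE => /negP; rewrite -ltNge => nu.
  set v := ell2_invnorm _ in nu.
  have g0 : 0 < (v - eps) / 6 by rewrite divr_gt0 // subr_gt0.
  have s_lt : (v + eps) / 2 < v by lra.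
  have s_ge : 0 <= (v + eps) / 2.
    by have := eps0; lra.
  have [M0 MP] := sections_stable aK s_ge s_lt.
  have [n0 n0P] := exists_small_inv g0.
  exists ((v - eps) / 6) => //; exists (maxn M0 n0) => n.
  rewrite geq_max => /andP[M0n n0n] l ll0 M Mpos nM sl.
  have := MP M Mpos (leq_trans M0n nM).
  have := smin_lipschitz (toeplitz_mx a M) l0 l Mpos.
  rewrite normc_distC in ll0.
  have : n.+1%:R^-1 <= n0.+1%:R^-1 :> R by rewrite lef_pV2 ?posrE ?ltr0n // ler_nat.
  move=> i1 i2 i3.
  by case: (gap_contradiction nu i1 i2 i3 sl ll0 n0P).
exists M0.+1%:R^-1; first by rewrite invr_gt0 ltr0n.
exists M0 => M Mpos MM l /= sl; apply: (MP M0 (leqnn _) l _ M) => //.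
have h := le_trans (smin_toeplitz_ge l Mpos) sl.
have i1 : M0.+1%:R^-1 <= 1 :> R by rewrite invf_le1 ?ltr0n // ler1n.
by rewrite -addrA -lerBlDl (le_trans h) // lerD2l.
Qed.

Lemma sections_pspec_eventually l (c : R) : X l -> eps < c ->
  exists M0, forall M, (M0 <= M)%N -> smin (toeplitz_mx a M - l%:M) < c.
Proof.
rewrite ell2_pspecE => Xl ec; apply: contrapT => nex.
have c0 : 0 < c by exact: le_lt_trans ec.
suff : c <= ell2_invnorm (shifted_toeplitz a l) by rewrite leNgt (le_lt_trans Xl ec).
apply: (sections_invnorm aK c0) => M0; apply: contrapT => nM.
apply: nex; exists M0 => M MM; rewrite ltNge; apply/negP => cM.
by apply: nM; exists M.
Qed.

Lemma ell2_pspec_bounded l : X l -> normc l <= K + eps.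
Proof.
move=> Xl; rewrite leNgt; apply/negP => lK.
have el : eps < normc l - K by lra.
have [M0 /(_ M0.+1 (leqnSn _))] := sections_pspec_eventually Xl el.
by rewrite ltNge smin_toeplitz_ge.
Qed.

Definition no_plateau := forall r : R, 0 < r -> exists2 eta : R, 0 < eta &
  forall M l, (0 < M)%N -> smin (toeplitz_mx a M - l%:M) <= eps + eta ->
  exists2 t, normc (l - t) <= r & smin (toeplitz_mx a M - t%:M) <= eps.

(** Only finitely many points of [X] have to be approximated, one for each small
    disc that meets [X]. *)
Lemma pspec_in_sections (d : R) : no_plateau -> 0 < d ->
  exists M0, forall M, (0 < M)%N -> (M0 <= M)%N ->
    within_dist d X [set l | smin (toeplitz_mx a M - l%:M) <= eps].
Proof.
move=> np d0; have d6 : 0 < d / 6 by rewrite divr_gt0.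
pose P n (l : C) := X l -> forall M, (0 < M)%N -> (n <= M)%N ->
  exists2 t, smin (toeplitz_mx a M - t%:M) <= eps & normc (l - t) < d.
have [|M0 MP] := @locally_uniform_disc R (K + eps) P; last first.
  exists M0 => M Mpos MM l Xl; apply: (MP M0 (leqnn _) l _ Xl M Mpos MM).
  exact: ell2_pspec_bounded.
move=> l0; exists (d / 6) => //.
have [[t Xt lt]|nex] := pselect (exists2 t, X t & normc (l0 - t) < d / 6); last first.
  exists 0%N => n _ l ll0 Xl; case: nex; exists l => //.
  by rewrite normc_distC.
have [eta eta0 etaP] := np _ d6.
have ee : eps < eps + eta by rewrite ltrDl.
have [M0 MP] := sections_pspec_eventually Xt ee.
exists M0 => n M0n l ll0 _ M Mpos nM.
have [u tu su] := etaP M t Mpos (ltW (MP M (leq_trans M0n nM))).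
exists u => //; have := normc_triangle l l0 u; have := normc_triangle l0 t u.
by lra.
Qed.

Lemma no_plateau_pos : 0 < eps -> no_plateau.
Proof.
move=> e0 r r0; have K0 := l1_bound_ge0 aK.
have k0 : 0 < 2 * K + eps + 1 by lra.
have [eta eta0 etaP] := pspec_no_plateau e0 k0 r0.
exists (Num.min eta 1); first by rewrite lt_min eta0 ltr01.
move=> M l M0 sl.
have sl1 : smin (toeplitz_mx a M - l%:M) <= eps + 1.
  by rewrite (le_trans sl) // lerD2l ge_min lexx orbT.
have sle : smin (toeplitz_mx a M - l%:M) <= eps + eta.
  by rewrite (le_trans sl) // lerD2l ge_min lexx.
have lb : normc l <= K + eps + 1 by have := smin_toeplitz_ge l M0; lra.
have [|z zr sz] := etaP M _ M0 _ sle.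
  move=> x; rewrite mulmxBl (le_trans (vnormD _ _)) // vnormN vnorm_scalar_mx.
  apply: (@le_trans _ _ (K * vnorm x + (K + eps + 1) * vnorm x)).
    by rewrite lerD ?toeplitz_mx_norm // ler_wpM2r ?vnorm_ge0.
  by rewrite -mulrDl ler_wpM2r ?vnorm_ge0 //; lra.
exists (l + z); first by rewrite opprD addrA subrr add0r normcN.
by rewrite -shift_shift.
Qed.

End FiniteSections.

Section Hermitian.
Variables (R : realType) (a : int -> R[i]).
Hypothesis a_herm : forall j, a (- j) = conjc (a j).
Local Open Scope sesquilinear_scope.

Lemma toeplitz_mx_normal M : toeplitz_mx a M \is normalmx.
Proof.
have E : (toeplitz_mx a M) ^t* = toeplitz_mx a M.
  apply/matrixP => i j; rewrite !mxE.
  by rewrite -[RHS]conjcK -a_herm opprB.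
by apply/normalmxP; rewrite E.
Qed.

Lemma no_plateau_hermitian : no_plateau a 0.
Proof.
move=> r r0; exists r => // M l M0; rewrite add0r => sl.
have [mu lmu smu] := normal_eigenvalue_near M0 (toeplitz_mx_normal M) sl.
by exists mu.
Qed.

End Hermitian.

(** * Indices of a block matrix *)

Section BlockIndices.
Variables (N : nat) (m : 'I_N -> nat).
Local Notation M := (\sum_i m i)%N.
Local Open Scope nat_scope.

(** Sizes and offsets of the blocks as functions of a natural number, so that
    consecutive blocks can be summed over without ordinals. *)
Definition block_size (i : nat) : nat := if insub i is Some i' then m i' else 0.
Definition block_offset (i : nat) : nat := \sum_(j < i) block_size j.

Lemma block_size_ord (i : 'I_N) : block_size i = m i.
Proof. by rewrite /block_size valK. Qed.

Lemma block_offsetS i : block_offset i.+1 = block_offset i + block_size i.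
Proof. by rewrite /block_offset big_ord_recr. Qed.

Lemma block_offset_mono i j : i <= j -> block_offset i <= block_offset j.
Proof.
move=> ij; rewrite /block_offset (big_ord_widen j block_size ij) big_mkcond.
by apply: leq_sum => k _; case: ifP.
Qed.

Lemma block_offsetD k j :
  block_offset (k + j) = block_offset k + \sum_(i < j) block_size (k + i).
Proof. by rewrite /block_offset big_split_ord. Qed.

Lemma RankE (i : 'I_N) (p : 'I_(m i)) :
  tagnat.Rank i p = block_offset i + p :> nat.
Proof.
rewrite tagnat.RankEsum; congr (_ + _).
rewrite /block_offset (big_ord_widen_cond N xpredT _ (ltnW (ltn_ord i))) /=.
by apply: eq_bigr => j _; rewrite block_size_ord.
Qed.

Lemma block_bounds (P : 'I_M) :
  block_offset (tagnat.sig1 P) <= P < block_offset (tagnat.sig1 P).+1.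
Proof.
have PE : P = block_offset (tagnat.sig1 P) + tagnat.sig2 P :> nat.
  by rewrite -RankE tagnat.sig2K.
rewrite PE leq_addr /= block_offsetS ltn_add2l block_size_ord.
exact: ltn_ord.
Qed.

Lemma min_block_size_le i : min_block_size m <= m i.
Proof.
rewrite /min_block_size; have := mem_index_enum i; move: (\sum_j m j) => x0.
elim: (index_enum _) => //= j r IH; rewrite inE big_cons geq_min.
by case/predU1P => [->|/IH ->]; rewrite ?leqnn ?orbT.
Qed.

(** Between two blocks that are not adjacent lies at least one whole block. *)
Lemma nonadjacent_far (P Q : 'I_M) : (tagnat.sig1 Q).+1 < tagnat.sig1 P ->
  min_block_size m <= P - Q.
Proof.
move=> QP; have /andP[_ Qlt] := block_bounds Q; have /andP[leP _] := block_bounds P.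
have lt1 : (tagnat.sig1 Q).+1 < N by apply: leq_ltn_trans (ltn_ord (tagnat.sig1 P)); exact: ltnW.
have := min_block_size_le (Ordinal lt1); rewrite -block_size_ord /= => w.
have := block_offset_mono QP; rewrite block_offsetS.
move: (block_offset _) (block_offset _) (block_size _) Qlt leP w => x y z.
move: (min_block_size m) (nat_of_ord P) (nat_of_ord Q) => b p q; clear.
lia.
Qed.

Lemma sum_blocks (V : nmodType) (f : 'I_M -> V) :
  (\sum_P f P = \sum_i \sum_(p < m i) f (tagnat.Rank i p))%R.
Proof.
rewrite sig_big_dep /= (reindex _ tagnat.sig_bij_on) /=.
apply: eq_bigr => P _. by congr f; rewrite -[LHS]tagnat.sig2K.
Qed.

Lemma posP k i : pos N k = Some i -> i.+1 = k.
Proof. by case: k => //= k; case: insubP => // j _ jk [<-]; rewrite jk. Qed.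

Lemma pos_ltn k (kN : k < N) : pos N k.+1 = Some (Ordinal kN).
Proof. by rewrite /= insubT. Qed.

(** The fictitious blocks outside the matrix have no global indices; with this
    convention [xblock] is a plain lookup ([xblockE]). *)
Definition global_index (u : option 'I_N) : 'I_(xsize m u) -> option 'I_M :=
  match u with
  | Some i => fun p => Some (tagnat.Rank i p)
  | None => fun _ => None
  end.

Lemma xblockE (R : realType) (B : 'M[R[i]]_M) u v p q :
  xblock B u v p q = match global_index p, global_index q with
                     | Some P, Some Q => B P Q | _, _ => 0%R end.
Proof. by case: u p => [i|] p; case: v q => [j|] q; rewrite /= ?mxE. Qed.

Lemma global_index_pos k (p : 'I_(xsize m (pos N k.+1))) : k < N ->
  exists P, [/\ global_index p = Some P, tagnat.sig1 P = k :> nat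
    & P = block_offset k + p :> nat].
Proof.
move=> kN; move: p; rewrite (pos_ltn kN) => p; exists (tagnat.Rank _ p).
by rewrite tagnat.Rank1K RankE.
Qed.

Lemma xsize_pos k : k < N -> xsize m (pos N k.+1) = block_size k.
Proof. by move=> kN; rewrite (pos_ltn kN) [RHS](block_size_ord (Ordinal kN)). Qed.

Section Window.
Variables n k : nat.
Hypothesis kn : k + n <= N.
Local Notation msum := (\sum_(j < n) msize m k j)%N.

Lemma msizeE (j : 'I_n) : msize m k j = block_size (k + j).
Proof.
rewrite /msize addnS xsize_pos //.
by apply: leq_trans kn; rewrite ltn_add2l.
Qed.

Lemma window_size : block_offset (k + n) = block_offset k + msum.
Proof. by rewrite block_offsetD; congr (_ + _); apply: eq_bigr => j _; rewrite msizeE. Qed.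

Lemma window_ge : (forall i, 0 < m i) -> n <= msum.
Proof.
move=> m0; apply: (@leq_trans (\sum_(j < n) 1)); first by rewrite sum1_card card_ord.
apply: leq_sum => j _.
have kjN : k + j < N by apply: leq_trans kn; rewrite ltn_add2l.
by rewrite msizeE -[k + j]/(nat_of_ord (Ordinal kjN)) block_size_ord.
Qed.

Lemma window_column (t : 'I_msum) : exists P : 'I_M,
  [/\ global_index (tagnat.sig2 t) = Some P,
      tagnat.sig1 P = k + tagnat.sig1 t :> nat
    & P = block_offset k + t :> nat].
Proof.
have kjN : k + tagnat.sig1 t < N by apply: leq_trans kn; rewrite ltn_add2l.
have : exists P : 'I_M, [/\ global_index (tagnat.sig2 t) = Some P,
      tagnat.sig1 P = k + tagnat.sig1 t :> nat
    & P = block_offset (k + tagnat.sig1 t) + tagnat.sig2 t :> nat].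
  move: (tagnat.sig2 t); rewrite /msize addnS => p; exact: global_index_pos.
case=> P [gP sP PE]; exists P; split=> //.
rewrite PE block_offsetD -addnA; congr (_ + _).
rewrite [RHS](tagnat.rect t); congr (_ + _).
rewrite (big_ord_widen_cond n xpredT (fun i => block_size (k + i)) (ltnW (ltn_ord (tagnat.sig1 t)))) /=.
by apply: eq_bigr => j _; rewrite msizeE.
Qed.

(** The columns of a window of [n] blocks are exactly the indices of the blocks
    [k], ..., [k + n - 1]; the dependent block types [msize] disappear from here
    on. *)
Lemma window_embedding : exists g : 'I_msum -> 'I_M,
  [/\ forall t, global_index (tagnat.sig2 t) = Some (g t),
      forall t, tagnat.sig1 (g t) = k + tagnat.sig1 t :> nat,
      forall t, g t = block_offset k + t :> nat
    & forall P, k <= tagnat.sig1 P < k + n -> exists t, g t = P].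
Proof.
have [g gP] := choice window_column.
exists g; split=> [t|t|t|P /andP[kP Pn]]; try by case: (gP t).
have /andP[leP ltP] := block_bounds P.
have Pt : P - block_offset k < msum.
  have := leq_trans ltP (block_offset_mono Pn); rewrite window_size.
  have := leq_trans (block_offset_mono kP) leP.
  by clear; lia.
exists (Ordinal Pt); apply: val_inj; have [_ _ /= ->] := gP (Ordinal Pt).
by rewrite /= subnKC // (leq_trans (block_offset_mono kP)).
Qed.

End Window.
End BlockIndices.

(** * Windows of a block tridiagonal matrix *)

Section Windows.
Variables (R : realType) (N : nat) (m : 'I_N -> nat).
Local Notation C := R[i].
Local Notation M := (\sum_i m i)%N.
Implicit Types (A B : 'M[C]_M) (y : 'cV[C]_M).

Definition adjacent (P Q : 'I_M) : bool :=
  ((tagnat.sig1 P <= (tagnat.sig1 Q).+1) && (tagnat.sig1 Q <= (tagnat.sig1 P).+1))%N.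

Lemma tridiag_partE A P Q :
  tridiag_part A P Q = if adjacent P Q then A P Q else 0.
Proof.
rewrite mxE /adjacent; case: ifP => _; last by rewrite mxE.
by rewrite mxE !tagnat.sig2K.
Qed.

Lemma sum_inj_le (I J : finType) (h : J -> I) (c : pred I) (f : I -> R) :
  injective h -> (forall i, 0 <= f i) -> (forall j, c (h j)) ->
  \sum_j f (h j) <= \sum_(i | c i) f i.
Proof.
move=> hI f0 ch.
have -> : \sum_j f (h j) = \sum_(j in [set: J]%SET) f (h j).
  by apply: eq_bigl => j; rewrite inE.
rewrite -(big_imset f (in2W hI)) /=.
rewrite big_mkcond [leRHS]big_mkcond; apply: ler_sum => i _.
case: ifP => [/imsetP[j _ ->]|_]; first by rewrite ch.
by case: ifP.
Qed.

(** The rows of the block [u], which may be a fictitious one, are different rows of the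
    whole matrix; [c] selects the rows of that block. *)
Lemma block_rows_le (u : option 'I_N) (f : 'I_M -> R) (c : pred 'I_M) :
  (forall P, 0 <= f P) ->
  (forall (p : 'I_(xsize m u)) P, global_index p = Some P -> c P) ->
  \sum_(p < xsize m u) (if global_index p is Some P then f P else 0) <=
  \sum_(P | c P) f P.
Proof.
move=> f0; case: u => [i|] gc /=; last by rewrite big1 ?sumr_ge0.
apply: (@sum_inj_le _ _ (tagnat.Rank i)) => // [p q|p]; last exact: (gc p).
by move=> /(congr1 val)/eqP; rewrite tagnat.eq_Rank eqxx => /eqP/val_inj.
Qed.

Section OneWindow.
Variables (n k : nat) (kn : (k + n <= N)%N).
Local Notation msum := (\sum_(j < n) msize m k j)%N.

Lemma vnorm_three_blocks p q r l (X : 'M[C]_(p, q)) (Y : 'M[C]_q) (Z : 'M[C]_(r, q)) x :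
  vnorm ((col_mx X (col_mx Y Z) - l *: col_mx 0 (col_mx 1%:M 0)) *m x) ^+ 2 =
  vnorm (X *m x) ^+ 2 + (vnorm ((Y - l%:M) *m x) ^+ 2 + vnorm (Z *m x) ^+ 2).
Proof.
have -> : l *: col_mx 0 (col_mx 1%:M 0) = col_mx 0 (col_mx l%:M 0) :> 'M[C]_(p + (q + r), q).
  by rewrite 2!scale_col_mx !scaler0 scalemx1.
have -> : col_mx X (col_mx Y Z) - col_mx 0 (col_mx l%:M 0) = col_mx X (col_mx (Y - l%:M) Z).
  by rewrite 2!opp_col_mx !oppr0 2!add_col_mx !addr0.
by rewrite 2!mul_col_mx 2!vnorm_col_mx.
Qed.

Lemma Bplus_mul B l (x : 'cV[C]_msum) :
  vnorm ((Bplus n k B - l *: Iplus R m n k) *m x) ^+ 2 =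
  vnorm (Btop n k B *m x) ^+ 2 +
  (vnorm ((Bnk n k B - l%:M) *m x) ^+ 2 + vnorm (Bbot n k B *m x) ^+ 2).
Proof.
exact: vnorm_three_blocks.
Qed.

Lemma BnkE B (g : 'I_msum -> 'I_M) :
  (forall t, global_index (tagnat.sig2 t) = Some (g t)) ->
  forall s t, Bnk n k B s t = B (g s) (g t).
Proof. by move=> gE s t; rewrite mxE xblockE !gE. Qed.

(** A vector supported on [n] consecutive blocks does not see the rest of a block
    tridiagonal matrix, except for the two rows of blocks next to the window. *)
Lemma smin_window_le B l y :
  (forall P Q, ~~ adjacent P Q -> B P Q = 0) ->
  (forall P, ~~ (k <= tagnat.sig1 P < k + n)%N -> y P 0 = 0) ->
  smin (Bplus n k B - l *: Iplus R m n k) * vnorm y <= vnorm ((B - l%:M) *m y).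
Proof.
move=> Btri y0; have [g [gE g1 gv gsurj]] := window_embedding m kn.
have gI : injective g.
  by move=> s t /(congr1 (@nat_of_ord _)); rewrite !gv => /addnI/val_inj.
have sum_window (V : nmodType) (F : 'I_M -> V) :
    (forall P, ~~ (k <= tagnat.sig1 P < k + n)%N -> F P = 0) ->
    \sum_P F P = \sum_t F (g t).
  move=> F0; have -> : \sum_t F (g t) = \sum_(t in [set: 'I_msum]%SET) F (g t).
    by apply: eq_bigl => t; rewrite inE.
  rewrite -(big_imset F (in2W gI)) /=.
  rewrite [RHS]big_mkcond; apply: eq_bigr => P _; case: ifP => //.
  move=> /negbT nP; apply: F0; apply: contra nP => /gsurj[t <-].
  exact: imset_f.
pose x : 'cV[C]_msum := \col_t y (g t) 0.
have xy : vnorm x = vnorm y.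
  rewrite !vnormE /l2; congr Num.sqrt.
  rewrite (sum_window _ (fun P => normc (y P 0) ^+ 2)).
    by apply: eq_bigr => t _; rewrite mxE.
  by move=> P /y0 ->; rewrite normc0 expr0n.
set Z := (B - l%:M) *m y.
have ZE P : Z P 0 = \sum_t B P (g t) * y (g t) 0 - l * y P 0.
  rewrite /Z mulmxBl mul_scalar_mx !mxE; congr (_ - _).
  by apply: (sum_window _ (fun Q => B P Q * y Q 0)) => Q /y0 ->; rewrite mulr0.
pose f P := normc (Z P 0) ^+ 2.
have f0 P : 0 <= f P by exact: sqr_ge0.
have top : vnorm (Btop n k B *m x) ^+ 2 <=
    \sum_(P | ((tagnat.sig1 P).+1 == k)%N) f P.
  rewrite vnormE sqr_l2.
  have h (p : 'I_(xsize m (pos N k))) P :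
    global_index p = Some P -> ((tagnat.sig1 P).+1 == k)%N.
    have := @posP N k; move: p; case: (pos N k) => //= i p ik [<-].
    by rewrite tagnat.Rank1K (ik i).
  apply: le_trans (block_rows_le f0 h); apply: ler_sum => p _.
  have -> : (Btop n k B *m x) p 0 = \sum_t
      (if tagnat.sig1 t == 0 :> nat then
        if global_index p is Some P then B P (g t) else 0 else 0) * y (g t) 0.
    rewrite mxE; apply: eq_bigr => t _; rewrite !mxE; congr (_ * _).
    by case: ifP => _; rewrite ?mxE // xblockE gE.
  case gp : (global_index p) => [P|]; last first.
    by rewrite big1 ?normc0 ?expr0n // => t _; case: ifP; rewrite mul0r.
  have /eqP Pk := h p P gp.
  rewrite /f ZE y0 ?mulr0 ?subr0; last by rewrite -Pk ltnn.
  rewrite le_eqVlt; apply/orP; left; apply/eqP; congr (normc _ ^+ 2).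
  apply: eq_bigr => t _; case: ifP => // /negbT t0; rewrite Btri ?mul0r //.
  rewrite /adjacent g1.
  by move: (nat_of_ord (tagnat.sig1 t)) (nat_of_ord (tagnat.sig1 P)) Pk t0 => i j; clear; lia.
have bot : vnorm (Bbot n k B *m x) ^+ 2 <=
    \sum_(P | (tagnat.sig1 P == k + n :> nat)%N) f P.
  rewrite vnormE sqr_l2.
  have h (p : 'I_(xsize m (pos N (k + n.+1)))) P :
    global_index p = Some P -> (tagnat.sig1 P == k + n :> nat)%N.
    have := @posP N (k + n.+1); move: p; case: (pos N _) => //= i p ik [<-].
    by rewrite tagnat.Rank1K; have /eqP := ik i erefl; rewrite addnS eqSS.
  apply: le_trans (block_rows_le f0 h); apply: ler_sum => p _.
  have -> : (Bbot n k B *m x) p 0 = \sum_t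
      (if (tagnat.sig1 t).+1 == n then
        if global_index p is Some P then B P (g t) else 0 else 0) * y (g t) 0.
    rewrite mxE; apply: eq_bigr => t _; rewrite !mxE; congr (_ * _).
    by case: ifP => _; rewrite ?mxE // xblockE gE.
  case gp : (global_index p) => [P|]; last first.
    by rewrite big1 ?normc0 ?expr0n // => t _; case: ifP; rewrite mul0r.
  have /eqP Pk := h p P gp.
  rewrite /f ZE y0 ?mulr0 ?subr0; last by rewrite Pk ltnn andbF.
  rewrite le_eqVlt; apply/orP; left; apply/eqP; congr (normc _ ^+ 2).
  apply: eq_bigr => t _; case: ifP => // /negbT tn; rewrite Btri ?mul0r //.
  have := ltn_ord (tagnat.sig1 t); rewrite /adjacent g1.
  by move: (nat_of_ord (tagnat.sig1 t)) (nat_of_ord (tagnat.sig1 P)) Pk tn => i j; clear; lia.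
have mid : vnorm ((Bnk n k B - l%:M) *m x) ^+ 2 <=
    \sum_(P | (k <= tagnat.sig1 P < k + n)%N) f P.
  rewrite vnormE sqr_l2.
  apply: (@le_trans _ _ (\sum_t f (g t))); last first.
    by apply: sum_inj_le => // t; rewrite g1 leq_addr ltn_add2l ltn_ord.
  apply: ler_sum => s _; rewrite le_eqVlt; apply/orP; left; apply/eqP.
  rewrite /f ZE; congr (normc _ ^+ 2).
  rewrite mulmxBl mul_scalar_mx !mxE; congr (_ - _).
  by apply: eq_bigr => t _; rewrite (BnkE B gE) mxE.
rewrite -xy; apply: le_trans (smin_mul_le _ _) _.
rewrite -ler_sqr ?nnegrE ?vnorm_ge0 // Bplus_mul.
apply: (le_trans (lerD top (lerD mid bot))).
rewrite [leRHS]sqr_l2 -/f ![X in X + _]big_mkcond [X in _ + (_ + X)]big_mkcond.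
rewrite [X in _ + (X + _)]big_mkcond -!big_split /=; apply: ler_sum => P _.
rewrite -/(f P); have := f0 P; move: (f P) (nat_of_ord _) => r j.
by case: eqP => h1; case: eqP => h2; case: ifP => h3; rewrite ?addr0 ?add0r //;
  move: h1 h2 h3; clear; lia.
Qed.

Lemma smin_Bnk_le B l : (0 < msum)%N ->
  smin (Bnk n k B - l%:M) <= smin (Bplus n k B - l *: Iplus R m n k).
Proof.
move=> m0; apply: le_smin => // x; apply: le_trans (smin_mul_le _ _) _.
rewrite -ler_sqr ?nnegrE ?vnorm_ge0 // Bplus_mul.
by rewrite addrCA lerDl addr_ge0 ?sqr_ge0.
Qed.

End OneWindow.
End Windows.

(** * Sine weights and commutators with block multiplication *)

Section Inclusion.
Variables (R : realType) (N : nat) (m : 'I_N -> nat).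
Local Notation C := R[i].
Local Notation M := (\sum_i m i)%N.
Implicit Types (A : 'M[C]_M) (x : 'I_M -> C).

(** A block matrix whose blocks sit on a partial permutation [e] maps different block
    components to different block components, so its norm is the largest norm of
    a block. *)
Lemma blockwise_norm A (e : rel 'I_N) (r : R) x : 0 <= r ->
  (forall i j j', e i j -> e i j' -> j = j') ->
  (forall i i' j, e i j -> e i' j -> i = i') ->
  (forall i j, e i j -> mxnorm (submxblock A i j) <= r) ->
  l2 (fun P => \sum_Q (if e (tagnat.sig1 P) (tagnat.sig1 Q) then A P Q else 0) * x Q)
    <= r * l2 x.
Proof.
move=> r0 efun einj er.
pose xb (j : 'I_N) : 'cV[C]_(m j) := \col_q x (tagnat.Rank j q).
have xbE : l2 x ^+ 2 = \sum_j vnorm (xb j) ^+ 2.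
  rewrite sqr_l2 sum_blocks; apply: eq_bigr => j _.
  by rewrite vnormE sqr_l2; apply: eq_bigr => q _; rewrite mxE.
rewrite l2_le ?mulr_ge0 ?l2_ge0 // exprMn xbE sum_blocks mulr_sumr.
have rowE i (p : 'I_(m i)) :
    \sum_Q (if e (tagnat.sig1 (tagnat.Rank i p)) (tagnat.sig1 Q)
            then A (tagnat.Rank i p) Q else 0) * x Q =
    \sum_j (if e i j then (submxblock A i j *m xb j) p 0 else 0).
  rewrite sum_blocks; apply: eq_bigr => j _; case: ifP => eij.
    rewrite mxE; apply: eq_bigr => q _.
    by rewrite !tagnat.Rank1K eij !mxE.
  by rewrite big1 // => q _; rewrite !tagnat.Rank1K eij mul0r.
apply: (@le_trans _ _ (\sum_i \sum_j (if e i j then r ^+ 2 * vnorm (xb j) ^+ 2 else 0))).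
  apply: ler_sum => i _.
  apply: (@le_trans _ _ (\sum_(p < m i) normc (\sum_j
      (if e i j then (submxblock A i j *m xb j) p 0 else 0)) ^+ 2)).
    by apply: ler_sum => p _; rewrite rowE.
  have [[j eij]|nei] := pselect (exists j, e i j); last first.
    rewrite [leLHS]big1 => [|p _].
      by apply: sumr_ge0 => j _; case: (e i j) => //; rewrite mulr_ge0 ?sqr_ge0.
    rewrite big1 ?normc0 ?expr0n // => j _; case: ifP => // eij.
    by case: nei; exists j.
  have only j' : j' != j -> e i j' = false.
    by move=> jj'; apply/negP => eij'; move: jj'; rewrite (efun _ _ _ eij eij') eqxx.
  rewrite [leRHS](bigD1 j) //= eij [X in _ + X]big1 ?addr0; last first.
    by move=> j' /only ->.
  under eq_bigr => p _.
    rewrite (bigD1 j) //= eij [X in _ + X]big1 ?addr0; last first.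
      by move=> j' /only ->.
    over.
  rewrite -(sqr_l2 (fun p => (submxblock A i j *m xb j) p 0)) -exprMn.
  rewrite ler_sqr ?nnegrE ?mulr_ge0 ?vnorm_ge0 ?l2_ge0 // -vnormE.
  apply: le_trans (mxnorm_mul_le _ _) _.
  by rewrite ler_wpM2r ?vnorm_ge0 ?er.
rewrite exchange_big /=; apply: ler_sum => j _.
have [[i eij]|nej] := pselect (exists i, e i j); last first.
  rewrite [leLHS]big1 => [|i _]; first by rewrite mulr_ge0 ?sqr_ge0.
  case: ifP => // eij.
  by case: nej; exists i.
rewrite (bigD1 i) //= eij big1 ?addr0 // => i' ii'.
by case: ifP => // ei'j; move: ii'; rewrite (einj _ _ _ eij ei'j) eqxx.
Qed.

Lemma l2_pair_weighted (W : finType) (f : W -> 'I_M -> R) (F : 'I_M -> C) (c : R) :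
  0 <= c -> (forall P, F P != 0 -> \sum_k f k P ^+ 2 = c ^+ 2) ->
  l2 (fun kP : W * 'I_M => (f kP.1 kP.2)%:C%C * F kP.2) = c * l2 F.
Proof.
move=> c0 fc; apply/eqP; rewrite -(@eqrXn2 _ 2) ?mulr_ge0 ?l2_ge0 // exprMn !sqr_l2.
rewrite -(pair_big xpredT xpredT (fun k P => normc ((f k P)%:C%C * F P) ^+ 2)) /=.
rewrite exchange_big mulr_sumr /=; apply/eqP/eq_bigr => P _.
have [->|FP] := eqVneq (F P) 0.
  by rewrite normc0 expr0n mulr0 big1 // => k _; rewrite mulr0 normc0 expr0n.
rewrite -(fc P FP) mulr_suml; apply: eq_bigr => k _.
by rewrite normcM normc_real exprMn real_normK ?num_real.
Qed.

End Inclusion.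

Section SineWeights.
Variable R : realType.

(** The recurrence [sin (t + th) + sin (t - th) = 2 cos th sin t] makes the difference
    of the two sums telescope. *)
Lemma sum_sqr_sin_diff (th : R) p :
  \sum_(j < p) (sin (th * j.+1%:R) - sin (th * j%:R)) ^+ 2 =
  2 * (1 - cos th) * \sum_(j < p) sin (th * j%:R) ^+ 2
  + sin (th * p%:R) ^+ 2 - sin (th * p%:R) * sin (th * p%:R - th).
Proof.
elim: p => [|p IH]; first by rewrite !big_ord0 !mulr0 !sin0 expr0n /= mul0r subr0 addr0.
have thS : th * p.+1%:R = th * p%:R + th by rewrite -natr1 mulrDr mulr1.
rewrite !big_ord_recr /= IH thS addrK.
move: (\sum_(i < p) _) (th * p%:R) => S t; rewrite !sinD sinN cosN; ring.
Qed.

Variables (N n : nat).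
Let th : R := pi / n.+1%:R.

(** The eigenvector of the discrete Dirichlet Laplacian on [n] points for its least
    eigenvalue [4 sin^2(th / 2)], placed on the integers from [N + 1] to [N + n]. *)
Definition weight (t : nat) : R :=
  if (t <= N + n.+1)%N then sin (th * (t - N)%:R) else 0.

Definition weight_norm : R := Num.sqrt (\sum_(j < n.+1) sin (th * j%:R) ^+ 2).

Lemma weight_left t : (t <= N)%N -> weight t = 0.
Proof.
move=> tN; rewrite /weight; have -> : (t - N = 0)%N by apply/eqP; rewrite subn_eq0.
by rewrite mulr0 sin0; case: ifP.
Qed.

Lemma weight_right t : (N + n.+1 <= t)%N -> weight t = 0.
Proof.
rewrite /weight leq_eqVlt => /orP[/eqP <-|]; last by rewrite ltnNge => /negbTE ->.
by rewrite leqnn addKn /th divfK ?pnatr_eq0 // sinpi.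
Qed.

Lemma weightE j : (j <= n.+1)%N -> weight (N + j) = sin (th * j%:R).
Proof. by move=> jn; rewrite /weight leq_add2l jn addKn. Qed.

(** Summing over all translates of a window makes the sum independent of the position
    [b]; the support is placed at [N] so that no subtraction is truncated. *)
Lemma sum_shift (G : nat -> R) b : (b <= N)%N ->
  (forall t, (t < N)%N || (N + n < t)%N -> G t = 0) ->
  \sum_(k < N + n.+1) G (b + k)%N = \sum_(j < n.+1) G (N + j)%N.
Proof.
move=> bN G0.
have -> : \sum_(k < N + n.+1) G (b + k)%N = \sum_(b <= t < b + (N + n.+1)) G t.
  rewrite -(big_mkord xpredT (fun k => G (b + k)%N)) -[X in _ = \sum_(X <= _ < _) _]add0n big_addn.
  by rewrite addKn; apply: eq_bigr => k _; rewrite addnC.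
have -> : \sum_(j < n.+1) G (N + j)%N = \sum_(N <= t < N + n.+1) G t.
  rewrite -(big_mkord xpredT (fun k => G (N + k)%N)) -[X in _ = \sum_(X <= _ < _) _]add0n big_addn.
  by rewrite addKn; apply: eq_bigr => k _; rewrite addnC.
have h1 : (N <= b + (N + n.+1))%N by clear; lia.
have h2 : (N + n.+1 <= b + (N + n.+1))%N by rewrite leq_addl.
rewrite (big_cat_nat (n := N)) //= (big_cat_nat (m := N) (n := N + n.+1)) ?leq_addr //=.
rewrite [X in X + _]big_nat [X in X + _]big1 ?add0r; last first.
  by move=> t /andP[_ tN]; rewrite G0 // tN.
rewrite [X in _ + X]big_nat [X in _ + X]big1 ?addr0 //.
by move=> t /andP[tN _]; rewrite G0 // -ltnS -addnS tN orbT.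
Qed.

Lemma sum_sqr_weight b : (b <= N)%N ->
  \sum_(k < N + n.+1) weight (b + k) ^+ 2 = weight_norm ^+ 2.
Proof.
move=> bN; rewrite (sum_shift (G := fun t => weight t ^+ 2) bN).
  rewrite sqr_sqrtr ?sumr_ge0 // => [|j _]; last exact: sqr_ge0.
  by apply: eq_bigr => j _; rewrite weightE // ltnW.
move=> t /orP[/ltnW /weight_left ->|tn]; first by rewrite expr0n.
by rewrite weight_right ?expr0n // addnS.
Qed.

(** The source of the constant [2 sin (pi / (2 n + 2))]: at [p = n + 1] the boundary
    terms of [sum_sqr_sin_diff] vanish, and [1 - cos th = 2 sin^2 (th / 2)]. *)
Lemma sum_sqr_weight_diff b : (b <= N)%N ->
  \sum_(k < N + n.+1) (weight (b + k).+1 - weight (b + k)) ^+ 2 =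
  (2 * sin (th / 2) * weight_norm) ^+ 2.
Proof.
move=> bN; rewrite (sum_shift (G := fun t => (weight t.+1 - weight t) ^+ 2) bN).
  rewrite exprMn sqr_sqrtr ?sumr_ge0 // => [|j _]; last exact: sqr_ge0.
  transitivity (\sum_(j < n.+1) (sin (th * j.+1%:R) - sin (th * j%:R)) ^+ 2).
    by apply: eq_bigr => j _; rewrite -addnS !weightE // ltnW.
  rewrite sum_sqr_sin_diff.
  have -> : sin (th * n.+1%:R) = 0 by rewrite /th divfK ?pnatr_eq0 // sinpi.
  rewrite expr0n mul0r addr0 subr0; congr (_ * _).
  rewrite [in LHS](splitr th) cosD -!expr2 cos2sin2; ring.
move=> t /orP[tN|tn].
  by rewrite !weight_left ?subrr ?expr0n // ltnW.
by rewrite !weight_right ?subrr ?expr0n // -?addnS ?addnS // ltnW // addnS.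
Qed.

Lemma weight_norm_gt0 : (0 < n)%N -> 0 < weight_norm.
Proof.
move=> n0; rewrite sqrtr_gt0; have n1 : (1 < n.+1)%N by [].
rewrite (bigD1 (Ordinal n1)) //= ltr_pwDl //; last first.
  by apply: sumr_ge0 => j _; exact: sqr_ge0.
rewrite exprn_gt0 // mulr1 sin_gt0_pi // /th.
by rewrite divr_gt0 ?pi_gt0 //= ltr_pdivrMr ?ltr0n // ltr_pMr ?pi_gt0 // ltr1n.
Qed.

Lemma sin_half_ge0 : 0 <= sin (th / 2).
Proof.
have p0 := @pi_gt0 R.
apply: sin_ge0_pi; rewrite /th !divr_ge0 ?(ltW p0) //=.
rewrite -mulrA ler_piMr ?(ltW p0) // -invfM invf_le1 ?mulr_gt0 ?ltr0n //.
by rewrite -natrM ler1n.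
Qed.

Lemma half_angle : th / 2 = pi / (2 * n%:R + 2).
Proof.
have -> : 2 * n%:R + 2 = n.+1%:R * 2 :> R by rewrite -natr1; ring.
by rewrite /th invfM mulrA.
Qed.

End SineWeights.

Section PseudospectrumInclusion.
Variables (R : realType) (N : nat) (m : 'I_N -> nat).
Local Notation C := R[i].
Local Notation M := (\sum_i m i)%N.
Implicit Types A : 'M[C]_M.

Lemma r_U_ge A (i j : 'I_N) : j = i.+1 :> nat -> mxnorm (submxblock A i j) <= r_U A.
Proof.
move=> /eqP ij; exact: (@le_bigmax_cond _ _ _ 0 (i, j)
  (fun p : 'I_N * 'I_N => p.2 == p.1.+1 :> nat)
  (fun p => mxnorm (submxblock A p.1 p.2)) ij).
Qed.

Lemma r_L_ge A (i j : 'I_N) : i = j.+1 :> nat -> mxnorm (submxblock A i j) <= r_L A.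
Proof.
move=> /eqP ij; exact: (@le_bigmax_cond _ _ _ 0 (i, j)
  (fun p : 'I_N * 'I_N => p.1 == p.2.+1 :> nat)
  (fun p => mxnorm (submxblock A p.1 p.2)) ij).
Qed.

Lemma r_U_ge0 A : 0 <= r_U A.
Proof. exact: bigmax_ge_id. Qed.

Lemma r_L_ge0 A : 0 <= r_L A.
Proof. exact: bigmax_ge_id. Qed.

Lemma r_U_le A (K : R) : 0 <= K -> (forall i j, mxnorm (submxblock A i j) <= K) -> r_U A <= K.
Proof. by move=> K0 AK; apply/bigmax_leP; split. Qed.

Lemma r_L_le A (K : R) : 0 <= K -> (forall i j, mxnorm (submxblock A i j) <= K) -> r_L A <= K.
Proof. by move=> K0 AK; apply/bigmax_leP; split. Qed.

Definition upper_part A (x : 'I_M -> C) (P : 'I_M) : C :=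
  \sum_Q (if tagnat.sig1 Q == (tagnat.sig1 P).+1 :> nat then A P Q else 0) * x Q.

Definition lower_part A (x : 'I_M -> C) (P : 'I_M) : C :=
  \sum_Q (if tagnat.sig1 P == (tagnat.sig1 Q).+1 :> nat then A P Q else 0) * x Q.

Lemma upper_part_le A x : l2 (upper_part A x) <= r_U A * l2 x.
Proof.
apply: (@blockwise_norm _ _ _ A (fun i j => j == i.+1 :> nat)); first exact: r_U_ge0.
- by move=> i j j' /eqP ij /eqP ij'; apply: val_inj; rewrite /= ij ij'.
- by move=> i i' j /eqP -> /eqP [] /val_inj.
- by move=> i j /eqP; exact: r_U_ge.
Qed.

Lemma lower_part_le A x : l2 (lower_part A x) <= r_L A * l2 x.
Proof.
apply: (@blockwise_norm _ _ _ A (fun i j => i == j.+1 :> nat)); first exact: r_L_ge0.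
- by move=> i j j' /eqP -> /eqP [] /val_inj.
- by move=> i i' j /eqP ij /eqP ij'; apply: val_inj; rewrite /= ij ij'.
- by move=> i j /eqP; exact: r_L_ge.
Qed.

(** Multiplication by a function of the block index commutes with diagonal blocks; on
    the two neighbouring diagonals only differences of weights remain. *)
Lemma tridiag_commutator A l (x : 'cV[C]_M) (w : nat -> R) P :
  let y : 'cV[C]_M := \col_Q ((w (tagnat.sig1 Q))%:C%C * x Q 0) in
  ((tridiag_part A - l%:M) *m y) P 0 =
  (w (tagnat.sig1 P))%:C%C * ((tridiag_part A - l%:M) *m x) P 0
  + ((w (tagnat.sig1 P).+1 - w (tagnat.sig1 P))%:C%C * upper_part A (fun Q => x Q 0) P
     + (w (tagnat.sig1 P).-1 - w (tagnat.sig1 P))%:C%C * lower_part A (fun Q => x Q 0) P).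
Proof.
move=> y; set b := nat_of_ord (tagnat.sig1 P).
have E (z : 'cV[C]_M) : ((tridiag_part A - l%:M) *m z) P 0 =
    \sum_Q (if adjacent P Q then A P Q else 0) * z Q 0 - l * z P 0.
  rewrite mulmxBl mul_scalar_mx.
  have -> (u v : 'cV[C]_M) : (u - l *: v) P 0 = u P 0 - l * v P 0 by rewrite !mxE.
  rewrite mulmx_col; congr (_ - _).
  by apply: eq_bigr => Q _; rewrite tridiag_partE.
rewrite !E mulrBr addrAC /upper_part /lower_part !mulr_sumr -!big_split /=.
congr (_ - _); last by rewrite mxE; ring.
apply: eq_bigr => Q _; rewrite mxE /adjacent -/b.
move: (A P Q) (x Q 0) (nat_of_ord (tagnat.sig1 Q)) => u v c.
have [->|cb] := eqVneq c b.+1.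
  have -> : (b <= b.+2)%N && (b.+1 <= b.+1)%N by clear; lia.
  have -> : (b == b.+2) = false by clear; lia.
  by rewrite rmorphB /=; ring.
have [bc|bc] := eqVneq b c.+1.
  rewrite bc /=; have -> : (c.+1 <= c.+1)%N && (c <= c.+2)%N by clear; lia.
  by rewrite rmorphB /=; ring.
have [->|cb'] := eqVneq c b.
  have -> : (b <= b.+1)%N && (b <= b.+1)%N by clear; lia.
  by ring.
have -> : (b <= c.+1)%N && (c <= b.+1)%N = false by move: cb bc cb'; clear; lia.
by ring.
Qed.

End PseudospectrumInclusion.

(** * The inclusion of the pseudospectrum in Gamma *)

Section PseudospectrumInGamma.
Variables (R : realType) (N : nat) (m : 'I_N -> nat).
Local Notation C := R[i].
Local Notation M := (\sum_i m i)%N.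

(** The constants of [pspec_sub_Gamma]: [c] is the norm of the weights, [f], [u], [v] the
    norms of [(B - l) x] and of its upper and lower parts, [q] that of [A - B]. *)
Lemma window_budget (c sn mu f u v ru rl q : R) : 0 < c -> 0 <= sn ->
  mu * c <= c * f + (2 * sn * c * u + 2 * sn * c * v) ->
  f < mu - (2 * (rl + ru) * sn + q) + q -> u <= ru -> v <= rl -> False.
Proof.
move=> c0 sn0 h fb ub vb.
have h1 : mu <= f + (2 * sn * u + 2 * sn * v).
  rewrite -(ler_pM2r c0) (le_trans h) // le_eqVlt; apply/orP; left; apply/eqP; ring.
have h2 : sn * u <= sn * ru by rewrite ler_wpM2l.
have h3 : sn * v <= sn * rl by rewrite ler_wpM2l.
have h4 : f < mu - 2 * (sn * rl) - 2 * (sn * ru).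
  by apply: (lt_le_trans fb); rewrite le_eqVlt; apply/orP; left; apply/eqP; ring.
by lra.
Qed.

(** Let [mu] be the least of the singular values of the windows and [B] the block
    tridiagonal part of [A]. If [|(A - l) x| < s] for a unit vector [x], summing
    [mu |y_k| <= |(B - l) y_k|] in l^2 over all translates [y_k] of the weighted
    vector gives [mu c] on the left, where [c] is the norm of the weights, and at
    most [c (s + |A - B|) + 2 sin (th / 2) c (r_L + r_U)] on the right, so that
    [mu <= s + eps'_n]. *)
Lemma pspec_sub_Gamma (A : 'M[C]_M) n (eps : R) l :
  (0 < M)%N -> (0 < n)%N -> (n <= N)%N ->
  smin (A - l%:M) <= eps -> Gamma n eps A l.
Proof.
move=> M0 n0 nN Al; apply: contrapT => nG.
pose B := tridiag_part A.
pose sk k := smin (Bplus n k B - l *: Iplus R m n k).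
have big k : (k <= N - n)%N -> eps + eps' n A < sk k.
  by move=> kN; rewrite ltNge; apply/negP => h; apply: nG; exists k.
pose i0 := [arg min_(i < (ord0 : 'I_(N - n).+1)) sk i]%O.
have [mu muE] : exists mu, mu = sk i0 by exists (sk i0).
have mu_le k : (k <= N - n)%N -> mu <= sk k.
  rewrite -ltnS muE /i0 => kN; case: arg_minP => // i _ h.
  exact: (h (Ordinal kN)).
have mu_gt : eps + eps' n A < mu by rewrite muE big // -ltnS.
have mu0 : 0 <= mu by rewrite muE smin_ge0.
have [|x x1 xs] := @smin_lt _ _ _ (A - l%:M) (mu - eps' n A) M0.
  by rewrite ltrBrDr (le_lt_trans _ mu_gt) // lerD2r.
pose F P := ((B - l%:M) *m x) P 0.
pose U := upper_part A (fun Q => x Q 0).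
pose L := lower_part A (fun Q => x Q 0).
have Fle : l2 F < mu - eps' n A + mxnorm (A - B).
  rewrite -[l2 F]/(vnorm ((B - l%:M) *m x)).
  have -> : B - l%:M = (A - l%:M) - (A - B) by rewrite opprB [RHS]addrC subrKA.
  rewrite mulmxBl (le_lt_trans (vnormD _ _)) // vnormN ltr_leD //.
  by rewrite (le_trans (mxnorm_mul_le _ _)) // x1 mulr1.
have Ule : l2 U <= r_U A by have := upper_part_le A (fun Q => x Q 0); rewrite -vnormE x1 mulr1.
have Lle : l2 L <= r_L A by have := lower_part_le A (fun Q => x Q 0); rewrite -vnormE x1 mulr1.
pose c := weight_norm R n; pose w := weight R N n.
pose sn := sin (pi / n.+1%:R / 2) : R.
have sn0 : 0 <= sn by exact: sin_half_ge0.
have c0 : 0 < c by exact: weight_norm_gt0.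
have Pn (P : 'I_M) : (tagnat.sig1 P <= N)%N by rewrite ltnW.
pose y (k : nat) : 'cV[C]_M := \col_Q ((w (tagnat.sig1 Q + k)%N)%:C%C * x Q 0).
pose Z (k : nat) : 'cV[C]_M := (B - l%:M) *m y k.
have window (k : 'I_(N + n.+1)) : mu * vnorm (y k) <= vnorm (Z k).
  (* A translate that sticks out of the matrix is supported in the first or in
     the last n blocks, which form a window as well. *)
  pose k0 := minn (N.+1 - k) (N - n).
  have k0N : (k0 <= N - n)%N by exact: geq_minr.
  have kn : (k0 + n <= N)%N by move: k0N nN; clear; lia.
  apply: (@le_trans _ _ (sk k0 * vnorm (y k))).
    by rewrite ler_wpM2r ?vnorm_ge0 ?mu_le.
  apply: smin_window_le => // [P Q PQ|P Pk].
    by rewrite /B tridiag_partE (negbTE PQ).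
  rewrite mxE; have [h|h] : (tagnat.sig1 P + k <= N)%N \/ (N + n.+1 <= tagnat.sig1 P + k)%N.
  - move: Pk (ltn_ord k) (ltn_ord (tagnat.sig1 P)) nN; rewrite /k0.
    move: (nat_of_ord (tagnat.sig1 P)) (nat_of_ord k) => p q; clear; lia.
  - by rewrite /w weight_left ?mul0r.
  - by rewrite /w weight_right ?mul0r.
pose I := 'I_(N + n.+1).
have lower : mu * c <= l2 (fun kP : I * 'I_M => Z kP.1 kP.2 0).
  have yE : l2 (fun kP : I * 'I_M => y kP.1 kP.2 0) = c.
    have -> : c = c * l2 (fun P => x P 0) by rewrite -vnormE x1 mulr1.
    rewrite -(@l2_pair_weighted _ _ m I (fun k P => w (tagnat.sig1 P + k)%N)) ?(ltW c0) //.
      by apply: eq_l2 => -[k P]; rewrite mxE.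
    by move=> P _; exact: sum_sqr_weight.
  rewrite -yE -ler_sqr ?nnegrE ?mulr_ge0 ?l2_ge0 // exprMn !sqr_l2.
  rewrite -(pair_big xpredT xpredT (fun (k : I) P => normc (y k P 0) ^+ 2)) /=.
  rewrite -(pair_big xpredT xpredT (fun (k : I) P => normc (Z k P 0) ^+ 2)) /=.
  rewrite mulr_sumr; apply: ler_sum => k _.
  rewrite -(sqr_l2 (fun P => y k P 0)) -(sqr_l2 (fun P => Z k P 0)) -!vnormE -exprMn.
  by rewrite ler_sqr ?nnegrE ?mulr_ge0 ?vnorm_ge0.
pose a0 (k : I) (P : 'I_M) := w (tagnat.sig1 P + k)%N.
pose a1 (k : I) (P : 'I_M) := w ((tagnat.sig1 P).+1 + k)%N - w (tagnat.sig1 P + k)%N.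
pose a2 (k : I) (P : 'I_M) := w ((tagnat.sig1 P).-1 + k)%N - w (tagnat.sig1 P + k)%N.
have d0 : 0 <= 2 * sn * c by rewrite !mulr_ge0 ?(ltW c0).
have upper : l2 (fun kP : I * 'I_M => Z kP.1 kP.2 0) <=
    c * l2 F + (2 * sn * c * l2 U + 2 * sn * c * l2 L).
  have FE : l2 (fun kP : I * 'I_M => (a0 kP.1 kP.2)%:C%C * F kP.2) = c * l2 F.
    apply: l2_pair_weighted; first exact: ltW.
    by move=> P _; exact: sum_sqr_weight.
  have UE : l2 (fun kP : I * 'I_M => (a1 kP.1 kP.2)%:C%C * U kP.2) = 2 * sn * c * l2 U.
    apply: l2_pair_weighted => // P _; rewrite -(sum_sqr_weight_diff R n (Pn P)).
    by apply: eq_bigr => k _; rewrite /a1 addSn.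
  have LE : l2 (fun kP : I * 'I_M => (a2 kP.1 kP.2)%:C%C * L kP.2) = 2 * sn * c * l2 L.
    apply: l2_pair_weighted => // P LP.
    (* The first block row has no lower part, so the predecessor is a true one. *)
    have Ppos : (0 < tagnat.sig1 P)%N.
      rewrite lt0n; apply: contra LP => /eqP P0; rewrite /L /lower_part big1 // => Q _.
      by rewrite P0 mul0r.
    have bN : ((tagnat.sig1 P).-1 <= N)%N by rewrite (leq_trans (leq_pred _)).
    rewrite -(sum_sqr_weight_diff R n bN).
    apply: eq_bigr => k _; rewrite /a2 -[in X in _ - X](prednK Ppos) addSn.
    by rewrite -sqrrN opprB.
  have -> : l2 (fun kP : I * 'I_M => Z kP.1 kP.2 0) =
      l2 (fun kP : I * 'I_M => (a0 kP.1 kP.2)%:C%C * F kP.2 +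
        ((a1 kP.1 kP.2)%:C%C * U kP.2 + (a2 kP.1 kP.2)%:C%C * L kP.2)).
    by apply: eq_l2 => -[k P]; exact: (tridiag_commutator A l x (fun b => w (b + k)%N)).
  apply: le_trans (l2D _ _) _; rewrite -FE -UE -LE lerD2l; exact: l2D.
have snE : sn = sin (pi / (2 * n%:R + 2)) by rewrite /sn half_angle.
have epsE : eps' n A = 2 * (r_L A + r_U A) * sn + mxnorm (A - B) by rewrite snE.
move: (le_trans lower upper) Fle Ule Lle; rewrite epsE.
exact: (window_budget c0 sn0).
Qed.

End PseudospectrumInGamma.

(** * Windows of a Toeplitz matrix are finite sections *)

Section GammaOfToeplitz.
Variables (R : realType) (a : int -> R[i]) (K : R).
Hypothesis aK : l1_bound (fun j => normc (a j)) K.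
Variables (N : nat) (m : 'I_N -> nat).
Local Notation C := R[i].
Local Notation M := (\sum_i m i)%N.
Local Notation A := (toeplitz_mx a M).

Lemma nonadjacent_distance (P Q : 'I_M) : ~~ adjacent P Q ->
  (min_block_size m <= `|(P : nat)%:Z - (Q : nat)%:Z|)%N.
Proof.
rewrite /adjacent negb_and -!ltnNge => /orP[] /nonadjacent_far.
  by move: (nat_of_ord P) (nat_of_ord Q) => p q; clear; lia.
by move: (nat_of_ord P) (nat_of_ord Q) => p q; clear; lia.
Qed.

Variables (J : nat) (e : R).
Hypothesis tailJ : l1_bound (fun j => if (J <= `|j|)%N then normc (a j) else 0) e.
Hypothesis Jw : (J <= min_block_size m)%N.

(** Entries outside the block tridiagonal part are at distance at least the minimal
    block size from the diagonal. *)
Lemma tridiag_error : mxnorm (A - tridiag_part A) <= e.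
Proof.
apply: mxnorm_le; first exact: l1_bound_ge0 tailJ.
move=> x; rewrite !vnormE.
have -> : l2 (fun i => ((A - tridiag_part A) *m x) i 0) =
  l2 (fun i => \sum_j (A - tridiag_part A) i j * x j 0).
  by apply: eq_l2 => i; rewrite mulmx_col.
apply: (@schur_test_shift _ _ _ (fun i : 'I_M => (i : nat)%:Z)
  (fun j : 'I_M => (j : nat)%:Z) _ _ _ _ _ _ tailJ).
- by move=> i j [/val_inj].
- by move=> i j [/val_inj].
move=> i j.
have -> : (A - tridiag_part A) i j = A i j - tridiag_part A i j.
  by move: (tridiag_part A) => B; rewrite !mxE.
rewrite tridiag_partE; case: ifP => [_|/negbT ij].
  by rewrite subrr normc0; case: ifP; rewrite ?normc_ge0.
by rewrite subr0 (leq_trans Jw (nonadjacent_distance ij)) mxE.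
Qed.

Lemma submxblock_norm i j : mxnorm (submxblock A i j) <= K.
Proof.
apply: mxnorm_le; first exact: l1_bound_ge0 aK.
move=> x; rewrite !vnormE.
have -> : l2 (fun p => (submxblock A i j *m x) p 0) =
  l2 (fun p => \sum_q submxblock A i j p q * x q 0).
  by apply: eq_l2 => p; rewrite mulmx_col.
have rI (k : 'I_N) : injective (fun p : 'I_(m k) => (tagnat.Rank k p : nat)%:Z).
  by move=> p q /= [/eqP]; rewrite tagnat.eq_Rank eqxx => /eqP/val_inj.
apply: (@schur_test_shift _ _ _ (fun p : 'I_(m i) => (tagnat.Rank i p : nat)%:Z)
  (fun q : 'I_(m j) => (tagnat.Rank j q : nat)%:Z) _ _ _ _ (rI i) (rI j) aK).
by move=> p q; rewrite !mxE.
Qed.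

Lemma eps'_le n : eps' n A <= 4 * K * sin (pi / (2 * n%:R + 2)) + e.
Proof.
have K0 := l1_bound_ge0 aK.
rewrite /eps' lerD ?tridiag_error // ler_wpM2r //.
  by rewrite -half_angle sin_half_ge0.
have : r_L A <= K by apply: r_L_le => // i j; exact: submxblock_norm.
have : r_U A <= K by apply: r_U_le => // i j; exact: submxblock_norm.
by lra.
Qed.

(** Dropping the first and last block rows lowers the smallest singular value, and what
    remains is the block tridiagonal part of a section of order at least [n]. *)
Lemma Gamma_section n (eps : R) l :
  (forall i, (0 < m i)%N) -> (0 < n)%N -> (n <= N)%N ->
  Gamma n eps A l ->
  exists2 M', (n <= M')%N & smin (toeplitz_mx a M' - l%:M) <= eps + eps' n A + e.
Proof.
move=> m0 n0 nN [k /= kN Gk].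
have kn : (k + n <= N)%N by move: kN nN; clear; lia.
have nM := window_ge kn m0.
have Mpos := leq_trans n0 nM.
exists (\sum_(j < n) msize m k j)%N => //.
rewrite -lerBlDr; apply: le_trans Gk.
apply: le_trans (smin_Bnk_le _ _ Mpos).
have [g [gE g1 gv _]] := window_embedding m kn.
set T := toeplitz_mx a _.
have -> : Bnk n k (tridiag_part A) - l%:M = (T - l%:M) + (Bnk n k (tridiag_part A) - T).
  by rewrite [RHS]addrC subrKA.
apply: smin_perturb => // x; rewrite !vnormE.
have -> : l2 (fun i => ((Bnk n k (tridiag_part A) - T) *m x) i 0) =
  l2 (fun i => \sum_j (Bnk n k (tridiag_part A) - T) i j * x j 0).
  by apply: eq_l2 => i; rewrite mulmx_col.
apply: (@schur_test_shift _ _ _ (fun i : 'I_(\sum_(j < n) msize m k j) => (i : nat)%:Z)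
  (fun j : 'I_(\sum_(j < n) msize m k j) => (j : nat)%:Z) _ _ _ _ _ _ tailJ).
- by move=> i j [/val_inj].
- by move=> i j [/val_inj].
move=> s t.
have -> : (Bnk n k (tridiag_part A) - T) s t = Bnk n k (tridiag_part A) s t - T s t.
  by move: (Bnk n k _) => B; rewrite !mxE.
have gst : (g s : nat)%:Z - (g t : nat)%:Z = (s : nat)%:Z - (t : nat)%:Z.
  by rewrite !gv !PoszD opprD addrACA subrr add0r.
rewrite (BnkE _ gE) tridiag_partE.
have -> : A (g s) (g t) = T s t by rewrite !mxE gst.
case: ifP => [_|/negbT st].
  by rewrite subrr normc0; case: ifP; rewrite ?normc_ge0.
rewrite sub0r normcN -gst (leq_trans Jw (nonadjacent_distance st)) mxE.
by rewrite gst.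
Qed.

End GammaOfToeplitz.

Lemma sin_window_small (R : realType) (d : R) : 0 < d ->
  exists n0, forall n, (n0 <= n)%N -> sin (pi / (2 * n%:R + 2)) <= d.
Proof.
move=> d0; have := @continuous_sin R 0.
move=> /cvgrPdist_lt/(_ _ d0)/nbhs_ballP[r /= r0 rP].
exists (Num.truncn (pi / r)).+1 => n nn.
have n1 : 0 < 2 * n%:R + 2 :> R by rewrite ltr_wpDl // mulr_ge0.
have p0 := @pi_gt0 R.
have : ball 0 r (pi / (2 * n%:R + 2)).
  rewrite /ball /= sub0r normrN gtr0_norm ?divr_gt0 //.
  rewrite ltr_pdivrMr // mulrC -ltr_pdivrMr //.
  apply: (lt_le_trans (truncnS_gt _)).
  apply: (@le_trans _ _ n%:R); first by rewrite ler_nat.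
  have := ler0n R n; lra.
move=> /rP; rewrite sin0 sub0r normrN => /ltW; apply: le_trans.
exact: ler_norm.
Qed.

(** * Convergence *)

Section Convergence.
Variables (R : realType) (a : int -> R[i]) (K : R).
Hypothesis aK : l1_bound (fun j => normc (a j)) K.
Variable eps : R.
Hypothesis eps0 : 0 <= eps.
Hypothesis np : no_plateau a eps.
Local Notation X := (ell2_pspec eps (toeplitz_op a)).

Lemma section_within (d : R) : 0 < d -> exists M0, forall M, (0 < M)%N -> (M0 <= M)%N ->
  within_dist d (mx_pspec eps (toeplitz_mx a M)) X /\
  within_dist d X (mx_pspec eps (toeplitz_mx a M)).
Proof.
move=> d0; have [eta eta0 [M1 M1P]] := sections_in_pspec aK eps0 d0.
have [M2 M2P] := pspec_in_sections aK eps0 np d0.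
exists (maxn M1 M2) => M M0; rewrite geq_max => /andP[M1M M2M].
split=> [z|z /(M2P M M0 M2M)[t tE zt]].
  rewrite mx_pspecE // => zE; apply: (M1P M M0 M1M).
  by rewrite /= (le_trans zE) // lerDl ltW.
by exists t; rewrite ?mx_pspecE.
Qed.

Lemma Gamma_within (d : R) : 0 < d -> exists K0, forall N (m : 'I_N -> nat) n,
  (forall i, (0 < m i)%N) -> (1 <= n <= N - 1)%N -> (K0 <= n)%N ->
  (K0 <= min_block_size m)%N ->
  within_dist d (Gamma n eps (toeplitz_mx a (\sum_i m i))) X.
Proof.
move=> d0; have [eta eta0 [M1 M1P]] := sections_in_pspec aK eps0 d0.
have K0 := l1_bound_ge0 aK.
have e0 : 0 < eta / 4 by rewrite divr_gt0.
have [J tailJ] := l1_bound_tail aK e0.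
have [|n1 n1P] := @sin_window_small R (eta / 4 / (4 * K + 1)).
  by rewrite divr_gt0 //; lra.
exists (maxn M1 (maxn n1 J)) => N m n m0 /andP[n0 nN].
rewrite !geq_max => /and3P[M1n n1n _] /and3P[_ _ Jw] l.
have nN' : (n <= N)%N by rewrite (leq_trans nN) // leq_subr.
move=> /(Gamma_section tailJ Jw m0 n0 nN')[M' nM' sM'].
apply: (M1P M' (leq_trans n0 nM') (leq_trans M1n nM')); apply: (le_trans sM').
have := eps'_le aK tailJ Jw n.
have : 4 * K * sin (pi / (2 * n%:R + 2)) <= eta / 4.
  apply: (@le_trans _ _ (4 * K * (eta / 4 / (4 * K + 1)))).
    by rewrite ler_wpM2l ?mulr_ge0 // n1P.
  have K1 : 0 < 4 * K + 1 by lra.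
  rewrite mulrCA ler_piMr ?(ltW e0) // ler_pdivrMr //; lra.
move: (sin _) (eps' _ _) => u v; lra.
Qed.

End Convergence.

Lemma section_sub_Gamma (R : realType) (a : int -> R[i]) (eps : R) N (m : 'I_N -> nat) n :
  (0 < \sum_i m i)%N -> (1 <= n <= N - 1)%N ->
  mx_pspec eps (toeplitz_mx a (\sum_i m i)) `<=` Gamma n eps (toeplitz_mx a (\sum_i m i)).
Proof.
move=> M0 /andP[n0 nN] l; rewrite mx_pspecE // => lE.
by apply: pspec_sub_Gamma => //; rewrite (leq_trans nN) // leq_subr.
Qed.

Lemma mx_specE (R : realType) n (E : 'M[R[i]]_n) : (0 < n)%N ->
  mx_spec E = mx_pspec 0 E.
Proof.
move=> n0; apply/funext => l; rewrite mx_pspecE // smin_eq0 //.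
Qed.

Lemma within_dist_sub (R : realType) (d : R) (X Y Z : set R[i]) :
  Y `<=` Z -> within_dist d X Y -> within_dist d X Z.
Proof. by move=> YZ XY z /XY[t /YZ Zt zt]; exists t. Qed.

Lemma sub_within_dist (R : realType) (d : R) (X Y : set R[i]) :
  0 < d -> X `<=` Y -> within_dist d X Y.
Proof. by move=> d0 XY z /XY Yz; exists z; rewrite // subrr normc0. Qed.

Unset Implicit Arguments.

Theorem theorem5p9 (R : realType) (a : int -> R[i])
    (sum_a : (\esum_(j in [set: int]) (normc (a j))%:E < +oo)%E) :
  (forall eps : R,
     0 < eps \/ (eps = 0 /\ forall j : int, a (- j) = conjc (a j)) ->
     [/\ forall delta : R, 0 < delta -> exists K : nat,
           forall M : nat, (1 < M)%N -> (K <= M)%N ->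
             (hausdorff_dist (mx_pspec eps (toeplitz_mx a M))
                (ell2_pspec eps (toeplitz_op a)) < delta%:E)%E,
         block_cvg0 (fun N m n =>
           hausdorff_dist (Gamma n eps (toeplitz_mx a (\sum_i m i)%N))
             (ell2_pspec eps (toeplitz_op a)))
       & block_cvg0 (fun N m n =>
           hausdorff_dist (Gamma n eps (toeplitz_mx a (\sum_i m i)%N))
             (mx_pspec eps (toeplitz_mx a (\sum_i m i)%N)))]) /\
  ((forall j : int, a (- j) = conjc (a j)) ->
     block_cvg0 (fun N m n =>
       hausdorff_dist (Gamma n 0 (toeplitz_mx a (\sum_i m i)%N))
         (mx_spec (toeplitz_mx a (\sum_i m i)%N)))).
Proof.
have [K aK] := esum_l1_bound (fun j => normc_ge0 (a j)) sum_a.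
have Mpos N (m : 'I_N -> nat) n : (forall i, 0 < m i)%N -> (1 <= n <= N - 1)%N ->
    (0 < \sum_i m i)%N.
  move=> m0 /andP[n0 nN]; have N0 : (0 < N)%N.
    by apply: leq_trans (leq_subr 1 N); exact: leq_trans n0 nN.
  by rewrite (bigD1 (Ordinal N0)) //= addn_gt0 m0.
have main (eps : R) : 0 < eps \/ (eps = 0 /\ forall j : int, a (- j) = conjc (a j)) ->
  0 <= eps /\ no_plateau a eps.
  case=> [e0|[-> herm]]; first by split; [exact: ltW|exact: (no_plateau_pos aK e0)].
  by split=> //; exact: no_plateau_hermitian.
have third (eps : R) : 0 < eps \/ (eps = 0 /\ forall j : int, a (- j) = conjc (a j)) ->
  block_cvg0 (fun N m n =>
    hausdorff_dist (Gamma n eps (toeplitz_mx a (\sum_i m i)%N))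
      (mx_pspec eps (toeplitz_mx a (\sum_i m i)%N))).
  move=> /main[e0 np] d d0; have d4 : 0 < d / 2 / 2 by rewrite !divr_gt0.
  have [M0 M0P] := section_within aK e0 np d4.
  have [K0 K0P] := Gamma_within aK e0 d4.
  exists (maxn M0 K0) => N m n N1 m0 nN; rewrite !geq_max.
  move=> /andP[_ Kn] /andP[MM _] /andP[_ Kw].
  have MM0 := Mpos N m n m0 nN.
  have [_ XA] := M0P _ MM0 MM.
  apply: hausdorff_dist_lt => //.
    by rewrite [d / 2]splitr; apply: within_dist_trans XA; exact: K0P.
  by apply: sub_within_dist; [rewrite divr_gt0|exact: section_sub_Gamma].
split=> [eps heps|herm]; last first.
  move=> d d0; have [K0 K0P] := third 0 (or_intror (conj erefl herm)) d d0.
  exists K0 => N m n N1 m0 nN Kn KM Kw.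
  by rewrite mx_specE ?(Mpos N m n) //; exact: K0P.
have [e0 np] := main eps heps; split; last exact: third.
- move=> d d0; have [M0 M0P] := section_within aK e0 np (divr_gt0 d0 (ltr0Sn R 1)).
  exists M0 => M M1 MM; have [XA AX] := M0P M (ltnW M1) MM.
  exact: hausdorff_dist_lt.
- move=> d d0; have d2 : 0 < d / 2 by rewrite divr_gt0.
  have [M0 M0P] := section_within aK e0 np d2.
  have [K0 K0P] := Gamma_within aK e0 d2.
  exists (maxn M0 K0) => N m n N1 m0 nN; rewrite !geq_max.
  move=> /andP[_ Kn] /andP[MM _] /andP[_ Kw].
  have MM0 := Mpos N m n m0 nN.
  have [_ XA] := M0P _ MM0 MM.
  apply: hausdorff_dist_lt => //; first exact: K0P.
  by apply: within_dist_sub XA; exact: section_sub_Gamma.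
Qed.
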